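(* A quasielliptic pseudo-differential operator $p(-\Delta)$ on $X=X_1\times X_2$ is equal to an elliptic pseudo-differential operator on $X$; that is, there is an elliptic symbol $q$ with $p(-\Delta)=q(-\Delta)$.
   Context: Fractals. Let $K=\bigcup_{i=1}^M F_i(K)$ be the self-similar set of contractions $F_1,\dots,F_M$ of Euclidean space; for a word $\omega=\omega_1\cdots\omega_n$ put $F_\omega=F_{\omega_1}\circ\dots\circ F_{\omega_n}$. $K$ is post-critically finite (p.c.f.) if there is a subset $V_0$ of the fixed points of the $F_i$ (the boundary) with $F_\omega(K)\cap F_{\omega'}(K)\subseteq F_\omega(V_0)\cap F_{\omega'}(V_0)$ for all distinct words of equal length. $K$ carries a self-similar Dirichlet energy $\mathcal{E}(u)=\sum_i r_i^{-1}\mathcal{E}(u\circ F_i)$, a self-similar probability measure $\mu$, and the Laplacian defined weakly by $\Delta u=f$ iff $\mathcal{E}(u,v)=-\int fv\,d\mu$ for all $v\in\operatorname{dom}\mathcal{E}$ vanishing on $V_0$. A fractafold based on $K$ is a union of copies of $K$ of the same size glued at boundary points (without boundary if all boundary points are paired); these structures extend to it. Setting. $X=X_1\times X_2$, where $X_1,X_2$ are two copies of the same fractafold without boundary; $\Delta_1,\Delta_2$ are its Laplacian acting on $X_1$, $X_2$, and $\Delta=(\Delta_1,\Delta_2)$. If the fractafold is not compact, its Laplacian has pure point spectrum. Its heat kernel satisfies $h_t(x,y)\le c_1t^{-d/(d+1)}\exp(-c_2(R(x,y)^{d+1}/t)^\gamma)$ with positive constants, $R$ the resistance metric. The fractafold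 has a spectral gap $(\alpha,\beta)$, $\alpha<\beta$: $\lambda/\lambda'\notin(\alpha,\beta)$ for all $\lambda\ne\lambda'$ in the spectrum of its (negative) Laplacian. Symbols. $S^m$ ($m\in\mathbb{Z}$) is the set of smooth $p:(0,\infty)^2\to\mathbb{C}$ such that for every $\nu\in\mathbb{N}^2$ there is $C_\nu>0$ with $\lambda^\nu\left|\frac{\partial^\nu}{\partial\lambda^\nu}p(\lambda)\right|\le C_\nu(1+|\lambda|)^{\frac{m}{d+1}}$, where $\lambda^\nu=\lambda_1^{\nu_1}\lambda_2^{\nu_2}$. $p(-\Delta)u=\int_{(0,\infty)^2}p(\lambda)\,dP_\lambda(u)$, with $P_\lambda=P_{\lambda_1}\otimes P_{\lambda_2}$ the product spectral decomposition. $p\in S^m$ (and $p(-\Delta)$) is elliptic of order $m$ if there are $c,A>0$ with $|p(\lambda)|\ge c|\lambda|^{\frac{m}{d+1}}$ for all $\lambda\in\mathbb{R}^2_+$ with $|\lambda|\ge A$. Quasielliptic symbols. For $a\in(\alpha,\beta)$ and $\varepsilon>0$ let $\Gamma_{a,\varepsilon}=\{(\lambda_1,\lambda_2)\in\mathbb{R}^2_+:|\lambda_1-a\lambda_2|<\varepsilon\lambda_2\}$. $\mathfrak{G}$ is the collection of such cones that contain no pair of eigenvalues (no point $(\lambda_1,\lambda_2)$ with $\lambda_i$ an eigenvalue of $-\Delta_i$). $\mathcal{G}$ is the collection of cones in $\mathbb{R}^2_+$ that do not intersect any cone in $\mathfrak{G}$. A symbol $p\in S^m$ is quasielliptic if $|p(\lambda)|\ge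 c|\lambda|^{\frac{m}{d+1}}$ for all $\lambda\in\Gamma$ with $|\lambda|\ge A$, for all $\Gamma\in\mathcal{G}$, with the constant $A$ depending on $\Gamma$; $p(-\Delta)$ is quasielliptic if $p$ is a quasielliptic symbol. *)

(* Defs.v *)
From HB Require Import structures.
From mathcomp Require Import all_boot all_order all_algebra.
From mathcomp Require Import all_classical all_reals all_analysis.
From mathcomp Require Import complex.
Set Implicit Arguments.
Unset Strict Implicit.
Unset Printing Implicit Defensive.
Import Order.TTheory GRing.Theory Num.Theory.
Import numFieldNormedType.Exports.
Local Open Scope classical_set_scope.
Local Open Scope ring_scope.

Notation cabs := ComplexField.Normc.normc.
Notation rtoc x := (Complex x 0%R).

Definition borel (T : ptopologicalType) := g_sigma_algebraType (@open T).

(** * The space L^2(mu; C), and spectral measures on it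

    Elements of L^2 are represented by functions, identified when they are
    equal mu-almost everywhere. *)

Section L2.
Context (d : measure_display) (T : measurableType d) (R : realType).
Variable mu : {measure set T -> \bar R}.
Implicit Types u v w : T -> R[i].

Definition realL2 (u : T -> R) : Prop := u \in Lfun mu 2%:E.

Definition L2 u : Prop :=
  realL2 (@complex.Re R \o u) /\ realL2 (@complex.Im R \o u).

Definition cintegral u : R[i] :=
  Complex (\int[mu]_x complex.Re (u x)) (\int[mu]_x complex.Im (u x)).

Definition inner u v : R[i] := cintegral (fun x => u x * (v x)^*%C).

(* the square of the L^2 norm *)
Definition normsq u : R := \int[mu]_x (cabs (u x) ^+ 2).

Section spectral_measure.
Context (d' : measure_display) (S : measurableType d').
Variable P : set S -> (T -> R[i]) -> (T -> R[i]).

(* Countable additivity: A |-> <P A u, u> = |P A u|^2 is a measure. *)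
Record is_spectral_measure : Prop := {
  spm_L2 : forall A u, measurable A -> L2 u -> L2 (P A u) ;
  spm_ae : forall A u v, measurable A -> L2 u -> L2 v ->
    u = v %[ae mu] -> P A u = P A v %[ae mu] ;
  spm_linear : forall A (a : R[i]) u v, measurable A -> L2 u -> L2 v ->
    P A (fun x => a * u x + v x)
      = (fun x => a * P A u x + P A v x) %[ae mu] ;
  spm_sym : forall A u v, measurable A -> L2 u -> L2 v ->
    inner (P A u) v = inner u (P A v) ;
  spm_setI : forall A B u, measurable A -> measurable B -> L2 u ->
    P A (P B u) = P (A `&` B) u %[ae mu] ;
  spm_setT : forall u, L2 u -> P setT u = u %[ae mu] ;
  spm_sigma_additive : forall u, L2 u ->
    exists m : {measure set S -> \bar R},
      forall A, measurable A -> m A = (normsq (P A u))%:E }.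

(* [spectral_integral D g u w] means that u is in the domain of the (possibly
   unbounded) operator "integral over D of g dP" and that w is its value at u:
   with m A = |P A u|^2, there are simple functions s = sum_i c_i 1_(A_i) that
   approach g in L^2(D, m) while sum_i c_i P(A_i `&` D) u approaches w. *)
Definition spectral_integral (D : set S) (g : S -> R[i]) u w : Prop :=
  L2 u /\ L2 w /\
  exists m : {measure set S -> \bar R},
    (forall A, measurable A -> m A = (normsq (P A u))%:E) /\
    forall e : R, 0 < e ->
    exists (k : nat) (c : 'I_k -> R[i]) (A : 'I_k -> set S),
      [/\ forall i, measurable (A i),
          (\int[m]_(s in D)
             (cabs (g s - \sum_(i < k) c i * rtoc (\1_(A i) s)) ^+ 2)%:E
             < e%:E)%E
        & normsq (fun x => w x - \sum_(i < k) c i * P (A i `&` D) u x) < e].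

End spectral_measure.
End L2.

(** * Post-critically finite fractals *)

Section fractal.
Context (R : realType) (n : nat).
Local Notation E := 'rV[R]_n.

(* The library norm of 'rV is the sup norm. *)
Definition euclid_norm (x : E) : R := Num.sqrt (\sum_(i < n) x ord0 i ^+ 2).

Definition euclid_contraction (f : E -> E) : Prop :=
  exists2 c : R, c < 1 &
    forall x y, euclid_norm (f x - f y) <= c * euclid_norm (x - y).

Definition self_similar_set M (F : 'I_M -> E -> E) (K : set E) : Prop :=
  [/\ compact K, K !=set0 & K = \bigcup_(i in [set: 'I_M]) (F i @` K)].

Definition Fword M (F : 'I_M -> E -> E) (w : seq 'I_M) (x : E) : E :=
  foldr (fun i y => F i y) x w.

Definition pcf M (F : 'I_M -> E -> E) (K V0 : set E) : Prop :=
  (forall x, V0 x -> exists i, F i x = x) /\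
  (forall w w' : seq 'I_M, size w = size w' -> w <> w' ->
    Fword F w @` K `&` (Fword F w' @` K)
      `<=` Fword F w @` V0 `&` (Fword F w' @` V0)).

(* An energy is given by its quadratic form, with value +oo off its domain;
   it is a function of the restriction to K only. *)
Record dirichlet_energy (K : set E) (en : (E -> R) -> \bar R) : Prop := {
  energy_ge0 : forall u, (0 <= en u)%E ;
  energy_on : forall u v, (forall x, K x -> u x = v x) -> en u = en v ;
  energy_continuous : forall u, (en u < +oo)%E -> {within K, continuous u} ;
  energyZ : forall (a : R) u,
    en (fun x => a * u x) = ((a ^+ 2)%:E * en u)%E ;
  energy_parallelogram : forall u v,
    (en (fun x => u x + v x)%R + en (fun x => u x - v x)%R
      = 2%:E * en u + 2%:E * en v)%E ;
  energy_eq0 : forall u,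
    en u = 0%E <-> (forall x y, K x -> K y -> u x = u y) ;
  energy_markov : forall u : E -> R,
    (en (fun x => Num.min (Num.max (u x) 0%R) 1%R)%R <= en u)%E ;
  energy_complete : forall u_ : nat -> E -> R,
    (forall k, (en (u_ k) < +oo)%E) ->
    (forall e : R, 0 < e -> exists N, forall k l, (N <= k)%N -> (N <= l)%N ->
       (en (fun x => u_ k x - u_ l x)%R < e%:E)%E) ->
    exists2 u, (en u < +oo)%E &
      (fun k => en (fun x => u_ k x - u x)) @ \oo --> 0%E ;
  energy_regular : forall f : E -> R, {within K, continuous f} ->
    forall e : R, 0 < e ->
    exists2 u, (en u < +oo)%E & forall x, K x -> `|f x - u x| <= e }.

Definition self_similar_energy M (F : 'I_M -> E -> E) (r : 'I_M -> R)
    (en : (E -> R) -> \bar R) : Prop :=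
  (forall i, 0 < r i) /\
  forall u, en u = (\sum_(i < M) (r i)^-1%:E * en (u \o F i))%E.

Definition self_similar_measure M (F : 'I_M -> E -> E) (K : set E)
    (mu : probability (borel E) R) : Prop :=
  mu K = 1%E /\
  exists w : 'I_M -> R, [/\ forall i, 0 < w i, \sum_(i < M) w i = 1 &
    forall A : set (borel E), measurable A ->
      mu A = (\sum_(i < M) (w i)%:E * mu (F i @^-1` A))%E].

Record pcf_fractal := PcfFractal {
  nmaps : nat ;
  ifs : 'I_nmaps -> E -> E ;
  fset_of : set E ;
  bdry : set E ;
  resist : 'I_nmaps -> R ;
  energy : (E -> R) -> \bar R ;
  fmeasure : probability (borel E) R ;
  ifs_contraction : forall i, euclid_contraction (ifs i) ;
  fractal_self_similar : self_similar_set ifs fset_of ;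
  fractal_pcf : pcf ifs fset_of bdry ;
  fractal_energy : dirichlet_energy fset_of energy ;
  fractal_energy_self_similar : self_similar_energy ifs resist energy ;
  fractal_measure : self_similar_measure ifs fset_of fmeasure }.

End fractal.

(** * Fractafolds *)

Section fractafold_def.
Context (R : realType) (n : nat) (S : pcf_fractal R n).
Local Notation E := 'rV[R]_n.
Local Notation K := (fset_of S).

(* Copies of K, indexed by a countable type [cell], are glued at boundary
   points only; the space has the quotient topology, and its measure is the
   sum of the measures of the copies. *)
Record fractafold := Fractafold {
  cell : countType ;
  fpoints :> ptopologicalType ;
  chart : cell -> E -> fpoints ;
  volume : {sigma_finite_measure set (borel fpoints) -> \bar R} ;
  chart_cover : forall x, exists c, exists2 y, K y & chart c y = x ;
  chart_glue : forall c c' y y', K y -> K y' -> chart c y = chart c' y' ->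
    (c = c' /\ y = y') \/ (bdry S y /\ bdry S y') ;
  chart_open : forall U : set fpoints, open U <->
    forall c, exists2 V : set E, open V &
      forall y, K y -> (U (chart c y) <-> V y) ;
  volumeE : forall A : set (borel fpoints), measurable A ->
    volume A = (\esum_(c in [set: cell])
                  fmeasure S (K `&` (chart c @^-1` A)))%E }.

Definition without_boundary (X : fractafold) : Prop :=
  forall (c : cell X) (y : E), bdry S y ->
    exists! p : cell X * E,
      [/\ bdry S p.2, p <> (c, y) & chart p.1 p.2 = chart c y].

Section operators.
Variable X : fractafold.
Local Notation B := (borel X).
Local Notation mu := (volume X).

Definition fenergy (u : X -> R) : \bar R :=
  (\esum_(c in [set: cell X]) energy S (u \o chart c))%E.

Definition fdom (u : X -> R) : Prop :=
  realL2 mu (u : B -> R) /\ (fenergy u < +oo)%E.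

(* the bilinear form, by polarization *)
Definition fenergy2 (u v : X -> R) : R :=
  (fine (fenergy (fun x => u x + v x)) - fine (fenergy (fun x => u x - v x)))
    / 4.

(* [laplacian u f] means Delta u = f.  There is no boundary condition on the
   test functions v, as the fractafolds considered have no boundary; u is an
   L^2 class, whence the representative of finite energy. *)
Definition laplacian (u f : B -> R) : Prop :=
  realL2 mu f /\
  exists u0 : X -> R,
    [/\ fdom u0, (u0 : B -> R) = u %[ae mu] &
        forall v : X -> R, fdom v ->
          fenergy2 u0 v = - \int[mu]_x (f x * (v : B -> R) x)].

Definition claplacian (u f : B -> R[i]) : Prop :=
  laplacian (@complex.Re R \o u) (@complex.Re R \o f) /\
  laplacian (@complex.Im R \o u) (@complex.Im R \o f).

(* - Delta u = l u *)
Definition eigenfunction (l : R) (u : B -> R[i]) : Prop :=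
  L2 mu u /\ claplacian u (fun x => - (rtoc l * u x)).

Definition lap_eigenvalue (l : R) : Prop :=
  exists2 u, eigenfunction l u & ~ (u = (fun=> 0) %[ae mu]).

(* (- Delta - l) u = f *)
Definition resolvent_eq (l : R) (u f : B -> R[i]) : Prop :=
  L2 mu u /\ claplacian u (fun x => - (rtoc l * u x) - f x).

(* - Delta - l is a bijection from its domain to L^2 with bounded inverse *)
Definition in_resolvent_set (l : R) : Prop :=
  exists C : R, forall f, L2 mu f ->
    exists u, [/\ resolvent_eq l u f, normsq mu u <= C * normsq mu f &
      forall u', resolvent_eq l u' f -> u' = u %[ae mu]].

(* Only real l are needed, - Delta being self-adjoint. *)
Definition spectrum : set R := [set l | ~ in_resolvent_set l].

Definition pure_point_spectrum : Prop :=
  forall u, L2 mu u -> forall e : R, 0 < e ->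
    exists (k : nat) (l : 'I_k -> R) (phi : 'I_k -> B -> R[i]),
      (forall i, eigenfunction (l i) (phi i)) /\
      normsq mu (fun x => u x - \sum_(i < k) phi i x) < e.

(* - Delta is the integral of l dP_l *)
Definition spectral_resolution
    (P : set R -> (B -> R[i]) -> (B -> R[i])) : Prop :=
  is_spectral_measure mu P /\
  forall u f, L2 mu u -> L2 mu f ->
    (claplacian u f <->
     spectral_integral mu P setT (fun l : R => rtoc l) u (fun x => - f x)).

(* P is the product P1 (x) P1, on L^2(X x X). *)
Definition product_resolution (P1 : set R -> (B -> R[i]) -> (B -> R[i]))
    (P : set (R * R) -> (B * B -> R[i]) -> (B * B -> R[i])) : Prop :=
  is_spectral_measure (mu \x mu)%E P /\
  forall A1 A2 u1 u2, measurable A1 -> measurable A2 ->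
    L2 mu u1 -> L2 mu u2 ->
    P (A1 `*` A2) (fun x => u1 x.1 * u2 x.2)
      = (fun x => P1 A1 u1 x.1 * P1 A2 u2 x.2) %[ae (mu \x mu)%E].

Definition resistance (x y : X) : \bar R :=
  ((ereal_inf [set fenergy u | u in [set u : X -> R | u x = 0%R /\ u y = 1%R]])
     ^-1)%E.

(* h t is the integral kernel of exp(t Delta). *)
Definition heat_kernel (P : set R -> (B -> R[i]) -> (B -> R[i]))
    (h : R -> B -> B -> R) : Prop :=
  forall t : R, 0 < t ->
    [/\ measurable_fun [set: (B * B)%type] (fun x => h t x.1 x.2),
        forall x y, 0 <= h t x y &
        forall u, L2 mu u ->
          spectral_integral mu P setT (fun l : R => rtoc (expR (- (t * l)))) u
            (fun x => cintegral mu (fun y => rtoc (h t x y) * u y))].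

(* Times are restricted to t < 1: on a compact fractafold h_t tends to
   1 / volume as t grows, so the bound can only hold for bounded times. *)
Definition heat_kernel_estimate (P : set R -> (B -> R[i]) -> (B -> R[i]))
    (d : R) : Prop :=
  exists (h : R -> B -> B -> R) (c1 c2 gamma : R),
    [/\ heat_kernel P h, 0 < c1, 0 < c2, 0 < gamma &
      forall (t : R) x y, 0 < t < 1 ->
        ((h t x y)%:E <=
          (c1 * t `^ (- (d / (d + 1))))%R%:E *
          expeR (- (c2%:E * (poweR (poweR (resistance x y) (d + 1)%R
                                      * (t^-1)%R%:E) gamma))))%E].

(* For l' = 0 there is no ratio l / l'. *)
Definition spectral_gap (alpha beta : R) : Prop :=
  alpha < beta /\
  forall l l', spectrum l -> spectrum l' -> l <> l' -> l' <> 0 ->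
    ~ (alpha < l / l' < beta).

End operators.
End fractafold_def.

(** * Symbols *)

Section symbols.
Context (R : realType).

(* the open quadrant (0, +oo)^2, also written R^2_+; symbols are represented
   by functions on R * R of which only the values on [quadrant] matter *)
Definition quadrant : set (R * R) := [set l | 0 < l.1 /\ 0 < l.2].

Definition norm2 (l : R * R) : R := Num.sqrt (l.1 ^+ 2 + l.2 ^+ 2).

Definition cderivable (f : R * R -> R[i]) (l v : R * R) : Prop :=
  derivable (@complex.Re R \o f : R * R -> R) l v /\
  derivable (@complex.Im R \o f : R * R -> R) l v.

Definition cderive (v : R * R) (f : R * R -> R[i]) (l : R * R) : R[i] :=
  Complex ('D_v (@complex.Re R \o f : R * R -> R) l)
          ('D_v (@complex.Im R \o f : R * R -> R) l).

Definition e1 : R * R := (1, 0).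
Definition e2 : R * R := (0, 1).

Definition partial (nu1 nu2 : nat) (f : R * R -> R[i]) : R * R -> R[i] :=
  iter nu1 (cderive e1) (iter nu2 (cderive e2) f).

Definition smooth (f : R * R -> R[i]) : Prop :=
  forall nu1 nu2 l, quadrant l ->
    [/\ cderivable (partial nu1 nu2 f) l e1,
        cderivable (partial nu1 nu2 f) l e2,
        {for l, continuous (@complex.Re R \o partial nu1 nu2 f : R * R -> R)} &
        {for l, continuous (@complex.Im R \o partial nu1 nu2 f : R * R -> R)}].

(* the class S^m *)
Definition symbol (d : R) (m : int) (p : R * R -> R[i]) : Prop :=
  smooth p /\
  forall nu1 nu2 : nat, exists2 C : R, 0 < C &
    forall l, quadrant l ->
      l.1 ^+ nu1 * l.2 ^+ nu2 * cabs (partial nu1 nu2 p l)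
        <= C * (1 + norm2 l) `^ (m%:~R / (d + 1)).

Definition elliptic (d : R) (m : int) (p : R * R -> R[i]) : Prop :=
  symbol d m p /\
  exists c A : R, [/\ 0 < c, 0 < A &
    forall l, quadrant l -> A <= norm2 l ->
      c * norm2 l `^ (m%:~R / (d + 1)) <= cabs (p l)].

Definition Gamma (a e : R) : set (R * R) :=
  [set l | quadrant l /\ `|l.1 - a * l.2| < e * l.2].

Definition cone (G : set (R * R)) : Prop :=
  G `<=` quadrant /\ forall (s : R) l, 0 < s -> G l -> G (s * l.1, s * l.2).

(* the gothic G of cones Gamma that contain no pair of eigenvalues; [ev] is
   the set of eigenvalues of both factors *)
Definition empty_cone (ev : R -> Prop) (alpha beta : R) (G : set (R * R))
    : Prop :=
  exists a e : R, [/\ alpha < a < beta, 0 < e, G = Gamma a e &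
    forall l1 l2, ev l1 -> ev l2 -> ~ G (l1, l2)].

(* the calligraphic G *)
Definition admissible_cone (ev : R -> Prop) (alpha beta : R) (G : set (R * R))
    : Prop :=
  cone G /\ forall G', empty_cone ev alpha beta G' -> G `&` G' = set0.

Definition quasielliptic (ev : R -> Prop) (alpha beta d : R) (m : int)
    (p : R * R -> R[i]) : Prop :=
  symbol d m p /\
  exists2 c : R, 0 < c &
    forall G, admissible_cone ev alpha beta G ->
      exists2 A : R, 0 < A &
        forall l, G l -> A <= norm2 l ->
          c * norm2 l `^ (m%:~R / (d + 1)) <= cabs (p l).

End symbols.

(* [pdo P p u w]: u is in the domain of p(- Delta) and p(- Delta) u = w, where
   P is the joint spectral measure of (- Delta_1, - Delta_2). *)
Definition pdo (R : realType) (n : nat) (S : pcf_fractal R n)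
    (X : fractafold S)
    (P : set (R * R) -> (borel X * borel X -> R[i]) ->
         (borel X * borel X -> R[i]))
    (p : R * R -> R[i]) (u w : borel X * borel X -> R[i]) : Prop :=
  spectral_integral (volume X \x volume X)%E P (@quadrant R) p u w.

(* Main.v *)
(* In logarithmic coordinates the cones without pairs of eigenvalues are strips
   parallel to the diagonal.  Such a strip forces the logarithms of the eigenvalues
   into clusters of bounded diameter, mutually separated by gaps of a fixed length,
   and a product of two clusters spans a box that avoids the strips; so p, divided
   by (1 + l1 + l2)^(m/(d+1)), is bounded below on these boxes far out.  Each box is
   contractible at a uniform scale, which lets one deform p through nonvanishing
   values to a constant between boxes: the result is an elliptic symbol q that
   agrees with p near all pairs of eigenvalues.

   It remains to see that the spectral measure P of (- Delta_1, - Delta_2) does not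
   charge the points of the quadrant where q and p may differ.  By the product
   structure of P this follows from the vanishing of P1 on Borel sets of positive
   reals without eigenvalues.  If the fractafold is not compact, the spectrum is
   pure point.  If it is compact, it has finitely many cells, hence finite volume,
   and the heat kernel is bounded, so the heat operator is Hilbert-Schmidt and
   P1 restricted to a bounded interval is a sum of atoms. *)

Require Import Defs.
From HB Require Import structures.
From mathcomp Require Import finmap all_boot all_order all_algebra.
From mathcomp Require Import all_classical all_reals all_analysis.
From mathcomp Require Import measurable_realfun complex ring lra.
Import Order.TTheory GRing.Theory Num.Theory.
Import numFieldNormedType.Exports.
Local Open Scope classical_set_scope.
Local Open Scope ring_scope.

(** * Functions with controlled derivatives *)

Section smooth_class.
Context (R : realType).
Implicit Types (D : set (R * R)) (f g w : R * R -> R) (b : bool).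

(** The substitution l = exp s turns l_i d/dl_i into the translation-invariant d/ds_i. A symbol
    becomes a function all of whose derivatives obey one and the same weight, and a cutoff of fixed
    width in s is a symbol of order 0. So everything has to happen at a fixed scale: there may be
    infinitely many boxes of varying shape, and the constants may depend only on a common diameter
    [D], a separation [g], a Lipschitz constant and a lower bound of [F]. The deformation through
    nonzero values uses neither logarithm nor argument: it passes through finitely many frames,
    their number fixed by these constants, on nested neighbourhoods, and mixes each frame only with
    the next. The threshold A of quasiellipticity depends on the cone; but the part of the quadrant
    outside all empty cones is itself an admissible cone, so a single A serves. The set of
    eigenvalues need not be Borel a priori; hence p and q agree on an open neighbourhood in
    logarithmic coordinates, whose complement is the null set. *)

Definition dir b : R * R := if b then e1 R else e2 R.

(* The derivatives of f of order at most N are continuous and O(w) on D. *)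
Fixpoint Cl D (N : nat) w f : Prop :=
  [/\ exists C, forall l, D l -> `|f l| <= C * w l,
      forall l, D l -> {for l, continuous f} &
      if N is N'.+1 then
        forall b, (forall l, D l -> derivable f l (dir b)) /\
          Cl D N' w ('D_(dir b) f)
      else True].

Lemma open_near D (f g : R * R -> R) l : open D -> D l ->
  {in D, f =1 g} -> \near l, f l = g l.
Proof.
move=> oD Dl fg; have := open_nbhs_nbhs (conj oD Dl).
by apply: filterS => y Dy; apply: fg; rewrite inE.
Qed.

Lemma continuous_near (U V : topologicalType) (f g : U -> V) (l : U) :
  (\near l, f l = g l) -> {for l, continuous f} -> {for l, continuous g}.
Proof.
move=> fg cf; have fgl := nbhs_singleton fg.
by rewrite /prop_for /continuous_at -fgl; apply: cvg_trans cf; apply: near_eq_cvg.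
Qed.

Lemma Cl_congr D N w f g : open D -> {in D, f =1 g} -> Cl D N w f -> Cl D N w g.
Proof.
move=> oD; elim: N f g => [|N IH] f g fg [[C bC] cf df].
all: split; first (by exists C => l Dl; rewrite -fg ?inE//; exact: bC).
- by move=> l Dl; apply: continuous_near (cf _ Dl); exact: open_near fg.
- by [].
- by move=> l Dl; apply: continuous_near (cf _ Dl); exact: open_near fg.
move=> b; have [df1 df2] := df b; split.
  by move=> l Dl; apply: near_eq_derivable (df1 _ Dl); exact: open_near fg.
apply: IH df2 => l; rewrite inE => Dl.
by apply: near_eq_derive; exact: open_near fg.
Qed.

(** Derivatives may be given by a formula [F]; for a family closed under differentiation, membership
    then becomes an induction on the order. *)
Lemma Cl_intro D N w f (F : bool -> R * R -> R) : open D ->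
  (exists C, forall l, D l -> `|f l| <= C * w l) ->
  (forall l, D l -> {for l, continuous f}) ->
  (forall b l, D l -> is_derive l (dir b) f (F b l)) ->
  (forall b, Cl D N w (F b)) -> Cl D N.+1 w f.
Proof.
move=> oD bf cf df clF; split => // b; split.
  by move=> l Dl; have [] := df b l Dl.
apply: Cl_congr (clF b) => // l; rewrite inE => Dl.
by have ? := df b l Dl; rewrite derive_val.
Qed.

Lemma ClS D N w f : Cl D N.+1 w f -> Cl D N w f.
Proof.
elim: N f => [|N IH] f; first by case.
move=> [bf cf df]; split => // b; have [df1 df2] := df b; split => //.
exact: IH.
Qed.

Lemma Cl_sub D D' N w f : D' `<=` D -> Cl D N w f -> Cl D' N w f.
Proof.
move=> DD; elim: N f => [|N IH] f [[C bC] cf df].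
all: split; [by exists C => l /DD; apply: bC|by move=> l /DD; apply: cf|].
  by [].
move=> b; have [df1 df2] := df b; split; last exact: IH.
by move=> l /DD; apply: df1.
Qed.

Lemma Cl_union D D' N w f : (forall l, 0 <= w l) ->
  Cl D N w f -> Cl D' N w f -> Cl (D `|` D') N w f.
Proof.
move=> w0; elim: N f => [|N IH] f [[C bC] cf df] [[C' bC'] cf' df'].
all: split; [exists (Num.max C C')|by move=> l [/cf|/cf']|].
1,3: move=> l [/bC|/bC'] h; apply: (le_trans h); apply: ler_wpM2r => //;
  by rewrite le_max lexx ?orbT.
  by [].
move=> b; have [df1 df2] := df b; have [df1' df2'] := df' b.
split; last exact: IH.
by move=> l [/df1|/df1'].
Qed.

Lemma Cl_weight D N w w' f (C0 : R) : 0 <= C0 -> (forall l, D l -> 0 <= w l) ->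
  (forall l, D l -> w l <= C0 * w' l) -> Cl D N w f -> Cl D N w' f.
Proof.
move=> C00 w0 ww; elim: N f => [|N IH] f [[C bC] cf df].
all: split=> //; first (exists (Num.max C 0 * C0) => l Dl;
  apply: le_trans (bC _ Dl) _; rewrite -mulrA;
  apply: (@le_trans _ _ (Num.max C 0 * w l));
  [by apply: ler_wpM2r; rewrite ?w0// le_max lexx|
   by apply: ler_wpM2l; [rewrite le_max lexx orbT|exact: ww]]).
move=> b; have [df1 df2] := df b; split=> //.
exact: IH.
Qed.

Lemma Cl_cst D N (a : R) : open D -> Cl D N (fun=> 1) (fun=> a).
Proof.
move=> oD; elim: N a => [|N IH] a.
  by split=> [|l _|//]; [exists `|a| => l _; rewrite mulr1|exact: cvg_cst].
apply: (@Cl_intro _ _ _ _ (fun=> fun=> 0)) => //.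
- by exists `|a| => l _; rewrite mulr1.
- by move=> l _; exact: cvg_cst.
Qed.

Lemma Cl_add D N w f g : open D -> Cl D N w f -> Cl D N w g ->
  Cl D N w (fun l => f l + g l).
Proof.
move=> oD; elim: N f g => [|N IH] f g [[C bC] cf df] [[C' bC'] cg dg].
  split => //; first (exists (C + C') => l Dl; rewrite mulrDl).
    by rewrite (le_trans (ler_normD _ _))// lerD// ?bC ?bC'.
  by move=> l Dl; apply: cvgD; [exact: cf|exact: cg].
apply: (@Cl_intro _ _ _ _ (fun b l => 'D_(dir b) f l + 'D_(dir b) g l)) => //.
- by exists (C + C') => l Dl; rewrite mulrDl (le_trans (ler_normD _ _))// lerD// ?bC ?bC'.
- by move=> l Dl; apply: cvgD; [exact: cf|exact: cg].
- move=> b l Dl; have [/(_ _ Dl)/derivableP ? _] := df b.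
  by have [/(_ _ Dl)/derivableP ? _] := dg b; exact: is_deriveD.
- by move=> b; apply: IH; [case: (df b)|case: (dg b)].
Qed.

Lemma Cl_mul D N w w' f g : open D -> (forall l, D l -> 0 <= w l) ->
  (forall l, D l -> 0 <= w' l) -> Cl D N w f -> Cl D N w' g ->
  Cl D N (fun l => w l * w' l) (fun l => f l * g l).
Proof.
move=> oD w0 w0'; elim: N f g => [|N IH] f g.
  move=> [[C bC] cf df] [[C' bC'] cg dg].
  split => //; first (exists (C * C') => l Dl).
    by rewrite normrM mulrACA ler_pM// ?bC ?bC'.
  by move=> l Dl; apply: cvgM; [exact: cf|exact: cg].
move=> clf clg; have := ClS _ _ _ _ clf; have := ClS _ _ _ _ clg.
case: clf clg => [[C bC] cf df] [[C' bC'] cg dg] clg clf.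
apply: (@Cl_intro _ _ _ _
  (fun b l => f l * 'D_(dir b) g l + 'D_(dir b) f l * g l)) => //.
- by exists (C * C') => l Dl; rewrite normrM mulrACA ler_pM// ?bC ?bC'.
- by move=> l Dl; apply: cvgM; [exact: cf|exact: cg].
- move=> b l Dl; have [/(_ _ Dl)/derivableP hf _] := df b.
  have [/(_ _ Dl)/derivableP hg _] := dg b.
  apply: is_derive_eq (is_deriveM hf hg) _.
  by rewrite /GRing.scale/= [g l * _]mulrC.
- by move=> b; apply: Cl_add => //; apply: IH => //; [case: (dg b)|case: (df b)].
Qed.

Lemma Cl_mul1 D N w f g : open D -> (forall l, D l -> 0 <= w l) ->
  Cl D N (fun=> 1) f -> Cl D N w g -> Cl D N w (fun l => f l * g l).
Proof.
move=> oD w0 hf hg.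
have := Cl_mul _ _ _ _ _ _ oD (fun _ _ => ler01) w0 hf hg.
by under eq_fun do rewrite mul1r.
Qed.

Lemma Cl_opp D N w f : open D -> (forall l, D l -> 0 <= w l) ->
  Cl D N w f -> Cl D N w (fun l => - f l).
Proof.
move=> oD w0 hf; have := Cl_mul1 _ _ _ _ _ oD w0 (Cl_cst D N (-1) oD) hf.
by under [X in Cl _ _ _ X -> _]eq_fun do rewrite mulN1r.
Qed.

Lemma Cl_inv D N f (c : R) : open D -> 0 < c -> (forall l, D l -> c <= `|f l|) ->
  Cl D N (fun=> 1) f -> Cl D N (fun=> 1) (fun l => (f l)^-1).
Proof.
move=> oD c0 cf.
have fn0 l : D l -> f l != 0.
  by move=> /cf h; rewrite -normr_gt0; exact: lt_le_trans h.
have B : exists C, forall l, D l -> `|(f l)^-1| <= C * 1.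
  exists c^-1 => l Dl; rewrite normrV ?unitfE ?fn0// mulr1 lef_pV2 ?posrE ?cf//.
  by rewrite normr_gt0 fn0.
elim: N => [|N IH] hf; have [_ conf df] := hf.
  by split=> // l Dl; apply: cvgV; [exact: fn0|exact: conf].
apply: (@Cl_intro _ _ _ _
  (fun b l => (- 'D_(dir b) f l) * ((f l)^-1 * (f l)^-1))) => //.
- by move=> l Dl; apply: cvgV; [exact: fn0|exact: conf].
- move=> b l Dl; have [/(_ _ Dl) df1 _] := df b.
  apply: DeriveDef; first by apply: derivableV => //; exact: fn0.
  rewrite deriveV ?fn0// /GRing.scale/= -invfM -expr2.
  by rewrite mulrC mulrN mulNr mulrC.
- move=> b; have hI := IH (ClS _ _ _ _ hf).
  apply: Cl_mul1 => //.
    by apply: Cl_opp => //; case: (df b).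
  by apply: Cl_mul1.
Qed.

End smooth_class.

(** * Slices and locally affine substitutions *)

Section smooth_class2.
Context (R : realType).
Implicit Types (D : set (R * R)) (f g w : R * R -> R) (b : bool).

Definition xcoord b (l : R * R) : R := if b then l.1 else l.2.
Definition slice b (l : R * R) f (x : R) : R :=
  f (if b then (x, l.2) else (l.1, x)).

Lemma slice_xcoord b l f : slice b l f (xcoord b l) = f l.
Proof. by case: b l => -[]. Qed.

Lemma slice_quotient b l f (h : R) :
  h^-1 *: (f (h *: dir R b + l) - f l) =
  h^-1 *: (slice b l f (h *: 1 + xcoord b l) - slice b l f (xcoord b l)).
Proof.
rewrite slice_xcoord; congr (_ *: (f _ - _)).
case: b l => -[x y]; rewrite /dir/=; congr (_, _) => /=;
  by rewrite /GRing.scale/= ?mulr0 ?add0r ?mulr1.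
Qed.

Lemma derivable_slice b l f :
  derivable f l (dir R b) <-> derivable (slice b l f) (xcoord b l) 1.
Proof.
rewrite /derivable; under eq_fun do rewrite slice_quotient.
by [].
Qed.

Lemma derive_slice b l f :
  'D_(dir R b) f l = 'D_1 (slice b l f) (xcoord b l).
Proof.
by rewrite /derive; under eq_fun do rewrite slice_quotient.
Qed.

Lemma is_derive_slice b l f d :
  is_derive l (dir R b) f d <-> is_derive (xcoord b l) 1 (slice b l f) d.
Proof.
split=> -[h1 h2]; apply: DeriveDef.
- exact/derivable_slice.
- by rewrite -derive_slice.
- exact/derivable_slice.
- by rewrite derive_slice.
Qed.

Definition sepmap (tau : bool -> R -> R) (l : R * R) : R * R :=
  (tau true l.1, tau false l.2).

Lemma is_derive_sep b l f tau t' : derivable f (sepmap tau l) (dir R b) ->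
  is_derive (xcoord b l) 1 (tau b) t' ->
  is_derive l (dir R b) (f \o sepmap tau) ('D_(dir R b) f (sepmap tau l) * t').
Proof.
move=> /derivableP /is_derive_slice df dt; apply/is_derive_slice.
have -> : slice b l (f \o sepmap tau) = slice b (sepmap tau l) f \o tau b.
  by apply/funext => x; case: b {df dt}.
have ec : xcoord b (sepmap tau l) = tau b (xcoord b l) by case: b {df dt}.
by rewrite ec in df; exact: is_derive1_comp.
Qed.

Lemma continuous_sepmap l tau :
  {for l.1, continuous (tau true)} -> {for l.2, continuous (tau false)} ->
  {for l, continuous (sepmap tau)}.
Proof.
case: l => x y /= c1 c2.
have h1 : tau true z.1 @[z --> (x, y)] --> tau true x.
  by apply: (@cvg_comp _ _ _ fst (tau true) _ (nbhs x)); [exact: cvg_fst|].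
have h2 : tau false z.2 @[z --> (x, y)] --> tau false y.
  by apply: (@cvg_comp _ _ _ snd (tau false) _ (nbhs y)); [exact: cvg_snd|].
exact: (cvg_pair h1 h2).
Qed.

Lemma is_derive_affine (a c x : R) : is_derive x 1 (fun x => a * x + c) a.
Proof.
have h := is_deriveD (is_deriveZ a (is_derive_id x (1 : R))) (is_derive_cst c x (1 : R)).
by apply: is_derive_eq h _; rewrite addr0 /GRing.scale/= mulr1.
Qed.

(** Only the translation may jump from piece to piece, and it is locally constant on [D]; the factor
    [th] is common. So a derivative of [f \o T] is [th] times that of [f] at [T l], on every piece.
    This covers the floors in the cutoffs and the contractions towards cluster centers. *)
Lemma Cl_affine D N f (th : R) (T : R * R -> R * R) : open D ->
  (forall l0, D l0 -> exists k : R * R, \near l0,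
     T l0 = (th * l0.1 + k.1, th * l0.2 + k.2)) ->
  Cl R setT N (fun=> 1) f -> Cl R D N (fun=> 1) (f \o T).
Proof.
move=> oD aT.
have H f0 l0 : D l0 -> exists2 tau : bool -> R -> R,
    (\near l0, (f0 \o T) l0 = (f0 \o sepmap tau) l0) /\ T l0 = sepmap tau l0 &
    forall b (x : R), is_derive x 1 (tau b) th.
  move=> /aT [k hk].
  exists (fun b x => th * x + (if b then k.1 else k.2)).
    split; last exact: nbhs_singleton hk.
    by apply: filterS hk => l /= ->.
  by move=> b x; exact: is_derive_affine.
have ctau (tau : bool -> R -> R) b (x : R) : (forall b (x : R), is_derive x 1 (tau b) th) -> {for x, continuous (tau b)}.
  move=> h; apply: differentiable_continuous; apply/derivable1_diffP.
  by have [] := h b x.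
have Hc f' : (forall l, {for l, continuous f'}) -> forall l, D l ->
    {for l, continuous (f' \o T)}.
  move=> cf l Dl; have [k hk] := aT l Dl.
  apply: continuous_comp; last exact: cf.
  have e : \near l, sepmap (fun b x => th * x + (if b then k.1 else k.2)) l = T l.
    by apply: filterS hk => z /= ->.
  apply: (continuous_near _ _ _ _ _ e).
  apply: continuous_sepmap => /=; apply: cvgD; (try exact: cvg_cst);
    by apply: cvgM; [exact: cvg_cst|exact: cvg_id].
elim: N f => [|N IH] f hf; have [[C bC] cf df] := hf.
  split=> //; first by exists C => l Dl; exact: bC.
  by apply: Hc => l; exact: cf.
apply: (@Cl_intro _ _ _ _ _ (fun b l => th * 'D_(dir R b) f (T l))) => //.
- by exists C => l Dl; exact: bC.
- by apply: Hc => l; exact: cf.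
- move=> b l Dl; have [tau [nT eT] dtau] := H f l Dl.
  have -> : 'D_(dir R b) f (T l) = 'D_(dir R b) f (sepmap tau l) by rewrite eT.
  rewrite mulrC.
  have h2 : derivable f (sepmap tau l) (dir R b) by have [h _] := df b; exact: h.
  apply: near_eq_is_derive (is_derive_sep _ _ _ _ _ h2 (dtau b _)).
  by apply: filterS nT.
- move=> b; apply: (Cl_mul1 _ _ _ _ (fun=> th) ('D_(dir R b) f \o T)) => //.
    exact: Cl_cst.
  have [_ h] := df b; exact: IH.
Qed.

End smooth_class2.

(** * Symmetry of mixed derivatives *)

Section schwarz.
Context (R : realType).
Implicit Types (D : set (R * R)) (f g w : R * R -> R) (b : bool).

(** Control of the increments on the right suffices because the derivative is known to exist. *)
Lemma is_derive_quotient_le (phi : R -> R) (a d c e r : R) : 0 < r ->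
  is_derive a 1 phi d ->
  (forall s, 0 < s < r -> `|phi (a + s) - phi a - s * c| <= s * e) ->
  `|d - c| <= e.
Proof.
move=> r0 [/cvg_ex[/= d' hd'] hd] H.
have -> : d = d' by rewrite -hd; apply: cvg_lim hd' => //; exact: norm_hausdorff.
rewrite leNgt; apply/negP => ltc.
have e0 : 0 < `|d' - c| - e by rewrite subr_gt0.
move/cvgrPdist_lt : hd' => /(_ _ e0); rewrite near_withinE => /nbhs_ballP[r' /= r'0 hr'].
pose h : R := Num.min r r' / 2.
have m0 : 0 < Num.min r r' by rewrite lt_min r0.
have h0 : 0 < h by rewrite divr_gt0.
have hm : h < Num.min r r' by rewrite ltr_pdivrMr// ltr_pMr// ltr1n.
have /andP[hr hr2] : (h < r) && (h < r') by rewrite -lt_min.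
have := hr' h; rewrite /ball/= sub0r normrN gtr0_norm// => /(_ hr2 (lt0r_neq0 h0)).
have := H h; rewrite h0 hr => /(_ isT).
rewrite [h *: 1]mulr1 [_ *: _]mulrC [h + a]addrC.
set A := phi _ - phi a.
have -> : A - h * c = h * (A / h - c) by field; exact: lt0r_neq0.
rewrite normrM gtr0_norm// ler_pM2l// => H2 H3.
have : `|d' - c| <= `|d' - A / h| + `|A / h - c|.
  by apply: le_trans (ler_normD _ _); rewrite addrA subrK.
lra.
Qed.

Lemma is_derive_continuous (phi : R -> R) (z d : R) :
  is_derive z 1 phi d -> {for z, continuous phi}.
Proof. by case=> h _; apply: differentiable_continuous; exact/derivable1_diffP. Qed.

Lemma mvt_step (phi dphi : R -> R) (a s : R) : 0 < s ->
   (forall z : R, a <= z <= a + s -> is_derive z 1 phi (dphi z)) ->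
   exists2 z, a <= z <= a + s & phi (a + s) - phi a = dphi z * s.
Proof.
move=> s0 H; have ltas : a < a + s by rewrite ltrDl.
have [||z zin ->] := @MVT R phi dphi a (a + s) ltas.
- move=> z; rewrite in_itv/= => /andP[z1 z2]; apply: H.
  by rewrite (ltW z1) (ltW z2).
- apply: continuous_in_subspaceT => z; rewrite inE/= in_itv/= => zz.
  exact: is_derive_continuous (H _ zz).
- exists z; last by rewrite addrC addKr.
  by move: zin; rewrite in_itv/= => /andP[z1 z2]; rewrite (ltW z1) (ltW z2).
Qed.

Lemma is_derive_slice1 f l : derivable f l (e1 R) ->
  is_derive l.1 1 (fun z : R => f (z, l.2)) ('D_(e1 R) f l).
Proof. by move=> /derivableP; exact: (proj1 (is_derive_slice R true l f _)). Qed.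

Lemma is_derive_slice2 f l : derivable f l (e2 R) ->
  is_derive l.2 1 (fun z : R => f (l.1, z)) ('D_(e2 R) f l).
Proof. by move=> /derivableP; exact: (proj1 (is_derive_slice R false l f _)). Qed.

(** [Cl] differentiates in any order, whereas [partial] has the second variable innermost and
    smoothness gives continuity in that order only. Hence the version that asks for continuity of
    one of the two mixed derivatives. *)
Lemma schwarz D f l0 : open D -> D l0 ->
  (forall l, D l -> derivable f l (e1 R)) ->
  (forall l, D l -> derivable f l (e2 R)) ->
  (forall l, D l -> derivable ('D_(e2 R) f) l (e1 R)) ->
  (forall l, D l -> derivable ('D_(e1 R) f) l (e2 R)) ->
  {for l0, continuous ('D_(e1 R) ('D_(e2 R) f))} ->
  'D_(e2 R) ('D_(e1 R) f) l0 = 'D_(e1 R) ('D_(e2 R) f) l0.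
Proof.
move=> oD Dl0 d1 d2 d12 d21 ch.
case: l0 Dl0 ch => x y Dl0 ch.
set h0 : R := RHS; apply/eqP; rewrite -subr_eq0 -normr_le0; apply/ler_addgt0Pl => e e0.
rewrite addr0.
move/cvgrPdist_le : ch => /(_ _ e0) ch.
have : \forall l \near (x, y), D l /\ `|h0 - 'D_(e1 R) ('D_(e2 R) f) l| <= e.
  by apply: filterI; [exact: open_nbhs_nbhs|exact: ch].
move=> /nbhs_ballP[r /= r0 hr].
have box (z1 z2 : R) : `|z1 - x| < r -> `|z2 - y| < r -> D (z1, z2) /\
    `|h0 - 'D_(e1 R) ('D_(e2 R) f) (z1, z2)| <= e.
  by move=> sr tr; apply: hr; split; rewrite /ball/= distrC.
have x00 : `|x - x| < r by rewrite subrr normr0.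
have y00 : `|y - y| < r by rewrite subrr normr0.
have i1 l : D l -> is_derive l.1 1 (fun z => f (z, l.2)) ('D_(e1 R) f l).
  by move=> /d1 /is_derive_slice1.
have i2 l : D l -> is_derive l.2 1 (fun z => f (l.1, z)) ('D_(e2 R) f l).
  by move=> /d2 /is_derive_slice2.
have i12 l : D l -> is_derive l.1 1 (fun z => 'D_(e2 R) f (z, l.2)) ('D_(e1 R) ('D_(e2 R) f) l).
  by move=> /d12 /is_derive_slice1.
have i21 l : D l -> is_derive l.2 1 (fun z => 'D_(e1 R) f (l.1, z)) ('D_(e2 R) ('D_(e1 R) f) l).
  by move=> /d21 /is_derive_slice2.
(* The mean value theorem in the second and then in the first variable turns the second difference
   over a rectangle into s t times the mixed derivative at one of its points. *)
have sq (s t : R) : 0 < s < r -> 0 < t < r ->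
   `|f (x + s, y + t) - f (x, y + t) - (f (x + s, y) - f (x, y)) - s * (t * h0)|
     <= s * (t * e).
  move=> /andP[s0 sr] /andP[t0 tr].
  have ns (u v z : R) : 0 < u -> u < r -> v <= z <= v + u -> `|z - v| < r.
    move=> u0 ur /andP[z1 z2]; rewrite ger0_norm ?subr_ge0//.
    by apply: le_lt_trans ur; rewrite lerBlDl.
  have xs : `|x + s - x| < r by rewrite addrC addKr gtr0_norm.
  have D1 z : y <= z <= y + t -> is_derive z 1
      (fun z => f (x + s, z) - f (x, z))
      ('D_(e2 R) f (x + s, z) - 'D_(e2 R) f (x, z)).
    move=> zb; have zr := ns _ _ _ t0 tr zb.
    have k1 := i2 (x + s, z) (proj1 (box _ _ xs zr)).
    have k2 := i2 (x, z) (proj1 (box _ _ x00 zr)).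
    exact: is_deriveB k1 k2.
  have [eta eb He] := mvt_step _ _ _ _ t0 D1.
  have er := ns _ _ _ t0 tr eb.
  have D2 z : x <= z <= x + s -> is_derive z 1 (fun z => 'D_(e2 R) f (z, eta))
      ('D_(e1 R) ('D_(e2 R) f) (z, eta)).
    move=> zb; have zr := ns _ _ _ s0 sr zb.
    exact: (i12 (z, eta) (proj1 (box _ _ zr er))).
  have [xi xb Hx] := mvt_step _ _ _ _ s0 D2.
  have -> : f (x + s, y + t) - f (x, y + t) - (f (x + s, y) - f (x, y)) =
     s * (t * 'D_(e1 R) ('D_(e2 R) f) (xi, eta)).
    transitivity (('D_(e1 R) ('D_(e2 R) f) (xi, eta) * s) * t); last by ring.
    by rewrite -Hx -He; ring.
  rewrite -!mulrBr !normrM (gtr0_norm s0) (gtr0_norm t0) ler_pM2l// ler_pM2l// distrC.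
  have xr := ns _ _ _ s0 sr xb.
  exact: (proj2 (box _ _ xr er)).
(* Division by s and s -> 0; the last line of the proof does the same with t. *)
have q2 (t : R) : 0 < t < r -> `|'D_(e1 R) f (x, y + t) - 'D_(e1 R) f (x, y) - t * h0| <= t * e.
  move=> /andP[t0 tr].
  have yt : `|y + t - y| < r by rewrite addrC addKr gtr0_norm.
  have k1 := i1 (x, y + t) (proj1 (box _ _ x00 yt)).
  have k2 := i1 (x, y) Dl0.
  apply: (is_derive_quotient_le (fun z => f (z, y + t) - f (z, y)) x _ _ _ r r0 (is_deriveB k1 k2)).
  move=> s sb; have := sq s t sb; rewrite t0 tr => /(_ isT).
  by congr (`| _ - _| <= _); ring.
exact: (is_derive_quotient_le _ _ _ _ _ r r0 (i21 (x, y) Dl0)).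
Qed.

End schwarz.

(** * Symbols in logarithmic coordinates *)

Section conversion.
Context (R : realType).
Implicit Types (f g w : R * R -> R) (b : bool) (l s : R * R).

Lemma Cl_exp N (a : R) b : Cl R setT N (fun l => expR (a * xcoord R b l))
  (fun l => expR (a * xcoord R b l)).
Proof.
have B : exists C, forall l, setT l ->
    `|expR (a * xcoord R b l)| <= C * expR (a * xcoord R b l).
  by exists 1 => l _; rewrite ger0_norm ?expR_ge0// mul1r.
have D b' l : is_derive l (dir R b') (fun l => expR (a * xcoord R b l))
    ((if b' == b then a else 0) * expR (a * xcoord R b l)).
  apply/is_derive_slice; case: eqP => [->|/eqP nb].
    rewrite mulrC (_ : slice _ _ _ _ = expR \o (fun x => a * x + 0)).
      apply: is_derive1_comp; last exact: is_derive_affine.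
      by apply: is_derive_eq (is_derive_expR _) _; rewrite addr0.
    by apply/funext => x; rewrite /= addr0 /slice; case: b {B}.
  rewrite mul0r (_ : slice _ _ _ _ = cst (expR (a * xcoord R b l))).
    exact: is_derive_cst.
  by apply/funext => x; rewrite /slice; case: b b' nb {B} => -[].
have C l : {for l, continuous (fun l => expR (a * xcoord R b l))}.
  apply: continuous_comp; last exact: continuous_expR.
  apply: cvgM; first exact: cvg_cst.
  by case: b {B D} l => -[x y]; [exact: cvg_fst|exact: cvg_snd].
elim: N => [|N IH]; first by split.
apply: (@Cl_intro _ _ _ _ _
  (fun b' l => (if b' == b then a else 0) * expR (a * xcoord R b l))) => //.
  exact: openT.
move=> b'; apply: (Cl_mul1 _ _ _ _ (fun=> if b' == b then a else 0) _ openT) => //.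
exact: (Cl_cst _ _ _ _ openT).
Qed.

Definition Exp : R * R -> R * R := sepmap R (fun=> expR).
Definition Ln : R * R -> R * R := sepmap R (fun=> @ln R).

Lemma quadrant_open : open (@quadrant R).
Proof.
rewrite (_ : @quadrant R = [set l | 0 < l.1] `&` [set l | 0 < l.2])//.
apply: openI.
  by apply: (@open_comp _ _ fst [set x : R | 0 < x]) => [l _|]; [case: l => ? ?; exact: cvg_fst|exact: open_gt].
by apply: (@open_comp _ _ snd [set x : R | 0 < x]) => [l _|]; [case: l => ? ?; exact: cvg_snd|exact: open_gt].
Qed.

Lemma quadrant_Exp s : quadrant (Exp s).
Proof. by split; exact: expR_gt0. Qed.

Lemma ExpK l : quadrant l -> Exp (Ln l) = l.
Proof. by case: l => x y [/= x0 y0]; rewrite /Exp/Ln/sepmap/= !lnK. Qed.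

Definition rpartial j k f : R * R -> R :=
  iter j (fun f => 'D_(e1 R) f) (iter k (fun f => 'D_(e2 R) f) f).

Section to_class.
Variables (f w : R * R -> R).
Hypothesis df : forall j k l b, quadrant l -> derivable (rpartial j k f) l (dir R b).
Hypothesis cf : forall j k l, quadrant l -> {for l, continuous (rpartial j k f)}.
Hypothesis bf : forall j k, exists C, forall l, quadrant l ->
  l.1 ^+ j * l.2 ^+ k * `|rpartial j k f l| <= C * w l.

(** The new derivative has to move inside past the j derivatives in the first variable, one
    application of Schwarz for each. *)
Lemma rpartial_e2 j k l : quadrant l ->
  'D_(e2 R) (rpartial j k f) l = rpartial j k.+1 f l.
Proof.
elim: j l => [//|j IH] l ql.
have nIH l' : quadrant l' -> \near l', 'D_(e2 R) (rpartial j k f) l' = rpartial j k.+1 f l'.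
  move=> ql'; apply: (open_near _ _ _ _ _ quadrant_open ql') => z; rewrite inE; exact: IH.
rewrite [in RHS]/rpartial iterS -/(rpartial j k.+1 f).
rewrite -(near_eq_derive _ (nIH l ql)).
rewrite [in LHS]/rpartial iterS -/(rpartial j k f).
apply: (@schwarz R (@quadrant R)) => //.
- exact: quadrant_open.
- by move=> ? ?; exact: (df j k _ true).
- by move=> ? ?; exact: (df j k _ false).
- move=> l' ql'; apply: (@near_eq_derivable _ _ _ (rpartial j k.+1 f)).
    by apply: filterS (nIH _ ql').
  exact: (df j k.+1 _ true).
- by move=> ? ?; exact: (df j.+1 k _ false).
- apply: (@continuous_near _ _ (rpartial j.+1 k.+1 f)); last exact: cf.
  apply: (open_near _ _ _ _ _ quadrant_open ql) => z; rewrite inE => qz.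
  by apply: near_eq_derive; apply: filterS (nIH _ qz).
Qed.

(** The symbol estimate of order (j, k), solved for the derivative and read in logarithmic
    coordinates: each derivative costs a factor 1 / l. *)
Definition weight j k l := w (Exp l) * expR (- (j%:R * l.1)) * expR (- (k%:R * l.2)).

(** Differentiating a function of exp s brings out exp s, which cancels the additional exp (- s) in
    the weight of the next derivative. So the weight is the same at every order, as [Cl] demands. *)
Lemma rpartial_class N j k : (forall l, 0 <= w l) ->
  Cl R setT N (weight j k) (rpartial j k f \o Exp).
Proof.
move=> w0.
have W0 j' k' l : setT l -> 0 <= weight j' k' l.
  by move=> _; rewrite /weight !mulr_ge0// expR_ge0.
have B j' k' : exists C, forall l, setT l ->
    `|(rpartial j' k' f \o Exp) l| <= C * weight j' k' l.
  have [C hC] := bf j' k'; exists C => l _.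
  have := hC _ (quadrant_Exp l); rewrite /Exp/= /weight -!expRM_natl.
  rewrite !expRN => h.
  by rewrite !mulrA ler_pdivlMr ?expR_gt0// ler_pdivlMr ?expR_gt0// -mulrA mulrC
    [X in X * _]mulrC.
have C j' k' l : setT l -> {for l, continuous (rpartial j' k' f \o Exp)}.
  move=> _; apply: continuous_comp; last by apply: cf; exact: quadrant_Exp.
  by apply: continuous_sepmap; exact: continuous_expR.
elim: N j k => [|N IH] j k; first by split=> [||//]; [exact: B|exact: C].
apply: (@Cl_intro _ _ _ _ _ (fun b l => expR (1 * xcoord R b l) *
   (rpartial (j + b) (k + ~~ b) f (Exp l))) openT (B j k) (C j k)).
- move=> b l _.
  rewrite mulrC (_ : rpartial (j + b) _ _ _ = 'D_(dir R b) (rpartial j k f) (Exp l)); last first.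
    case: b; first by rewrite addn1 addn0.
    by rewrite addn0 addn1/= rpartial_e2//; exact: quadrant_Exp.
  apply: is_derive_sep; first by apply: df; exact: quadrant_Exp.
  by rewrite mul1r; exact: is_derive_expR.
- move=> b.
  have := Cl_mul _ _ _ _ _ _ _ openT _ (W0 (j + b)%N (k + ~~ b)%N) (Cl_exp N 1 b) (IH (j + b)%N (k + ~~ b)%N).
  have -> : (fun l => expR (1 * xcoord R b l) * weight (j + b) (k + ~~ b) l) = weight j k.
    apply/funext => l; rewrite /weight !natrD !mulrDl !opprD !expRD.
    case: b => /=; rewrite mul1r ?mul0r ?oppr0 ?expR0 ?mul1r !mulr1.
      by rewrite (expRN l.1); field; exact/lt0r_neq0/expR_gt0.
    by rewrite (expRN l.2); field; exact/lt0r_neq0/expR_gt0.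
  by apply=> l _; exact: expR_ge0.
Qed.

End to_class.
Section from_class.
Variables (Q w : R * R -> R).
Hypothesis w0 : forall l, 0 <= w l.
Hypothesis clQ : forall N, Cl R setT N (w \o Exp) Q.

(** What d/dl becomes under l = exp s. *)
Definition log_derive b f l := expR (-1 * xcoord R b l) * 'D_(dir R b) f l.

Definition log_partial j k : R * R -> R :=
  iter j (log_derive true) (iter k (log_derive false) Q).

Lemma weight_ge0 j k l : 0 <= weight w j k l.
Proof. by rewrite /weight !mulr_ge0// expR_ge0. Qed.

Lemma log_derive_class N j k b f : Cl R setT N.+1 (weight w j k) f ->
  Cl R setT N (weight w (j + b) (k + ~~ b)) (log_derive b f).
Proof.
move=> [_ _ /(_ b)[_ cl]].
have := Cl_mul _ _ _ _ _ _ _ openT _ (fun l _ => weight_ge0 j k l) (Cl_exp N (-1) b) cl.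
have -> : (fun l => expR (-1 * xcoord R b l) * weight w j k l) =
    weight w (j + b) (k + ~~ b).
  apply/funext => l; rewrite /weight !natrD !mulrDl !opprD !expRD mulN1r.
  by case: b {cl} => /=; rewrite ?mul0r ?oppr0 ?expR0 ?mul1r !mulr1; ring.
by apply=> l _; exact: expR_ge0.
Qed.

Lemma log_partial_class N j k : Cl R setT N (weight w j k) (log_partial j k).
Proof.
elim: j N => [|j IH] N; last first.
  by have := log_derive_class N j k true _ (IH _); rewrite addn1 addn0.
elim: k N => [|k IH] N; last first.
  by have := log_derive_class N 0 k false _ (IH _); rewrite addn1.
rewrite (_ : weight w 0 0 = w \o Exp); first exact: clQ.
by apply/funext => l; rewrite /weight !mul0r oppr0 expR0 !mulr1.
Qed.

Lemma continuous_Ln l : quadrant l -> {for l, continuous Ln}.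
Proof. by move=> [? ?]; apply: continuous_sepmap; exact: continuous_ln. Qed.

Lemma is_derive_log b f l : quadrant l -> derivable f (Ln l) (dir R b) ->
  is_derive l (dir R b) (f \o Ln) (log_derive b f (Ln l)).
Proof.
move=> ql df.
have dl : is_derive (xcoord R b l) 1 (@ln R) (expR (-1 * xcoord R b (Ln l))).
  have x0 : 0 < xcoord R b l by case: ql; case: b {df}.
  apply: is_derive_eq (is_derive1_ln x0) _.
  by rewrite mulN1r expRN; congr (_^-1); case: b {df} x0 => /= x0; rewrite lnK.
by rewrite /log_derive mulrC; exact: is_derive_sep df dl.
Qed.

Lemma rpartial_log_partial j k l : quadrant l ->
  rpartial j k (Q \o Ln) l = log_partial j k (Ln l).
Proof.
have step b f g : (forall l, quadrant l -> f l = g (Ln l)) ->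
    (forall l, derivable g l (dir R b)) ->
    forall l, quadrant l -> 'D_(dir R b) f l = log_derive b g (Ln l).
  move=> fg dg {}l ql.
  have [_ <-] := is_derive_log b g l ql (dg _).
  apply: near_eq_derive; apply: (open_near _ _ _ _ _ quadrant_open ql) => z.
  by rewrite inE; exact: fg.
have dl j' k' l' b : derivable (log_partial j' k') l' (dir R b).
  by have [_ _ /(_ b)[h _]] := log_partial_class 1 j' k'; exact: h.
elim: j l => [|j IH] l; last by apply: (step true) => // z; exact: dl.
elim: k l => [//|k IH] l; apply: (step false) => // z.
exact: (dl 0).
Qed.

Lemma rpartial_log j k l : quadrant l ->
  (forall b, derivable (rpartial j k (Q \o Ln)) l (dir R b)) /\
  {for l, continuous (rpartial j k (Q \o Ln))}.
Proof.
move=> ql.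
have e : \near l, (log_partial j k \o Ln) l = rpartial j k (Q \o Ln) l.
  apply: (open_near _ _ _ _ _ quadrant_open ql) => z.
  by rewrite inE => /rpartial_log_partial ->.
have [_ ct dl] := log_partial_class 1 j k.
split.
  move=> b; apply: near_eq_derivable e _.
  have [h _] := dl b.
  by have [] := is_derive_log b _ _ ql (h (Ln l) I).
apply: (continuous_near _ _ _ _ _ e).
apply: continuous_comp; first exact: continuous_Ln.
exact: ct.
Qed.

Lemma rpartial_log_bound j k : exists C, forall l, quadrant l ->
  l.1 ^+ j * l.2 ^+ k * `|rpartial j k (Q \o Ln) l| <= C * w l.
Proof.
have [[C hC] _ _] := log_partial_class 0 j k.
exists C => l ql; rewrite rpartial_log_partial//.
have := hC (Ln l) I; rewrite /weight ExpK//.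
have [x0 y0] := ql.
rewrite !expRN !expRM_natl /= !lnK//.
by rewrite !mulrA ler_pdivlMr ?exprn_gt0// ler_pdivlMr ?exprn_gt0// -mulrA mulrC
    [X in X * _]mulrC.
Qed.

End from_class.
End conversion.

(** * Smooth cutoffs *)

Section cutoff.
Context (R : realType).
Implicit Types (f g w : R * R -> R) (b : bool) (l s : R * R).

(** [flat 0] is the usual exp (- 1 / x) extended by 0; with the extra powers the family is closed
    under differentiation up to linear combinations. *)
Definition flat k (x : R) : R := if 0 < x then x ^- k * expR (- x^-1) else 0.

Lemma flat_ge0 k x : 0 <= flat k x.
Proof.
rewrite /flat; case: ifP => // x0.
by rewrite mulr_ge0 ?expR_ge0// invr_ge0 exprn_ge0// ltW.
Qed.

(** With y = 1 / x and k > 0, exp y = exp (y / k) ^ k >= (y / k) ^ k. For k = 0 the bound reads 0 ^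
    0 = 1. *)
Lemma flat_le k x : flat k x <= k%:R ^+ k.
Proof.
rewrite /flat; case: ifP => x0; last by rewrite exprn_ge0.
have y0 : 0 < x^-1 by rewrite invr_gt0.
case: k => [|k].
  by rewrite !expr0 invr1 mul1r expRN invf_le1 ?expR_gt0// -expR0 ler_expR ltW.
rewrite expRN ler_pdivrMr ?expR_gt0//.
have -> : x^-1 = k.+1%:R * (x^-1 / k.+1%:R) by rewrite mulrCA divff ?mulr1// pnatr_eq0.
rewrite expRM_natl -exprMn -exprVn lerXn2r ?nnegrE ?mulr_ge0 ?expR_ge0 ?ler0n//.
  by rewrite ltW.
rewrite -ler_pdivrMl ?ltr0n// mulrC.
apply: le_trans (expR_ge1Dx _); by rewrite lerDr.
Qed.

Lemma flatD k x : flat k x = x ^+ 2 * flat k.+2 x.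
Proof.
rewrite /flat; case: ifP => x0; last by rewrite mulr0.
rewrite mulrA; congr (_ * _); rewrite !exprS expr0; field.
by rewrite ?expf_neq0// lt0r_neq0.
Qed.

Lemma is_derive_flat k (x : R) :
  is_derive x 1 (flat k) (- k%:R * flat k.+1 x + flat k.+2 x).
Proof.
have [x0|x0|<-] := ltgtP 0 x.
- have xn0 : x != 0 by rewrite lt0r_neq0.
  have h1 : is_derive x 1 (fun y : R => y^-1) (- x ^- 2).
    have := @is_deriveV _ id x 1 1 xn0 (is_derive_id x (1 : R)).
    by move=> h; apply: is_derive_eq h _; rewrite /GRing.scale/= mulr1.
  have := is_deriveX k h1; rewrite exprfctE => h2.
  have h3 : is_derive x 1 (expR \o (fun y : R => - y^-1)) (expR (- x^-1) * x ^- 2).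
    apply: is_derive1_comp; apply: is_derive_eq (is_deriveN h1) _.
    by rewrite opprK.
  have h4 := is_deriveM h2 h3.
  apply: (near_eq_is_derive (f := (fun y => (y^-1) ^+ k) \* (expR \o (fun y : R => - y^-1)))).
    have : \near x, 0 < x by apply: open_nbhs_nbhs; split; [exact: open_gt|].
    by apply: filterS => y y0; rewrite /flat y0 /= exprVn.
  apply: is_derive_eq h4 _.
  rewrite /flat x0 /GRing.scale/=.
  case: k {h2} => [|k].
    by rewrite /= !expr0 ?expr1 ?expr2; field.
  rewrite /= -mulr_natl !exprVn !exprS; field.
  by rewrite xn0 expf_neq0.
- have nx (y : R) : y < 0 -> (0 < y) = false by move=> ?; rewrite ltNge ltW.
  rewrite /flat !(nx _ x0) mulr0 addr0.
  have h0 : \near x, x < 0 by apply: open_nbhs_nbhs; split; [exact: open_lt|].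
  apply: near_eq_is_derive (is_derive_cst (0 : R) x 1).
  by apply: filterS h0 => y y0; rewrite (nx _ y0).
rewrite {2 3}/flat ltxx mulr0 addr0.
(* At 0 the difference quotient is h times [flat k.+2 h], and [flat k.+2] is bounded. *)
have cv : h^-1 *: (flat k (h *: 1 + 0) - flat k 0) @[h --> 0^'] --> (0 : R).
  apply/cvgrPdist_le => e e0; rewrite near_withinE.
  have C0 : 0 < k.+2%:R ^+ k.+2 :> R by rewrite exprn_gt0.
  have nb : nbhs (0 : R) (ball 0 (e / k.+2%:R ^+ k.+2)).
    by apply: nbhsx_ballx; rewrite divr_gt0.
  apply: filterS nb => h; rewrite /ball/= sub0r normrN => he h0.
  rewrite {2}/flat ltxx subr0 addr0 sub0r normrN [h *: 1]mulr1 flatD.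
  rewrite /GRing.scale/= expr2 -mulrA mulKf// normrM.
  rewrite (ger0_norm (flat_ge0 _ _)).
  apply: (@le_trans _ _ (`|h| * k.+2%:R ^+ k.+2)).
    by rewrite ler_wpM2l// flat_le.
  by rewrite -ler_pdivlMr// ltW.
by apply: DeriveDef; [apply/cvg_ex; exists 0|exact: cvg_lim cv].
Qed.

Lemma is_derive_xcoord (phi : R -> R) b b' l (d : R) : is_derive (xcoord R b l) 1 phi d ->
  is_derive l (dir R b') (fun l => phi (xcoord R b l)) (if b' == b then d else 0).
Proof.
move=> dp; apply/is_derive_slice; case: eqP => [->|/eqP nb].
  by rewrite (_ : slice _ _ _ _ = phi)//; apply/funext => x; rewrite /slice; case: b {dp}.
rewrite (_ : slice _ _ _ _ = cst (phi (xcoord R b l))).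
  exact: is_derive_cst.
by apply/funext => x; rewrite /slice; case: b b' nb {dp} => -[].
Qed.

Lemma continuous_xcoord b : continuous (xcoord R b).
Proof. by case: b => -[x y]; [exact: cvg_fst|exact: cvg_snd]. Qed.

Lemma flat_class N b k : Cl R setT N (fun=> 1) (fun l => flat k (xcoord R b l)).
Proof.
have B k' : exists C, forall l, setT l -> `|flat k' (xcoord R b l)| <= C * 1.
  by exists (k'%:R ^+ k') => l _; rewrite mulr1 ger0_norm ?flat_ge0// flat_le.
have C k' l : setT l -> {for l, continuous (fun l => flat k' (xcoord R b l))}.
  move=> _; apply: continuous_comp; first exact: continuous_xcoord.
  exact: is_derive_continuous (is_derive_flat k' _).
elim: N k => [|N IH] k; first by split=> [||//]; [exact: B|exact: C].
apply: (@Cl_intro _ _ _ _ _ (fun b' l => if b' == b then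
   - k%:R * flat k.+1 (xcoord R b l) + flat k.+2 (xcoord R b l) else 0)
   openT (B k) (C k)).
  by move=> b' l _; apply: is_derive_xcoord; exact: is_derive_flat.
move=> b'; case: (b' == b); last exact: (Cl_cst _ _ _ _ openT).
apply: (Cl_add _ _ _ _ _ _ openT); last exact: IH.
by apply: (Cl_mul1 _ _ _ _ (fun=> - k%:R) _ openT) => //; exact: (Cl_cst _ _ _ _ openT).
Qed.

Definition step (x : R) : R := flat 0 x / (flat 0 x + flat 0 (1 - x)).

Lemma flat0_ge (x : R) : 1 / 2 <= x -> expR (-2) <= flat 0 x.
Proof.
move=> x2; rewrite /flat; have x0 : 0 < x by lra.
rewrite x0 expr0 invr1 mul1r ler_expR lerN2 -[leRHS]invrK lef_pV2 ?posrE//.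
by rewrite -[_^-1]mul1r.
Qed.

(** One of x and 1 - x is at least 1/2. A bound away from 0, not mere positivity, is what [Cl_inv]
    needs. *)
Lemma step_den x : expR (-2) <= flat 0 x + flat 0 (1 - x).
Proof.
have [h|h] := leP (1/2) x.
  by rewrite (le_trans (flat0_ge _ h))// lerDl flat_ge0.
have /flat0_ge k : 1/2 <= 1 - x by lra.
by rewrite (le_trans k)// lerDr flat_ge0.
Qed.

Lemma step_den0 x : 0 < flat 0 x + flat 0 (1 - x).
Proof. exact: lt_le_trans (expR_gt0 _) (step_den x). Qed.

Lemma step_ge0 x : 0 <= step x.
Proof. by rewrite /step mulr_ge0 ?flat_ge0// invr_ge0 ltW// step_den0. Qed.

Lemma step_le1 x : step x <= 1.
Proof. by rewrite /step ler_pdivrMr ?step_den0// mul1r lerDl flat_ge0. Qed.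

Lemma step_le0 x : x <= 0 -> step x = 0.
Proof. by move=> x0; rewrite /step {1}/flat ltNge x0 mul0r. Qed.

Lemma step_ge1 x : 1 <= x -> step x = 1.
Proof.
move=> x1; have := step_den0 x.
have z : flat 0 (1 - x) = 0 by rewrite /flat subr_gt0 ltNge x1.
by rewrite /step z addr0 => h; rewrite divff// lt0r_neq0.
Qed.

Lemma step_class N b : Cl R setT N (fun=> 1) (fun l => step (xcoord R b l)).
Proof.
have f0 := flat_class N b 0.
have f1 : Cl R setT N (fun=> 1) (fun l => flat 0 (1 - xcoord R b l)).
  have := Cl_affine _ _ _ _ (-1) (fun l => (-1 * l.1 + 1, -1 * l.2 + 1)) openT _ f0.
  rewrite (_ : _ \o _ = (fun l => flat 0 (1 - xcoord R b l))).
    by apply=> l _; exists (1, 1); near=> z.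
  by apply/funext => l; rewrite /= /xcoord; case: b {f0} => /=; rewrite mulN1r addrC.
apply: (Cl_mul1 _ _ _ _ _ _ openT) => //.
apply: (Cl_inv _ _ _ _ (expR (-2)) openT); first exact: expR_gt0.
  by move=> l _; rewrite ger0_norm ?step_den// ltW// step_den0.
exact: (Cl_add _ _ _ _ _ _ openT).
Unshelve. all: by end_near.
Qed.

End cutoff.

(** * Staircases and cutoffs around an arbitrary set *)

Section cutoff2.
Context (R : realType).
Implicit Types (f g w : R * R -> R) (b : bool) (l s : R * R).

Lemma Cl_locally_cst D N f (C : R) : open D -> (forall l, D l -> `|f l| <= C) ->
  (forall l, D l -> \forall l' \near l, f l' = f l) -> Cl R D N (fun=> 1) f.
Proof.
move=> oD fC fl.
have B : exists C, forall l, D l -> `|f l| <= C * 1.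
  by exists C => l Dl; rewrite mulr1 fC.
have C' l : D l -> {for l, continuous f}.
  move=> Dl; apply: (@continuous_near _ _ (cst (f l))); last exact: cst_continuous.
  by apply: filterS (fl _ Dl) => z ->.
case: N => [|N]; first by split.
apply: (@Cl_intro _ _ _ _ _ (fun _ _ => 0) oD B C') => [b l Dl|b].
  apply: (near_eq_is_derive (f := cst (f l))) (is_derive_cst _ _ _).
  by apply: filterS (fl _ Dl) => z ->.
exact: Cl_cst.
Qed.

Lemma near_between b (h a u v : R) l : u < xcoord R b l / h + a < v ->
  \forall l' \near l, u < xcoord R b l' / h + a < v.
Proof.
move=> /andP[h1 h2].
have c : {for l, continuous (fun l => xcoord R b l / h + a)}.
  apply: cvgD; last exact: cvg_cst.
  apply: cvgM; last exact: cvg_cst.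
  exact: continuous_xcoord.
have n1 : \forall l' \near l, u < xcoord R b l' / h + a := c [set y | u < y] (open_nbhs_nbhs (conj (@open_gt _ u) h1)).
have n2 : \forall l' \near l, xcoord R b l' / h + a < v := c [set y | y < v] (open_nbhs_nbhs (conj (@open_lt _ v) h2)).
by near=> z; apply/andP; split; near: z.
Unshelve. all: by end_near.
Qed.

Lemma floor_near b (h a : R) l (k : int) : k%:~R < xcoord R b l / h + a < k%:~R + 1 ->
  \forall l' \near l, Num.floor (xcoord R b l' / h + a) = k.
Proof.
move=> /near_between; apply: filterS => l' /andP[h1 h2].
by apply: floor_def; rewrite ltW// intrD.
Qed.

Lemma open_floor b (h a : R) : open [set l | exists k : int,
  k%:~R < xcoord R b l / h + a < k%:~R + 1].
Proof.
rewrite openE => l /= [k /near_between]; rewrite /interior.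
by apply: filterS => l' hl'; exists k.
Qed.

(** For h > 0 this passes through the value [a k] at the node k h and goes from there to [a (k + 1)]
    by a smooth step that is flat at both nodes. *)
Definition staircase (a : int -> R) (h : R) (x : R) : R :=
  a (Num.floor (x / h)) +
  (a (Num.floor (x / h) + 1) - a (Num.floor (x / h))) *
    step R (x / h - (Num.floor (x / h))%:~R).

(* near a node, where the floor jumps *)
Lemma staircase_shift (a : int -> R) (h x : R) (k : int) :
  k%:~R < x / h + 1 / 2 < k%:~R + 1 ->
  staircase a h x = a (k - 1) + (a k - a (k - 1)) * step R (x / h - (k - 1)%:~R)
   + (a (k + 1) - a k) * step R (x / h - k%:~R).
Proof.
move=> /andP[h1 h2].
have [lek|ltk] := leP k%:~R (x / h).
  have e : Num.floor (x / h) = k by apply: floor_def; rewrite lek intrD; lra.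
  rewrite /staircase e [step R (_ - (k - 1)%:~R)]step_ge1; first by ring.
  by rewrite intrD; lra.
have e : Num.floor (x / h) = k - 1 by apply: floor_def; rewrite subrK ltk intrD andbT; lra.
rewrite /staircase e subrK [step R (_ - k%:~R)]step_le0; first by ring.
by rewrite subr_le0 ltW.
Qed.

Lemma step_affine_class D N b (h : R) (k : R * R -> int) : open D ->
  (forall l, D l -> \forall l' \near l, k l' = k l) ->
  Cl R D N (fun=> 1) (fun l => step R (xcoord R b l / h - (k l)%:~R)).
Proof.
move=> oD lk.
have -> : (fun l => step R (xcoord R b l / h - (k l)%:~R)) =
  (fun l => step R (xcoord R b l)) \o (fun l => (l.1 / h - (k l)%:~R, l.2 / h - (k l)%:~R)).
  by apply/funext => l /=; case: b.
apply: (Cl_affine _ _ _ _ h^-1) => //; last exact: step_class.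
move=> l Dl; exists (- (k l)%:~R, - (k l)%:~R).
by apply: filterS (lk _ Dl) => l' ->; rewrite /= ![h^-1 * _]mulrC.
Qed.

(** Two open sets cover the plane. Off the nodes the floor of x / h is locally constant; off the
    midpoints between nodes the floor of x / h + 1/2 is, and [staircase_shift] expresses the
    staircase through it. *)
Lemma staircase_class (a : int -> R) (h : R) N b : (forall k, 0 <= a k <= 1) ->
  Cl R setT N (fun=> 1) (fun l => staircase a h (xcoord R b l)).
Proof.
move=> a01.
have a1 k : `|a k| <= 1 by have /andP[? ?] := a01 k; rewrite ger0_norm.
have ad k k' : `|a k - a k'| <= 1.
  by have := a01 k; have := a01 k'; rewrite ler_norml; lra.
pose D1 := [set l | exists k : int, k%:~R < xcoord R b l / h + 0 < k%:~R + 1].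
pose D2 := [set l | exists k : int, k%:~R < xcoord R b l / h + 1/2 < k%:~R + 1].
have oD1 : open D1 by exact: open_floor.
have oD2 : open D2 by exact: open_floor.
have -> : setT = D1 `|` D2.
  apply/esym; rewrite -subTset => l _.
  have := floor_itv (xcoord R b l / h).
  set k := Num.floor _; rewrite intrD => /andP[]; rewrite le_eqVlt => /orP[/eqP e _|h1 h2].
    by right; exists k; rewrite -e; lra.
  by left; exists k; rewrite addr0 h1.
have fl (c : R) l (k : int) : k%:~R < xcoord R b l / h + c < k%:~R + 1 ->
    \forall l' \near l, Num.floor (xcoord R b l' / h + c) = Num.floor (xcoord R b l / h + c).
  by move=> hk; have e := floor_near _ _ _ _ _ hk; rewrite (nbhs_singleton e).
have lc (F : int -> R) (c : R) l (k : int) : k%:~R < xcoord R b l / h + c < k%:~R + 1 ->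
    \forall l' \near l, F (Num.floor (xcoord R b l' / h + c)) = F (Num.floor (xcoord R b l / h + c)).
  by move=> /fl; apply: filterS => l' ->.
apply: Cl_union => //.
  rewrite /staircase; apply: (Cl_add _ _ _ _ _ _ oD1).
    apply: (Cl_locally_cst _ _ _ 1) => // l [k /(lc a)].
    by apply: filterS => l'; rewrite !addr0 => ->.
  apply: (Cl_mul1 _ _ _ _ _ _ oD1) => //.
    apply: (Cl_locally_cst _ _ _ 1) => // l [k /(lc (fun k => a (k + 1) - a k))].
    by apply: filterS => l'; rewrite !addr0 => ->.
  apply: step_affine_class => // l [k /fl].
  by apply: filterS => l'; rewrite !addr0 => ->.
pose kk l := Num.floor (xcoord R b l / h + 1/2).
apply: (@Cl_congr _ _ _ _ (fun l => a (kk l - 1) + (a (kk l) - a (kk l - 1)) * step R (xcoord R b l / h - (kk l - 1)%:~R)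
   + (a (kk l + 1) - a (kk l)) * step R (xcoord R b l / h - (kk l)%:~R))) => //.
  move=> l; rewrite inE => -[k hk].
  by rewrite (staircase_shift _ _ _ k)// /kk (nbhs_singleton (floor_near _ _ _ _ _ hk)).
apply: (Cl_add _ _ _ _ _ _ oD2).
  apply: (Cl_add _ _ _ _ _ _ oD2).
    by apply: (Cl_locally_cst _ _ _ 1) => // l [k /(lc (fun k => a (k - 1)))].
  apply: (Cl_mul1 _ _ _ _ _ _ oD2) => //.
    by apply: (Cl_locally_cst _ _ _ 1) => // l [k /(lc (fun k => a k - a (k - 1)))].
  by apply: (step_affine_class _ _ _ _ (fun l => kk l - 1)) => // l [k /fl]; apply: filterS => l' e; rewrite /kk e.
apply: (Cl_mul1 _ _ _ _ _ _ oD2) => //.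
  by apply: (Cl_locally_cst _ _ _ 1) => // l [k /(lc (fun k => a (k + 1) - a k))].
by apply: (step_affine_class _ _ _ _ kk) => // l [k /fl].
Qed.

(** The distance to an arbitrary set is not smooth, so the set is sampled on a grid of mesh d / 2. A
    node has value 1 when [E] meets one of the two grid intervals that touch it. Then both nodes
    around a point of [E] have value 1, and a nonzero value means that [E] has a point within two
    meshes. *)
Lemma cutoff_exists (E : set R) (d : R) : 0 < d -> exists psi : R -> R,
  [/\ forall x, 0 <= psi x <= 1,
      forall x, E x -> psi x = 1,
      forall x, psi x != 0 -> exists2 y, E y & `|x - y| <= d &
      forall N b, Cl R setT N (fun=> 1) (fun l => psi (xcoord R b l))].
Proof.
move=> d0; pose h := d / 2; have h0 : 0 < h by rewrite divr_gt0.
pose a (k : int) : R := if `[< exists2 y, E y & (k - 1)%:~R * h <= y <= (k + 1)%:~R * h >] then 1 else 0.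
have a01 k : 0 <= a k <= 1 by rewrite /a; case: asboolP; rewrite !lexx ler01.
exists (staircase a h); split.
- move=> x; rewrite /staircase; set k := Num.floor _.
  have := a01 k; have := a01 (k + 1).
  have := step_ge0 R (x / h - k%:~R); have := step_le1 R (x / h - k%:~R).
  move: (step R _) (a k) (a (k + 1)) => s u v s1 s0 /andP[v0 v1] /andP[u0 u1].
  rewrite (_ : u + (v - u) * s = (1 - s) * u + s * v); last by ring.
  by apply/andP; split; nra.
- move=> x Ex; rewrite /staircase; set k := Num.floor _.
  have /andP[k1 k2] := floor_itv (x / h); rewrite -/k in k1 k2.
  have [{}k1 {}k2] : k%:~R * h <= x /\ x < (k + 1)%:~R * h.
    by rewrite -ler_pdivlMr// -ltr_pdivrMr.
  have -> : a k = 1.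
    rewrite /a; case: asboolP => // -[]; exists x => //.
    rewrite (ltW k2) andbT; apply: le_trans k1.
    by rewrite ler_pM2r// ler_int lerBlDr lerDl.
  have -> : a (k + 1) = 1.
    rewrite /a; case: asboolP => // -[]; exists x => //.
    rewrite addrK k1/=; apply: le_trans (ltW k2) _.
    by rewrite ler_pM2r// ler_int lerDl.
  by rewrite subrr mul0r addr0.
- move=> x; rewrite /staircase; set k := Num.floor _ => nz.
  have /andP[k1 k2] := floor_itv (x / h); rewrite -/k in k1 k2.
  have [{}k1 {}k2] : k%:~R * h <= x /\ x < (k + 1)%:~R * h.
    by rewrite -ler_pdivlMr// -ltr_pdivrMr.
  have dh : d = h + h by rewrite /h; field.
  move: k1 k2; rewrite !intrD !mulrDl mul1r => k1 k2.
  have [e|] := asboolP (exists2 y, E y & (k - 1)%:~R * h <= y <= (k + 1)%:~R * h).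
    case: e => y Ey; rewrite !intrD !mulrDl !mulrNz !mul1r mulN1r => /andP[y1 y2]; exists y => //.
    by rewrite ler_norml; lra.
  move=> n1; have [e|n2] := asboolP (exists2 y, E y & (k + 1 - 1)%:~R * h <= y <= (k + 1 + 1)%:~R * h).
    case: e => y Ey; rewrite !intrD !mulrDl !mulrNz !mul1r mulN1r => /andP[y1 y2]; exists y => //.
    by rewrite ler_norml; lra.
  by move: nz; rewrite /a; do 2 case: asboolP => // _; rewrite subrr mul0r addr0 eqxx.
- by move=> N b; exact: staircase_class.
Qed.

Lemma Cl_lipschitz f : Cl R setT 1 (fun=> 1) f -> exists2 L, 0 <= L &
  forall x y x' y', `|f (x, y) - f (x', y')| <= L * (`|x - x'| + `|y - y'|).
Proof.
move=> [_ _ df].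
have [dt [[C1 b1] _ _]] := df true; have [de [[C2 b2] _ _]] := df false.
pose L := Num.max (Num.max C1 C2) 0.
have L0 : 0 <= L by rewrite le_max lexx orbT.
have lip (phi dphi : R -> R) (u v : R) : (forall z : R, is_derive z 1 phi (dphi z)) ->
    (forall z, `|dphi z| <= L) -> `|phi u - phi v| <= L * `|u - v|.
  move=> dphi1 dphi2; wlog vu : u v / v <= u.
    move=> H; have [/H//|/ltW/H] := leP v u.
    by rewrite distrC [ `|v - u|]distrC.
  move: vu; rewrite le_eqVlt => /orP[/eqP->|vu]; first by rewrite !subrr normr0 mulr0.
  have [|z _] := @mvt_step R phi dphi v (u - v) _ (fun z _ => dphi1 z).
    by rewrite subr_gt0.
  by rewrite subrKC => ->; rewrite normrM ler_wpM2r.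
have L1 l : `|'D_(e1 R) f l| <= L.
  by rewrite (le_trans (b1 l I))// mulr1 !le_max lexx.
have L2 l : `|'D_(e2 R) f l| <= L.
  by rewrite (le_trans (b2 l I))// mulr1 !le_max lexx orbT.
exists L => // x y x' y'.
have i1 (z : R) : is_derive z 1 (fun z => f (z, y)) ('D_(e1 R) f (z, y)) :=
  is_derive_slice1 R f (z, y) (dt (z, y) I).
have i2 (z : R) : is_derive z 1 (fun z => f (x', z)) ('D_(e2 R) f (x', z)) :=
  is_derive_slice2 R f (x', z) (de (x', z) I).
have k1 := lip _ _ x x' i1 (fun z => L1 _).
have k2 := lip _ _ y y' i2 (fun z => L2 _).
rewrite mulrDr; apply: le_trans (lerD k1 k2).
by apply: le_trans (ler_normD _ _); rewrite addrA subrK.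
Qed.

End cutoff2.

(** * Moduli of complex numbers and convex combinations *)

Notation Re := complex.Re.
Notation Im := complex.Im.

Section cabs_facts.
Context (R : realType).
Implicit Types (z v : R[i]) (t : R).

Lemma cabsE z : cabs z = Num.sqrt (Re z ^+ 2 + Im z ^+ 2).
Proof. by case: z. Qed.

Lemma cabs_ge0 z : 0 <= cabs z.
Proof. by rewrite cabsE sqrtr_ge0. Qed.

Lemma cabs_sqr z : cabs z ^+ 2 = Re z ^+ 2 + Im z ^+ 2.
Proof. by rewrite cabsE sqr_sqrtr// addr_ge0 ?sqr_ge0. Qed.

Lemma cabs_Re z : `|Re z| <= cabs z.
Proof. by rewrite cabsE -sqrtr_sqr ler_wsqrtr// lerDl sqr_ge0. Qed.

Lemma cabs_Im z : `|Im z| <= cabs z.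
Proof. by rewrite cabsE -sqrtr_sqr ler_wsqrtr// lerDr sqr_ge0. Qed.

Lemma cabs_le z : cabs z <= `|Re z| + `|Im z|.
Proof.
rewrite -ler_sqr ?nnegrE ?cabs_ge0 ?addr_ge0// cabs_sqr.
rewrite -[Re z ^+ 2]real_normK ?num_real// -[Im z ^+ 2]real_normK ?num_real//.
by rewrite sqrrD lerD2r lerDl mulrn_wge0// mulr_ge0.
Qed.

Definition mix t z v : R[i] :=
  Complex (t * Re z + (1 - t) * Re v) (t * Im z + (1 - t) * Im v).

Lemma mix_close t z v : 0 <= t <= 1 -> cabs z - cabs (v - z) <= cabs (mix t z v).
Proof.
move=> /andP[t0 t1].
have e : z = mix t z v + Complex (1 - t) 0 * (z - v).
  by case: z v => a b [c e]; apply/eqP; rewrite /mix eq_complex/=; apply/andP; split;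
    apply/eqP; ring.
have := le_normcD (mix t z v) (Complex (1 - t) 0 * (z - v)).
rewrite -e ComplexField.Normc.normcM -(normcN (z - v)) opprB.
have -> : cabs (Complex (1 - t) 0) = 1 - t.
  by rewrite cabsE/= expr0n addr0 sqrtr_sqr ger0_norm// subr_ge0.
have := cabs_ge0 (v - z); nra.
Qed.

(** z and v = s i lie in one closed half-plane, so their imaginary parts add without cancellation.
    In the mixture |Re| + |Im| is at least t |z| + 1 - t >= c, and the modulus is at least half of
    this sum. *)
Lemma mix_sides t z v (s c : R) : 0 <= t <= 1 -> c <= 1 -> c <= cabs z ->
  `|s| = 1 -> 0 <= s * Im z -> v = Complex 0 s -> c / 2 <= cabs (mix t z v).
Proof.
move=> /andP[t0 t1] c1 cz s1 sz ->.
have h1 := cabs_Re (mix t z (Complex 0 s)).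
have h2 := cabs_Im (mix t z (Complex 0 s)).
have e2 : `|Im (mix t z (Complex 0 s))| = t * `|Im z| + (1 - t).
  have [s0|s0] := leP 0 s.
    rewrite (ger0_norm s0) in s1; rewrite /= s1 mulr1; rewrite s1 mul1r in sz.
    by rewrite (ger0_norm sz) ger0_norm// addr_ge0 ?mulr_ge0// subr_ge0.
  have {}s1 : s = -1 by rewrite (ltr0_norm s0) in s1; rewrite -s1 opprK.
  rewrite /= s1 mulrN1; rewrite s1 mulN1r oppr_ge0 in sz.
  rewrite (ler0_norm sz) ler0_norm; first by ring.
  by rewrite subr_le0; apply: (@le_trans _ _ 0); rewrite ?mulr_ge0_le0// subr_ge0.
have e1 : `|Re (mix t z (Complex 0 s))| = t * `|Re z|.
  by rewrite /= mulr0 addr0 normrM ger0_norm.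
have := cabs_le z; rewrite e1 in h1; rewrite e2 in h2 => h3; nra.
Qed.

End cabs_facts.

(** * Clusters of a set of reals *)

Section clusters.
Context (R : realType).
Variables (Sg : set R) (g : R).
Hypothesis g0 : 0 < g.
Implicit Types (s t x y : R).

(** An equivalence on [Sg] whose classes are the clusters. It is stated by the absence of gaps of
    length [g], not by chains of short steps, because what is known about eigenvalues are intervals
    free of them. *)
Definition linked s t := [/\ Sg s, Sg t & forall z, Num.min s t <= z ->
  z + g <= Num.max s t -> exists2 y, Sg y & z < y < z + g].

Lemma linked_near s t : Sg s -> Sg t -> `|s - t| < g -> linked s t.
Proof.
move=> Ss St st; split => // z z1 z2; exfalso.
have [h|h] := leP s t.
  by move: z1 z2; rewrite min_l// max_r//; move: st; rewrite ler0_norm ?subr_le0//; lra.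
have ts := ltW h.
by move: z1 z2; rewrite (min_r ts) (max_l ts); move: st; rewrite gtr0_norm ?subr_gt0//; lra.
Qed.

Lemma linked_sym s t : linked s t -> linked t s.
Proof. by move=> [Ss St H]; split => // z; rewrite minC maxC; exact: H. Qed.

(** An interval around t contains the point t of [Sg]; any other interval lies on one side of t,
    where one of the two hypotheses applies. *)
Lemma linked_trans s t u : linked s t -> linked t u -> linked s u.
Proof.
move=> [Ss St H1] [_ Su H2]; split => // z.
rewrite ge_min le_max => z1 z2.
have [/andP[h1 h2]|] := boolP (z < t < z + g); first by exists t => //; apply/andP.
rewrite negb_and -!leNgt => /orP[tz|zt].
  case/orP: z2 => z2.
    by apply: H1; rewrite ?ge_min ?le_max ?tz ?z2 ?orbT.
  by apply: H2; rewrite ?ge_min ?le_max ?tz ?z2 ?orbT.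
case/orP: z1 => z1.
  by apply: H1; rewrite ?ge_min ?le_max ?zt ?z1 ?orbT.
by apply: H2; rewrite ?ge_min ?le_max ?zt ?z1 ?orbT.
Qed.

Definition thick (r : R) : set R := [set x | exists2 y, Sg y & `|x - y| < r].

Lemma thick_near r x : thick r x -> \forall x' \near x, thick r x'.
Proof.
move=> [y Sy xy].
have e0 : 0 < r - `|x - y| by rewrite subr_gt0.
apply/nbhs_ballP; exists (r - `|x - y|) => //= x' xx'; exists y => //.
have := ler_normD (x' - x) (x - y); rewrite addrA subrK.
by move: xx'; rewrite /ball/= distrC; lra.
Qed.

Variable rho : R.
Hypothesis rhog : rho <= g / 4.

Definition cluster_mem x : set R :=
  [set t | exists s, `|x - s| < rho /\ linked s t].

(** The choice is made from a set that is the same for all x near one cluster, so the center does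
    not move with x. Far from [Sg] the set is empty and the value is the default 0. *)
Definition cluster_center x : R := xget 0 (cluster_mem x).

Lemma centerP x : thick rho x -> exists2 s, `|x - s| < rho & linked s (cluster_center x).
Proof.
move=> [s Ss xs]; have : cluster_mem x (cluster_center x).
  apply: (@xgetI _ _ _ s); exists s; split => //.
  by apply: linked_near => //; rewrite subrr normr0.
by move=> [s' [? ?]]; exists s'.
Qed.

(** If x and x' are less than g / 4 apart, points of [Sg] within [rho] of them are less than g / 4 +
    2 rho < g apart, hence linked; so [cluster_mem] is the same set at x and at x'. *)
Lemma center_near x : thick rho x -> \forall x' \near x, cluster_center x' = cluster_center x.
Proof.
move=> tx; have := thick_near _ _ tx.
have nb : nbhs x (ball x (g / 4)) by apply: nbhsx_ballx; rewrite divr_gt0.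
move=> tn; near=> x'; rewrite /cluster_center; congr (xget 0 _).
have hb : ball x (g / 4) x' by near: x'.
have tx' : thick rho x' by near: x'.
rewrite /ball/= in hb.
have sub (a b t : R) : `|a - b| < g / 4 -> thick rho b -> cluster_mem a t -> cluster_mem b t.
  move=> ab [s Ss bs] [s' [as' l]]; exists s; split => //.
  have [Ss' _ _] := l.
  apply: linked_trans l; apply: linked_near => //.
  have := ler_normD (s - b) (b - s').
  have := ler_normD (b - a) (a - s').
  rewrite !addrA !subrK (distrC s b) (distrC b a) => h1 h2.
  move: ab bs as' h1 h2 rhog g0; move: (`|a - b|) (`|b - s|) (`|a - s'|) (`|b - s'|) (`|s - s'|) => n1 n2 n3 n4 n5. lra.
apply/seteqP; split => t; apply: sub => //.
by rewrite distrC.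
Unshelve. all: by end_near.
Qed.

End clusters.

(** * Patching over boxes of clusters *)

Section patching.
Context (R : realType).
Variables (Sg : set R) (g D : R) (U : set R).
Hypotheses (g0 : 0 < g) (D0 : 0 <= D).
Hypothesis linked_dist : forall s t, linked R Sg g s t -> `|s - t| <= D.
Hypothesis linked_box : forall s s' t t' (a : R),
  linked R Sg g s s' -> linked R Sg g t t' -> 0 <= a <= 1 ->
  ~ U (a * s + (1 - a) * s' - (a * t + (1 - a) * t')).
Variables (F : R * R -> R[i]) (c M : R).
Hypothesis F_class : forall N, Cl R setT N (fun=> 1) (@Re R \o F) /\
  Cl R setT N (fun=> 1) (@Im R \o F).
Hypotheses (c0 : 0 < c) (c1 : c <= 1).
Hypothesis F_ge : forall x y, ~ U (x - y) -> M <= Num.max x y -> c <= cabs (F (x, y)).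

Lemma cabs_lipschitz : exists2 L, 0 < L & forall x y x' y',
  cabs (F (x, y) - F (x', y')) <= L * (`|x - x'| + `|y - y'|).
Proof.
have [h1 h2] := F_class 1.
have [L1 L10 l1] := Cl_lipschitz _ _ h1; have [L2 L20 l2] := Cl_lipschitz _ _ h2.
exists (L1 + L2 + 1); first by move: c0 c1; lra.
move=> x y x' y'; apply: le_trans (cabs_le _ _) _.
have -> : Re (F (x, y) - F (x', y')) = Re (F (x, y)) - Re (F (x', y')).
  by case: (F _) (F _) => ? ? [].
have -> : Im (F (x, y) - F (x', y')) = Im (F (x, y)) - Im (F (x', y')).
  by case: (F _) (F _) => ? ? [].
by rewrite mulrDl mulrDl -addrA lerD ?l1// -[leLHS]addr0 lerD ?l2// mulr_ge0 ?addr_ge0.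
Qed.

Section patch.
Variable L : R.
Hypothesis L0 : 0 < L.
Hypothesis lip : forall x y x' y',
  cabs (F (x, y) - F (x', y')) <= L * (`|x - x'| + `|y - y'|).
Variable N : nat.
Hypothesis N0 : (0 < N)%N.
Hypothesis N_large : L * (2 * (D + g)) / N%:R <= c / 4.
Variables (rho del : R).
Hypotheses (rho0 : 0 < rho) (rhog : rho <= g / 4) (rhoL : L * rho <= c / 4).
Hypotheses (del0 : 0 < del) (del_rho : (2 * N.+2%:R + 2) * del <= rho).
Notation cen := (cluster_center R Sg g rho).

(** Consecutive radii differ by more than the transition width [del] of the cutoffs, so that
    [psi n.+1] is 1 wherever [psi n] does not vanish. *)
Definition rad (n : nat) : R := (2 * n%:R + 1) * del.

Lemma rad_rho n : (n <= N.+2)%N -> rad n + del <= rho.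
Proof.
move=> nN; apply: le_trans del_rho; rewrite /rad -[X in _ + X]mul1r -mulrDl.
rewrite ler_pM2r//; have : n%:R <= N.+2%:R :> R by rewrite ler_nat.
lra.
Qed.

(** A homothety about the pair of centers. Both coordinates shrink at the same rate, which is the
    form that [linked_box] covers. *)
Definition contraction (n : nat) (l : R * R) : R * R :=
  ((1 - n%:R / N%:R) * l.1 + n%:R / N%:R * cen l.1,
   (1 - n%:R / N%:R) * l.2 + n%:R / N%:R * cen l.2).

Definition sidesign (l : R * R) : R := if 0 <= Im (F (cen l.1, cen l.2)) then 1 else -1.

(* The frames slide F along the segment from l to the pair of cluster centers,
   which is locally constant in l, and then turn to +-i and to 1.  Consecutive
   frames never point in opposite directions, so their mixtures stay away from 0. *)
Definition frame (n : nat) (l : R * R) : R[i] :=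
  if (n <= N)%N then F (contraction n l)
  else if n == N.+1 then Complex 0 (sidesign l) else 1.

Definition near_box (l : R * R) := thick R Sg rho l.1 /\ thick R Sg rho l.2.

Lemma near_box_open : open near_box.
Proof.
rewrite openE => l [h1 h2]; rewrite /interior.
have n1 : \forall z \near l.1, thick R Sg rho z by exact: thick_near h1.
have n2 : \forall z \near l.2, thick R Sg rho z by exact: thick_near h2.
have k1 : \forall z \near l, _ := continuous_xcoord R true l _ n1.
have k2 : \forall z \near l, _ := continuous_xcoord R false l _ n2.
by apply: filterS (filterI k1 k2).
Qed.

Lemma cen_near l : near_box l ->
  \forall l' \near l, cen l'.1 = cen l.1 /\ cen l'.2 = cen l.2.
Proof.
move=> [h1 h2].
have n1 : \forall z \near l.1, cen z = cen l.1 by exact: center_near h1.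
have n2 : \forall z \near l.2, cen z = cen l.2 by exact: center_near h2.
have k1 : \forall z \near l, _ := continuous_xcoord R true l _ n1.
have k2 : \forall z \near l, _ := continuous_xcoord R false l _ n2.
by apply: filterS (filterI k1 k2).
Qed.

Lemma frame_class n k : Cl R near_box k (fun=> 1) (@Re R \o frame n) /\
  Cl R near_box k (fun=> 1) (@Im R \o frame n).
Proof.
rewrite /frame; case: (leqP n N) => nN.
  have aff l : near_box l -> exists q : R * R, \near l,
    contraction n l = ((1 - n%:R / N%:R) * l.1 + q.1, (1 - n%:R / N%:R) * l.2 + q.2).
    move=> bl; exists (n%:R / N%:R * cen l.1, n%:R / N%:R * cen l.2).
    by apply: filterS (cen_near l bl) => z [e1 e2]; rewrite /contraction e1 e2.
  have [r i] := F_class k.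
  by split; [exact: (Cl_affine _ _ _ _ _ _ near_box_open aff r)|
             exact: (Cl_affine _ _ _ _ _ _ near_box_open aff i)].
case: eqP => _; last by split; exact: (Cl_cst _ _ _ _ near_box_open).
split; first exact: (Cl_cst _ _ _ _ near_box_open).
apply: (Cl_locally_cst _ _ _ _ 1 near_box_open).
  by move=> l _ /=; rewrite /sidesign; case: ifP; rewrite ?normrN normr1.
by move=> l /cen_near; apply: filterS => z [e1 e2] /=; rewrite /sidesign e1 e2.
Qed.

(* the points swept by the contraction stay within rho of the hull of a
   pair of clusters *)
Lemma contraction_ge n (l : R * R) : (n <= N)%N -> near_box l -> M + D + g <= Num.max l.1 l.2 ->
  c / 2 <= cabs (F (contraction n l)).
Proof.
move=> nN [/(centerP R Sg g g0)[s s1 ls] /(centerP R Sg g g0)[t t1 lt]] hM.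
set a : R := 1 - n%:R / N%:R.
have a01 : 0 <= a <= 1.
  rewrite /a subr_ge0 ler_pdivrMr ?ltr0n// mul1r ler_nat nN gerBl.
  by rewrite divr_ge0.
have an : n%:R / N%:R = 1 - a by rewrite /a opprB addrC subrK.
have := linked_box _ _ _ _ a ls lt a01 => nU.
have hd (u s' : R) : `|u - s'| < rho -> linked R Sg g s' (cen u) ->
   `|a * s' + (1 - a) * cen u - (a * u + (1 - a) * cen u)| <= rho /\
   u - (D + rho) <= a * s' + (1 - a) * cen u.
  move=> us' l'; have := linked_dist _ _ l'.
  rewrite (_ : a * s' + _ - _ = a * (s' - u)); last by ring.
  case/andP: a01 => a0 a1; rewrite normrM (ger0_norm a0) (distrC s' u) => h.
  split; first by have := normr_ge0 (u - s'); nra.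
  move: us' h; rewrite ltr_norml ler_norml => /andP[? ?] /andP[? ?].
  by nra.
have [d1 m1] := hd _ _ s1 ls; have [d2 m2] := hd _ _ t1 lt.
(* Compared with l, the point of the hull loses at most D + rho in the larger coordinate, which the
   margin D + g absorbs. There [F] is at least c; moving to the contracted l changes it by at most 2
   L rho <= c / 2. *)
have /(F_ge _ _ nU) h : M <= Num.max (a * s + (1 - a) * cen l.1) (a * t + (1 - a) * cen l.2).
  rewrite le_max; move: hM; rewrite le_max => /orP[h|h]; apply/orP; [left|right].
    by apply: le_trans m1; move: g0 rhog; lra.
  by apply: le_trans m2; move: g0 rhog; lra.
have := lip (a * s + (1 - a) * cen l.1) (a * t + (1 - a) * cen l.2)
  (a * l.1 + (1 - a) * cen l.1) (a * l.2 + (1 - a) * cen l.2).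
move=> h2.
have := le_normcD (F (a * s + (1 - a) * cen l.1, a * t + (1 - a) * cen l.2)
  - F (a * l.1 + (1 - a) * cen l.1, a * l.2 + (1 - a) * cen l.2))
  (F (a * l.1 + (1 - a) * cen l.1, a * l.2 + (1 - a) * cen l.2)).
rewrite subrK /contraction -/a an => h3.
have : L * (`|a * s + (1 - a) * cen l.1 - (a * l.1 + (1 - a) * cen l.1)| +
   `|a * t + (1 - a) * cen l.2 - (a * l.2 + (1 - a) * cen l.2)|) <= L * (rho + rho).
  by rewrite ler_pM2l// lerD.
rewrite mulrDr; move: rhoL; lra.
Qed.

Lemma frame_mix n (l : R * R) t : near_box l -> M + D + g <= Num.max l.1 l.2 -> 0 <= t <= 1 ->
  c / 4 <= cabs (mix R t (frame n l) (frame n.+1 l)).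
Proof.
move=> bl hM t01; rewrite /frame.
have [nN|nN] := ltnP n N.
  (* Two sliding frames: the first has modulus at least c / 2, and one slide moves each coordinate
     by at most (D + g) / N, hence the value by at most c / 4. *)
  rewrite (ltnW nN); apply: le_trans (mix_close _ _ _ _ t01).
  have h1 := contraction_ge n l (ltnW nN) bl hM.
  have : cabs (F (contraction n.+1 l) - F (contraction n l)) <= c / 4.
    apply: le_trans (lip _ _ _ _) _; apply: le_trans N_large.
    rewrite -(mulrA L (2 * (D + g))) (ler_pM2l L0).
    have hd (u : R) : thick R Sg rho u -> `|(1 - n.+1%:R / N%:R) * u + n.+1%:R / N%:R * cen u -
      ((1 - n%:R / N%:R) * u + n%:R / N%:R * cen u)| <= (D + g) / N%:R.
      move=> /(centerP R Sg g g0)[s s1 /linked_dist s2].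
      rewrite (_ : (1 - n.+1%:R / N%:R) * u + _ - _ = (cen u - u) / N%:R); last first.
        by rewrite -natr1; field; rewrite pnatr_eq0 -lt0n.
      rewrite normrM [ `|N%:R^-1|]ger0_norm ?invr_ge0// ler_pM2r ?invr_gt0 ?ltr0n//.
      have := ler_normD (cen u - s) (s - u); rewrite addrA subrK.
      rewrite (distrC s u) (distrC (cen u) s); move: g0 rhog; lra.
    case: bl => b1 b2; have k1 := hd _ b1; have k2 := hd _ b2.
    apply: le_trans (lerD k1 k2) _.
    by rewrite le_eqVlt (_ : _ + _ = 2 * (D + g) / N%:R) ?eqxx//; ring.
  lra.
have [->|nN1] := eqVneq n N.
  rewrite leqnn eqxx.
  (* The last sliding frame is the value of [F] at the pair of centers, and [sidesign] picks the
     point +-i in its closed half-plane. *)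
  apply: (@le_trans _ _ ((c / 2) / 2)); first by move: c0 c1; lra.
  apply: (mix_sides _ _ _ _ (sidesign l)) => //.
  - by move: c1; lra.
  - exact: contraction_ge.
  - by rewrite /sidesign; case: ifP; rewrite ?normrN normr1.
  rewrite /sidesign.
  have -> : contraction N l = (cen l.1, cen l.2).
    by rewrite /contraction divff ?pnatr_eq0 -?lt0n// subrr !mul0r !mul1r !add0r.
  by case: ifP; [rewrite mul1r|move/negbT; rewrite -ltNge mulN1r oppr_ge0 => /ltW].
have nN' : (N < n)%N by rewrite ltn_neqAle eq_sym nN1.
rewrite leqNgt nN' /= eqSS (negbTE nN1).
have one : cabs (1 : R[i]) = 1 by exact: ComplexField.Normc.normc1.
case: eqP => _.
  (* Between +-i and 1 the absolute real and imaginary parts add up to 1, so one of them is at least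
     1/2. *)
  have h1 := cabs_Re _ (mix R t (Complex 0 (sidesign l)) 1).
  have h2 := cabs_Im _ (mix R t (Complex 0 (sidesign l)) 1).
  move: h1 h2; rewrite /= !mulr0 !add0r !mulr1 addr0 normrM.
  have -> : `|sidesign l| = 1 by rewrite /sidesign; case: ifP; rewrite ?normrN normr1.
  move: t01 => /andP[t0 t1]; rewrite mulr1 !ger0_norm ?subr_ge0//; move: c1; lra.
apply: le_trans (mix_close _ _ _ _ t01); rewrite subrr ComplexField.Normc.normc0 one; move: c1; lra.
Qed.

Variable psi : nat -> R -> R.
Hypothesis psi01 : forall n x, 0 <= psi n x <= 1.
Hypothesis psi1 : forall n x, thick R Sg (rad n) x -> psi n x = 1.
Hypothesis psi_supp : forall n x, psi n x != 0 ->
  exists2 y, thick R Sg (rad n) y & `|x - y| <= del.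
Hypothesis psi_class : forall n k b, Cl R setT k (fun=> 1) (fun l => psi n (xcoord R b l)).

Definition Psi n (l : R * R) : R := psi n l.1 * psi n l.2.

(** Nested mixtures with the constant 1 innermost. In use n + k = N + 2, so the innermost 1 is the
    frame of index N + 2. As the supports are nested, at most two consecutive frames contribute at a
    point. *)
Fixpoint patch n k (l : R * R) : R[i] :=
  if k is k'.+1 then mix R (Psi n l) (frame n l) (patch n.+1 k' l) else 1.

Lemma psi_thick n x : psi n x != 0 -> thick R Sg (rad n.+1) x.
Proof.
move=> /psi_supp[y [s Ss ys] xy]; exists s => //.
have := ler_normD (x - y) (y - s); rewrite addrA subrK.
have : rad n + del + del = rad n.+1 by rewrite /rad -natr1; ring.
by move: ys xy del0; lra.
Qed.

Lemma thick_le r r' x : r <= r' -> thick R Sg r x -> thick R Sg r' x.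
Proof. by move=> rr [s Ss h]; exists s => //; exact: lt_le_trans rr. Qed.

Lemma Psi01 n l : 0 <= Psi n l <= 1.
Proof.
have /andP[? ?] := psi01 n l.1; have /andP[? ?] := psi01 n l.2.
by rewrite /Psi mulr_ge0//= mulr_ile1.
Qed.

Lemma Psi_class n k : Cl R setT k (fun=> 1) (Psi n).
Proof.
exact: (Cl_mul1 _ _ _ _ (fun l => psi n l.1) (fun l => psi n l.2) openT
  (fun _ _ => ler01) (psi_class n k true) (psi_class n k false)).
Qed.

Lemma Psi_near_box n l : (n <= N.+1)%N -> Psi n l != 0 -> near_box l.
Proof.
rewrite /Psi mulf_eq0 negb_or => nN /andP[/psi_thick h1 /psi_thick h2].
have rr : rad n.+1 <= rho.
  by apply: le_trans (rad_rho n.+1 nN); rewrite lerDl ltW.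
by split; [exact: thick_le h1|exact: thick_le h2].
Qed.

Lemma Psi_off n l : (n <= N.+1)%N -> ~ near_box l -> \forall l' \near l, Psi n l' = 0.
Proof.
move=> nN nb.
have off b : ~ thick R Sg rho (xcoord R b l) ->
    \forall l' \near l, psi n (xcoord R b l') = 0.
  move=> nt.
  have h : \forall x \near xcoord R b l, psi n x = 0.
    have nbx : nbhs (xcoord R b l) (ball (xcoord R b l) del) by exact: nbhsx_ballx.
    apply: filterS nbx => x xb; apply/eqP/negPn/negP => /psi_thick[s Ss xs].
    apply: nt; exists s => //; rewrite /ball/= in xb.
    have := ler_normD (xcoord R b l - x) (x - s); rewrite addrA subrK => h.
    apply: le_lt_trans h _; apply: lt_le_trans (rad_rho n.+1 nN).
    by rewrite addrC ltrD.
  exact: (continuous_xcoord R b l _ h).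
have [h1|h1] := pselect (thick R Sg rho l.1); last first.
  by apply: filterS (off true h1) => z /= e; rewrite /Psi e mul0r.
have [h2|h2] := pselect (thick R Sg rho l.2); last first.
  by apply: filterS (off false h2) => z /= e; rewrite /Psi e mulr0.
by exfalso; apply: nb.
Qed.

(** A frame is regular only near the boxes, where the centers are locally constant; the cutoff
    vanishes around every other point, so the product is regular everywhere. *)
Lemma cut_frame_class n k (f : R * R -> R) : (n <= N.+1)%N ->
  Cl R near_box k (fun=> 1) f -> Cl R setT k (fun=> 1) (fun l => Psi n l * f l).
Proof.
move=> nN cf.
pose D2 := interior [set l | Psi n l = 0].
have -> : setT = near_box `|` D2.
  apply/esym; rewrite -subTset => l _.
  by have [h|h] := pselect (near_box l); [left|right; exact: Psi_off].
apply: Cl_union => //.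
  apply: Cl_mul1 => //; first exact: near_box_open.
  exact: Cl_sub (Psi_class n k).
have oD2 : open D2 by exact: open_interior.
apply: (Cl_congr _ _ _ _ (fun=> 0)) => //; last exact: Cl_cst.
by move=> l; rewrite inE => /interior_subset/= ->; rewrite mul0r.
Qed.

Lemma mix_part_class n k (f h : R * R -> R) : (n <= N.+1)%N ->
  Cl R near_box k (fun=> 1) f -> Cl R setT k (fun=> 1) h ->
  Cl R setT k (fun=> 1) (fun l => Psi n l * f l + (1 - Psi n l) * h l).
Proof.
move=> nN cf ch; apply: (Cl_add _ _ _ _ _ _ openT); first exact: cut_frame_class.
apply: (Cl_mul1 _ _ _ _ _ _ openT) => //.
apply: (Cl_add _ _ _ _ _ _ openT); first exact: (Cl_cst _ _ _ _ openT).
by apply: (Cl_opp _ _ _ _ _ openT) => //; exact: Psi_class.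
Qed.

Lemma patch_class n k j : (n + k = N.+2)%N ->
  Cl R setT j (fun=> 1) (@Re R \o patch n k) /\
  Cl R setT j (fun=> 1) (@Im R \o patch n k).
Proof.
elim: k n => [|k IH] n nk; first by split; exact: (Cl_cst _ _ _ _ openT).
have nN : (n <= N.+1)%N by rewrite -ltnS -nk addnS ltnS leq_addr.
have [r i] := IH n.+1 ltac:(by rewrite addSn -addnS).
have [fr fi] := frame_class n j.
by split; exact: mix_part_class.
Qed.

Lemma mix0 z v : mix R 0 z v = v.
Proof. by rewrite /mix subr0 !mul0r !mul1r !add0r; case: v. Qed.

Lemma mix1 z v : mix R 1 z v = z.
Proof. by rewrite /mix subrr !mul0r !mul1r !addr0; case: z. Qed.

(** At the first index with [Psi n l] nonzero, everything inside that mixture collapses to the next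
    frame, and [frame_mix] applies. *)
Lemma patch_ge n k (l : R * R) : (n + k = N.+2)%N -> M + D + g <= Num.max l.1 l.2 ->
  c / 4 <= cabs (patch n k l).
Proof.
move=> + hM; elim: k n => [|k IH] n nk.
  have e1 : cabs (1 : R[i]) = 1 by exact: ComplexField.Normc.normc1.
  by rewrite -[patch n 0 l]/(1 : R[i]) e1; move: c1; lra.
rewrite -[patch n k.+1 l]/(mix R (Psi n l) (frame n l) (patch n.+1 k l)).
have nN : (n <= N.+1)%N by rewrite -ltnS -nk addnS ltnS leq_addr.
have nk' : (n.+1 + k = N.+2)%N by rewrite addSn -addnS.
have [->|P0] := eqVneq (Psi n l) 0; first by rewrite mix0; exact: IH.
have bl := Psi_near_box n l nN P0.
have -> : patch n.+1 k l = frame n.+1 l.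
  case: k {IH nk} nk' => [|k] /= nk'.
    rewrite addn0 in nk'; case: nk' => ->; rewrite /frame.
    by rewrite ltnNge leqnSn /= eqn_leq ltnn.
  move: P0; rewrite /Psi mulf_eq0 negb_or => /andP[/psi_thick h1 /psi_thick h2].
  by rewrite !psi1// mulr1 mix1.
by apply: frame_mix => //; exact: Psi01.
Qed.

Lemma patch_eq l : thick R Sg del l.1 -> thick R Sg del l.2 -> patch 0 N.+2 l = F l.
Proof.
move=> h1 h2; have d1 : del <= rad 0 by rewrite /rad mulr0 add0r mul1r.
have p1 := psi1 0 _ (thick_le _ _ _ d1 h1); have p2 := psi1 0 _ (thick_le _ _ _ d1 h2).
rewrite /= /Psi p1 p2.
rewrite mulr1 mix1 /frame /= /contraction !mul0r subr0 !mul1r !addr0.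
by case: l {h1 h2 p1 p2}.
Qed.

End patch.

Lemma patching : exists (H : R * R -> R[i]) (del c' M' : R),
  [/\ 0 < del, 0 < c',
   forall N, Cl R setT N (fun=> 1) (@Re R \o H) /\ Cl R setT N (fun=> 1) (@Im R \o H),
   forall l, thick R Sg del l.1 -> thick R Sg del l.2 -> H l = F l &
   forall l, M' <= Num.max l.1 l.2 -> c' <= cabs (H l)].
Proof.
have [L L0 lip] := cabs_lipschitz.
pose N := (Num.truncn (L * (2 * (D + g)) / (c / 4))).+1.
have N0 : (0 < N)%N by [].
have N_large : L * (2 * (D + g)) / N%:R <= c / 4.
  rewrite ler_pdivrMr ?ltr0n// [leRHS]mulrC -ler_pdivrMr ?divr_gt0//.
  by apply: ltW; rewrite /N truncnS_gt.
pose rho : R := Num.min (g / 4) (c / (4 * L)).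
have rho0 : 0 < rho by rewrite /rho lt_min !divr_gt0// mulr_gt0.
have rhog : rho <= g / 4 by rewrite /rho ge_min lexx.
have rhoL : L * rho <= c / 4.
  have h : rho <= c / (4 * L) by rewrite /rho ge_min lexx orbT.
  rewrite mulrC -ler_pdivlMr//; apply: le_trans h _.
  by rewrite invfM mulrA.
have d0 : 0 < 2 * N.+2%:R + 2 :> R by rewrite addr_gt0// mulr_gt0.
pose del : R := rho / (2 * N.+2%:R + 2).
have del0 : 0 < del by rewrite divr_gt0.
have del_rho : (2 * N.+2%:R + 2) * del <= rho.
  by rewrite /del mulrC divfK// lt0r_neq0.
have /choice[psi hpsi] n := cutoff_exists R (thick R Sg (rad del n)) del del0.
exists (patch N rho psi 0 N.+2), del, (c / 4), (M + D + g); split => //.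
- by rewrite divr_gt0.
- move=> j; apply: (patch_class N rho del rhog del0 del_rho psi) => //.
  + by move=> n x; have [_ _ h _] := hpsi n; exact: h.
  + by move=> n k b; have [_ _ _ h] := hpsi n; exact: h.
- move=> l h1 h2; apply: (patch_eq N rho del psi) => //.
  by move=> n x; have [_ h _ _] := hpsi n; exact: h.
- move=> l hM.
  apply: (patch_ge L L0 lip N N0 N_large rho del rhog rhoL del0 del_rho psi) => //.
  + by move=> n x; have [] := hpsi n.
  + by move=> n x; have [_ h _ _] := hpsi n; exact: h.
  + by move=> n x; have [_ _ h _] := hpsi n; exact: h.
Qed.

End patching.

(** * Clusters of logarithms of eigenvalues *)

Section gaps.
Context (R : realType).
Implicit Types (Sg : set R) (g r s t x y : R).

Lemma linked_ord Sg g s t : linked R Sg g s t -> linked R Sg g (Num.min s t) (Num.max s t).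
Proof. by move=> l; case: (leP s t) => _ //; exact: linked_sym. Qed.

Lemma linked_gap Sg g s t z : linked R Sg g s t -> s <= z -> z + g <= t ->
  exists2 y, Sg y & z < y < z + g.
Proof.
by move=> [_ _ H] sz zt; apply: H; rewrite ?ge_min ?le_max ?sz ?zt ?orbT.
Qed.

(** The extreme differences s - t' and s' - t lie on opposite sides of (a, b). If s - t <= a, then
    (t + a, t + b) lies between s and s' and is free of points of [Sg]; if s - t >= b, the same
    holds for (s - b, s - a) between t and t'. Both are at least g long, which a cluster does not
    allow. *)
Lemma box_avoids Sg g (a b : R) r s s' t t' :
  (forall s t, Sg s -> Sg t -> ~ (a < s - t < b)) -> g <= b - a -> a < r < b ->
  linked R Sg g s s' -> linked R Sg g t t' -> s - t' <= r <= s' - t -> False.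
Proof.
move=> av gab /andP[ar rb] ls lt /andP[r1 r2].
have [Ss Ss' _] := ls; have [St St' _] := lt.
have out x y : Sg x -> Sg y -> x - y <= a \/ b <= x - y.
  move=> Sx Sy; have nh := av x y Sx Sy; have [|h] := leP (x - y) a; first by left.
  by have [|h'] := leP b (x - y); [right|exfalso; apply/nh/andP].
have h1 : b <= s' - t by case: (out s' t Ss' St) => //; lra.
have h2 : s - t' <= a by case: (out s t' Ss St') => //; lra.
case: (out s t Ss St) => h3.
  have [||y Sy /andP[y1 y2]] := linked_gap _ _ _ _ (t + a) ls; try lra.
  by apply: (av y t Sy St); apply/andP; split; lra.
have [||y Sy /andP[y1 y2]] := linked_gap _ _ _ _ (s - b) lt; try lra.
by apply: (av s y Ss Sy); apply/andP; split; lra.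
Qed.

Lemma box_avoids_hull Sg g (a b : R) s s' t t' c :
  (forall s t, Sg s -> Sg t -> ~ (a < s - t < b)) -> g <= b - a ->
  linked R Sg g s s' -> linked R Sg g t t' -> 0 <= c <= 1 ->
  ~ (a < c * s + (1 - c) * s' - (c * t + (1 - c) * t') < b).
Proof.
move=> av gab /linked_ord ls /linked_ord lt /andP[c0 c1] h.
apply: (box_avoids _ _ _ _ _ _ _ _ _ av gab h ls lt).
have hl u v : Num.min u v <= c * u + (1 - c) * v <= Num.max u v.
  by case: (leP u v) => uv; apply/andP; split; nra.
have /andP[] := hl s s'; have /andP[] := hl t t'; move: (c * s + _) (c * t + _).
by move=> ? ? ? ? ? ?; apply/andP; split; lra.
Qed.

(** To the right of each point s of [Sg] there is a gap that a cluster cannot cross: (s + a, s + b)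
    if a >= 0, and (s - b, s - a) if b <= 0. If a < 0 < b, already s - s is a forbidden
    difference. *)
Lemma linked_dist Sg (a b : R) s t :
  (forall s t, Sg s -> Sg t -> ~ (a < s - t < b)) -> a < b ->
  linked R Sg (b - a) s t -> `|s - t| <= `|a| + `|b|.
Proof.
move=> av ab l.
have hm : forall s t, linked R Sg (b - a) s t -> s <= t ->  `|t - s| <= `|a| + `|b|.
  move=> {}s {}t {}l st; have [Ss St _] := l; rewrite ger0_norm ?subr_ge0//.
  have [a0|a0] := leP 0 a.
    rewrite (ger0_norm a0) ger0_norm; last lra.
    rewrite leNgt; apply/negP => h.
    have [||y Sy /andP[y1 y2]] := linked_gap _ _ _ _ (s + a) l; try lra.
    by apply: (av y s Sy Ss); apply/andP; split; lra.
  have [b0|b0] := leP b 0.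
    rewrite (ler0_norm b0) ltr0_norm//.
    rewrite leNgt; apply/negP => h.
    have [||y Sy /andP[y1 y2]] := linked_gap _ _ _ _ (s - b) l; try lra.
    by apply: (av s y Ss Sy); apply/andP; split; lra.
  by exfalso; apply: (av s s) => //; rewrite subrr a0.
have [st|/ltW st] := leP s t; first by rewrite distrC; exact: hm.
by apply: hm => //; exact: linked_sym.
Qed.

End gaps.

Section ratio.
Context (R : realType) (ev : R -> Prop) (alpha beta : R).
Hypothesis ab : alpha < beta.

Definition log_ev : set R := [set s | ev (expR s)].

Definition empty_interval (a e : R) := [/\ alpha < a < beta, 0 < e &
  forall l1 l2, ev l1 -> ev l2 -> ~ Gamma a e (l1, l2)].

(* logarithms of the slopes of the cones without pairs of eigenvalues *)
Definition empty_slopes : set R := [set r | exists a e : R,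
  empty_interval a e /\ `|expR r - a| < e].

Hypothesis gap : forall l l', 0 < l -> 0 < l' -> ev l -> ev l' -> l <> l' ->
  ~ (alpha < l / l' < beta).

Lemma GammaE (a e x y : R) : 0 < x -> 0 < y ->
  Gamma a e (x, y) <-> `|x / y - a| < e.
Proof.
move=> x0 y0; rewrite /Gamma/=.
have -> : x - a * y = (x / y - a) * y by field; exact: lt0r_neq0.
rewrite normrM (gtr0_norm y0) ltr_pM2r//.
by split=> [[]|].
Qed.

Lemma empty_interval_ratio a e s t : empty_interval a e -> log_ev s -> log_ev t ->
  ~ (`|expR (s - t) - a| < e).
Proof.
move=> [_ _ H] es et; rewrite expRB => h; apply: (H _ _ es et).
by apply/GammaE; rewrite ?expR_gt0.
Qed.

(* If alpha < 1 < beta, distinct logarithms are at least ln beta apart.  Otherwise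
   (alpha, beta) together with an empty interval is an interval that avoids every
   ratio of eigenvalues, and its logarithmic length separates the clusters. *)
Lemma clusters : (exists r, empty_slopes r) -> exists g D : R, [/\ 0 < g, 0 <= D,
  forall s t, linked R log_ev g s t -> `|s - t| <= D &
  forall s s' t t' a : R, linked R log_ev g s s' -> linked R log_ev g t t' ->
   0 <= a <= 1 -> ~ empty_slopes (a * s + (1 - a) * s' - (a * t + (1 - a) * t'))].
Proof.
have [/andP[a1 b1]|/negP n1 [r0 [a1 [e1 [I1 r0I]]]]] := boolP (alpha < 1 < beta).
  move=> _; have g0 : 0 < ln beta by apply: ln_gt0.
  have sep s t : log_ev s -> log_ev t -> s < t -> s + ln beta <= t.
    move=> es et st; rewrite leNgt; apply/negP => h.
    apply: (gap (expR t) (expR s)); rewrite ?expR_gt0//.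
      by move=> /expR_inj e; rewrite e ltxx in st.
    rewrite -expRB; apply/andP; split.
      by apply: (lt_trans a1); rewrite expR_gt1 subr_gt0.
    rewrite -[ltRHS]lnK ?posrE; last by rewrite (lt_trans ltr01).
    by rewrite ltr_expR; lra.
  have eqs s t : linked R log_ev (ln beta) s t -> s = t.
    move=> l; have [es et _] := l.
    wlog st : s t l es et / s <= t.
      move=> H; have [/H|/ltW ts] := leP s t; first exact.
      by apply/esym/H => //; exact: linked_sym.
    move: st; rewrite le_eqVlt => /orP[/eqP//|st].
    have [||y ey /andP[y1 y2]] := linked_gap _ _ _ _ _ s l; rewrite ?lexx ?sep//.
    by have := sep _ _ es ey y1; lra.
  exists (ln beta), 0; split => //.
    by move=> s t /eqs ->; rewrite subrr normr0.
  move=> s s' t t' a ls lt _; have [es _ _] := ls; have [et _ _] := lt.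
  rewrite -(eqs _ _ ls) -(eqs _ _ lt) (_ : _ - _ = s - t); last by ring.
  by move=> [a' [e' [Ie]]]; exact: empty_interval_ratio Ie es et.
have gap' s t : log_ev s -> log_ev t -> ~ (alpha < expR (s - t) < beta).
  move=> es et; have [e|st] := eqVneq s t; first by rewrite e subrr expR0.
  rewrite expRB; apply: gap; rewrite ?expR_gt0//.
  by move=> /expR_inj e; rewrite e eqxx in st.
(* Two ratio-free intervals that overlap, one containing the midpoint of the other, merge into a
   single one. *)
have join (u v a e : R) : u < a < v -> empty_interval a e ->
    (forall s t, log_ev s -> log_ev t -> ~ (u < expR (s - t) < v)) ->
    forall s t, log_ev s -> log_ev t ->
      ~ (Num.min u (a - e) < expR (s - t) < Num.max v (a + e)).
  move=> /andP[ua av] Ie uv s t es et; have := empty_interval_ratio _ _ _ _ Ie es et.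
  have := uv _ _ es et; have [_ e0 _] := Ie.
  move: (expR _) => x h1 h2 /andP[]; rewrite gt_min lt_max => h3 h4.
  have [xu|ux] := leP x u.
    apply: h2; rewrite ltr_norml; apply/andP; split; last by lra.
    by case/orP: h3; lra.
  have [vx|xv] := leP v x; last by apply: h1; rewrite ux.
  apply: h2; rewrite ltr_norml; apply/andP; split; first by lra.
  by case/orP: h4; lra.
have [ab1 e10 _] := I1.
pose al := Num.min alpha (a1 - e1); pose be := Num.max beta (a1 + e1).
have J0 : forall s t, log_ev s -> log_ev t -> ~ (al < expR (s - t) < be) :=
  join _ _ _ _ ab1 I1 gap'.
(* alpha and beta may be negative; but exp r0 lies in the empty interval, so its right end is
   positive. *)
have be0 : 0 < be.
  rewrite /be lt_max; apply/orP; right; apply: lt_trans (expR_gt0 r0) _.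
  by move: r0I; rewrite ltr_norml => /andP[]; lra.
have albe : al < be by rewrite /al /be gt_min lt_max ab.
(* If al <= 0, all ratios below be are excluded and the logarithmic interval reaches to - oo; b0 - 1
   is then an arbitrary left end. *)
pose b0 := ln be; pose a0 := if 0 < al then ln al else b0 - 1.
have a0b0 : a0 < b0.
  by rewrite /a0; case: ifP => [al0|_]; [rewrite ltr_ln|lra].
have lower (u v c x : R) : 0 < v -> c < x -> x < ln v -> (0 < u -> c = ln u) -> u < expR x < v.
  move=> v0 cx xv uc; apply/andP; split.
    have [u0|u0] := ltP 0 u; last by apply: le_lt_trans u0 (expR_gt0 _).
    by rewrite -[u]lnK ?posrE// ltr_expR -uc.
  by rewrite -[v]lnK ?posrE// ltr_expR.
have av : forall s t, log_ev s -> log_ev t -> ~ (a0 < s - t < b0).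
  move=> s t es et /andP[h1 h2]; apply: (J0 _ _ es et).
  by apply: (lower _ _ a0) => //; rewrite /a0 => ->.
exists (b0 - a0), (`|a0| + `|b0|); split.
- by rewrite subr_gt0.
- by rewrite addr_ge0.
- by move=> s t; exact: linked_dist.
(* [g] and [D] come from the interval of r0 alone. For another empty slope x the forbidden interval
   is enlarged by that of x; being longer, it still separates clusters defined by the gap b0 - a0.
   If its left end is not positive, the logarithmic left end is placed below both a0 and x. *)
move=> s s' t t' c ls lt c01; set x := (X in empty_slopes X) => -[a2 [e2 [I2 xI]]].
have [/andP[aa2 a2b] e20 _] := I2.
have a2J : al < a2 < be by rewrite /al /be gt_min aa2 lt_max a2b.
have J := join _ _ _ _ a2J I2 J0.
pose u := Num.min al (a2 - e2); pose v := Num.max be (a2 + e2).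
have v0 : 0 < v by rewrite /v lt_max be0.
have uv : u < v by rewrite /u /v gt_min lt_max albe.
have b0v : b0 <= ln v by rewrite /b0 ler_ln ?posrE// /v le_max lexx.
have xv : x < ln v.
  rewrite -ltr_expR lnK ?posrE// /v lt_max; apply/orP; right.
  by move: xI; rewrite ltr_norml => /andP[]; lra.
pose a' := if 0 < u then ln u else Num.min a0 (x - 1).
have a'a0 : a' <= a0.
  rewrite /a'; case: ifP => [u0|_]; last by rewrite ge_min lexx.
  have al0 : 0 < al by move: u0; rewrite /u lt_min => /andP[].
  by rewrite /a0 al0 ler_ln ?posrE// /u ge_min lexx.
have a'x : a' < x.
  rewrite /a'; case: ifP => [u0|_]; last by rewrite gt_min; apply/orP; right; lra.
  rewrite -ltr_expR lnK ?posrE// /u gt_min; apply/orP; right.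
  by move: xI; rewrite ltr_norml => /andP[]; lra.
have av' : forall s t, log_ev s -> log_ev t -> ~ (a' < s - t < ln v).
  move=> s1 t1 es et /andP[h1 h2]; apply: (J _ _ es et).
  by apply: (lower _ _ a') => //; rewrite /a' -/u => ->.
have ga : b0 - a0 <= ln v - a' by lra.
have nb := box_avoids_hull R log_ev (b0 - a0) a' (ln v) s s' t t' c av' ga ls lt c01.
by apply: nb; rewrite -/x a'x.
Qed.

End ratio.

(** * The elliptic symbol replacing a quasielliptic one *)

Section baseline.
Context (R : realType).
Implicit Types (l s : R * R) (b : bool).

Lemma is_derive_outer (phi : R -> R) (f : R * R -> R) b l (d e : R) :
  is_derive l (dir R b) f d -> is_derive (f l) 1 phi e ->
  is_derive l (dir R b) (phi \o f) (e * d).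
Proof.
move=> /is_derive_slice df dp; apply/is_derive_slice.
rewrite -(slice_xcoord R b l f) in dp.
exact: (is_derive1_comp dp df).
Qed.

(** In logarithmic coordinates, a smooth substitute for 1 + |l|, within a factor of 2 of it. *)
Definition jap l : R := 1 + expR l.1 + expR l.2.

Lemma jap_gt0 l : 0 < jap l.
Proof. by rewrite /jap !addr_gt0// expR_gt0. Qed.

Lemma jap_continuous : continuous jap.
Proof.
move=> l; apply: cvgD.
  apply: cvgD; first exact: cvg_cst.
  apply: (@continuous_comp _ _ _ fst expR); last exact: continuous_expR.
  exact: (continuous_xcoord R true).
apply: (@continuous_comp _ _ _ snd expR); last exact: continuous_expR.
exact: (continuous_xcoord R false).
Qed.

Lemma is_derive_jap b l : is_derive l (dir R b) jap (expR (xcoord R b l)).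
Proof.
have h b' := is_derive_xcoord R expR b' b l (expR (xcoord R b' l)) (is_derive_expR _).
have := is_deriveD (is_deriveD (is_derive_cst (1 : R) l (dir R b)) (h true)) (h false).
by move=> hh; apply: is_derive_eq hh _; case: b {h} => /=; rewrite ?add0r ?addr0.
Qed.

(** The logarithmic derivative of [jap]. Derivatives of shares are polynomials in shares, which are
    bounded by 1; this bounds all derivatives of powers of [jap] by the power itself. *)
Definition share b l : R := expR (xcoord R b l) / jap l.

Lemma share_bound b l : `|share b l| <= 1.
Proof.
rewrite /share ger0_norm ?divr_ge0 ?expR_ge0 ?(ltW (jap_gt0 _))//.
rewrite ler_pdivrMr ?jap_gt0// mul1r /jap.
by have := expR_ge0 l.1; have := expR_ge0 l.2; case: b => /=; lra.
Qed.

Lemma is_derive_share b b' l : is_derive l (dir R b') (share b)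
  (share b l * ((if b' == b then 1 else 0) - share b' l)).
Proof.
have j0 : jap l != 0 by rewrite lt0r_neq0 ?jap_gt0.
have h1 := is_derive_xcoord R expR b b' l (expR (xcoord R b l)) (is_derive_expR _).
have h2 : is_derive l (dir R b') (fun l => (jap l)^-1) (- (jap l) ^- 2 *: expR (xcoord R b' l)).
  have [jd je] := is_derive_jap b' l.
  by apply: DeriveDef; [exact: derivableV|rewrite deriveV// je].
have h3 := is_deriveM h1 h2.
apply: is_derive_eq h3 _; rewrite /share /GRing.scale/=.
by case: (b' == b); field.
Qed.

Lemma share_continuous b l : {for l, continuous (share b)}.
Proof.
apply: cvgM; last by apply: cvgV; [rewrite lt0r_neq0 ?jap_gt0|exact: jap_continuous].
apply: (@continuous_comp _ _ _ (xcoord R b) expR); last exact: continuous_expR.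
exact: continuous_xcoord.
Qed.

Lemma share_class N b : Cl R setT N (fun=> 1) (share b).
Proof.
have B b' : exists C, forall l, setT l -> `|share b' l| <= C * 1.
  by exists 1 => l _; rewrite mulr1; exact: share_bound.
have C b' l : setT l -> {for l, continuous (share b')} by move=> _; exact: share_continuous.
elim: N b => [|N IH] b; first by split=> [||//]; [exact: B|exact: C].
apply: (@Cl_intro _ _ _ _ _ (fun b' l => share b l * ((if b' == b then 1 else 0) - share b' l))
   openT (B b) (C b)).
  by move=> b' l _; exact: is_derive_share.
move=> b'; apply: (Cl_mul1 _ _ _ _ _ _ openT) => //.
apply: (Cl_add _ _ _ _ _ _ openT); first exact: (Cl_cst _ _ _ _ openT).
by apply: (Cl_opp _ _ _ _ _ openT).
Qed.

Definition japow (r : R) l : R := jap l `^ r.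

Lemma japow_gt0 r l : 0 < japow r l.
Proof. by rewrite powR_gt0// jap_gt0. Qed.

Lemma is_derive_japow r b l : is_derive l (dir R b) (japow r) (r * share b l * japow r l).
Proof.
have h := is_derive_outer (fun x => x `^ r) jap b l _ _ (is_derive_jap b l) (is_derive1_powR _ (jap_gt0 l)).
apply: is_derive_eq h _; rewrite /share /japow powRD ?powRr1 ?powR_inv1 ?ltW ?jap_gt0//.
  by ring.
by apply/implyP => _; rewrite lt0r_neq0 ?jap_gt0.
Qed.

Lemma japow_continuous r l : {for l, continuous (japow r)}.
Proof.
apply: (@continuous_comp _ _ _ jap (fun x => x `^ r)); first exact: jap_continuous.
exact: is_derive_continuous (is_derive1_powR r (jap_gt0 l)).
Qed.

Lemma japow_class N r : Cl R setT N (japow r) (japow r).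
Proof.
have B : exists C, forall l, setT l -> `|japow r l| <= C * japow r l.
  by exists 1 => l _; rewrite mul1r ger0_norm// ltW// japow_gt0.
have C l : setT l -> {for l, continuous (japow r)} by move=> _; exact: japow_continuous.
elim: N => [|N IH]; first by split=> [||//].
apply: (@Cl_intro _ _ _ _ _ (fun b l => r * share b l * japow r l) openT B C).
  by move=> b l _; exact: is_derive_japow.
move=> b; apply: (Cl_mul1 _ _ _ _ _ _ openT) => //.
  by move=> l _; rewrite ltW// japow_gt0.
apply: (Cl_mul1 _ _ _ _ (fun=> r) _ openT) => //; last exact: share_class.
exact: (Cl_cst _ _ _ _ openT).
Qed.

Lemma powR_comparable (r K : R) : 1 <= K -> exists2 k, 0 < k &
  forall x y, 0 < x -> x <= y -> y <= K * x -> x `^ r <= k * y `^ r /\ y `^ r <= k * x `^ r.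
Proof.
move=> K1; have K0 : 0 < K by rewrite (lt_le_trans ltr01).
have pos (s x y : R) : 0 <= s -> 0 < x -> x <= y -> y <= K * x ->
    x `^ s <= y `^ s /\ y `^ s <= K `^ s * x `^ s.
  move=> s0 x0 xy yK; have y0 : 0 < y by rewrite (lt_le_trans x0).
  split; first by rewrite ge0_ler_powR// nnegrE ltW.
  by rewrite -powRM ?(ltW K0) ?(ltW x0)// ge0_ler_powR// nnegrE ltW// mulr_gt0.
have Kge (s : R) : 0 <= s -> 1 <= K `^ s by move=> s0; rewrite -(powRr0 K) ler_powR.
have [r0|r0] := leP 0 r.
  exists (K `^ r); first exact: powR_gt0.
  move=> x y x0 xy yK; have [h1 h2] := pos r x y r0 x0 xy yK; split => //.
  by rewrite (le_trans h1)// ler_peMl ?powR_ge0// Kge.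
have nr0 : 0 <= - r by rewrite oppr_ge0 ltW.
exists (K `^ (- r)); first exact: powR_gt0.
move=> x y x0 xy yK; have [] := pos (- r) x y nr0 x0 xy yK.
have y0 : 0 < y by rewrite (lt_le_trans x0).
have e (z : R) : z `^ r = (z `^ (- r))^-1 by rewrite powRN invrK.
rewrite (e x) (e y).
have [X Y] : 0 < x `^ (- r) /\ 0 < y `^ (- r) by rewrite !powR_gt0.
move: (x `^ (- r)) (y `^ (- r)) (K `^ (- r)) X Y (Kge _ nr0) => u v k u0 v0 k1 h1 h2.
have iv : v^-1 <= u^-1 by rewrite lef_pV2.
split.
  by rewrite ler_pdivlMr// mulrC ler_pdivrMr.
by rewrite (le_trans iv)// ler_peMl// invr_ge0 ltW.
Qed.

End baseline.

(** * Symbols as classes in logarithmic coordinates *)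

Section symbols_as_classes.
Context (R : realType).
Implicit Types (l : R * R) (p q : R * R -> R[i]).

Lemma Re_partial j k p : @Re R \o partial j k p = rpartial R j k (@Re R \o p).
Proof.
elim: j => [|j IH]; last by rewrite /rpartial iterS -/(rpartial R j k _) -IH.
by elim: k => [//|k IH]; rewrite /rpartial /= -[iter k _ (@Re R \o p)]/(rpartial R 0 k _) -IH.
Qed.

Lemma Im_partial j k p : @Im R \o partial j k p = rpartial R j k (@Im R \o p).
Proof.
elim: j => [|j IH]; last by rewrite /rpartial iterS -/(rpartial R j k _) -IH.
by elim: k => [//|k IH]; rewrite /rpartial /= -[iter k _ (@Im R \o p)]/(rpartial R 0 k _) -IH.
Qed.

Variables (d : R) (m : int).
Let r := m%:~R / (d + 1).
Definition sweight l : R := (1 + norm2 l) `^ r.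

Lemma norm2_ge0 l : 0 <= norm2 l.
Proof. exact: sqrtr_ge0. Qed.

Lemma sweight_ge0 l : 0 <= sweight l.
Proof. exact: powR_ge0. Qed.

Lemma symbol_class p N : symbol d m p ->
  Cl R setT N (sweight \o Exp R) (@Re R \o p \o Exp R) /\
  Cl R setT N (sweight \o Exp R) (@Im R \o p \o Exp R).
Proof.
move=> [sm bd].
have w0 : weight R sweight 0 0 = sweight \o Exp R.
  by apply/funext => l; rewrite /weight !mul0r oppr0 expR0 !mulr1.
have bnd (part : R[i] -> R) (hp : forall z, `|part z| <= cabs z) j k :
    exists C, forall l, quadrant l ->
      l.1 ^+ j * l.2 ^+ k * `|part (partial j k p l)| <= C * sweight l.
  have [C C0 hC] := bd j k; exists C => l ql; apply: le_trans (hC l ql).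
  by apply: ler_wpM2l (hp _); case: ql => l1 l2; rewrite mulr_ge0// exprn_ge0// ltW.
rewrite -w0; split; apply: (rpartial_class R _ sweight) => //.
- move=> j k l b ql; rewrite -Re_partial.
  by have [[h1 _] [h2 _] _ _] := sm j k l ql; case: b; [exact: h1|exact: h2].
- by move=> j k l ql; rewrite -Re_partial; have [_ _ h _] := sm j k l ql.
- by move=> j k; rewrite -Re_partial; exact: (bnd (@Re R) (cabs_Re R)).
- exact: sweight_ge0.
- move=> j k l b ql; rewrite -Im_partial.
  by have [[_ h1] [_ h2] _ _] := sm j k l ql; case: b; [exact: h1|exact: h2].
- by move=> j k l ql; rewrite -Im_partial; have [_ _ _ h] := sm j k l ql.
- by move=> j k; rewrite -Im_partial; exact: (bnd (@Im R) (cabs_Im R)).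
- exact: sweight_ge0.
Qed.

Lemma class_symbol (Q : R * R -> R[i]) :
  (forall N, Cl R setT N (sweight \o Exp R) (@Re R \o Q) /\
             Cl R setT N (sweight \o Exp R) (@Im R \o Q)) ->
  symbol d m (Q \o Ln R).
Proof.
move=> cQ.
have cR N : Cl R setT N (sweight \o Exp R) (@Re R \o Q) by have [] := cQ N.
have cI N : Cl R setT N (sweight \o Exp R) (@Im R \o Q) by have [] := cQ N.
split=> [j k l ql|j k].
  have [dR kR] := rpartial_log R _ sweight sweight_ge0 cR j k l ql.
  have [dI kI] := rpartial_log R _ sweight sweight_ge0 cI j k l ql.
  have eR := Re_partial j k (Q \o Ln R); have eI := Im_partial j k (Q \o Ln R).
  split; rewrite /cderivable ?eR ?eI //.
    by split; [exact: (dR true)|exact: (dI true)].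
  by split; [exact: (dR false)|exact: (dI false)].
have [C1 h1] := rpartial_log_bound R _ sweight sweight_ge0 cR j k.
have [C2 h2] := rpartial_log_bound R _ sweight sweight_ge0 cI j k.
have m0 : 0 <= Num.max 0 (C1 + C2) by rewrite le_max lexx.
exists (Num.max 0 (C1 + C2) + 1); first by rewrite ltr_wpDl.
move=> l ql; have [l1 l2] := ql.
have := h1 l ql; have := h2 l ql.
have -> : rpartial R j k (@Re R \o Q \o Ln R) l = Re (partial j k (Q \o Ln R) l).
  by rewrite -[RHS]/((@Re R \o partial j k (Q \o Ln R)) l) Re_partial.
have -> : rpartial R j k (@Im R \o Q \o Ln R) l = Im (partial j k (Q \o Ln R) l).
  by rewrite -[RHS]/((@Im R \o partial j k (Q \o Ln R)) l) Im_partial.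
move=> k2 k1; have w0 := sweight_ge0 l.
have P0 : 0 <= l.1 ^+ j * l.2 ^+ k by rewrite mulr_ge0// exprn_ge0// ltW.
apply: (@le_trans _ _ ((C1 + C2) * sweight l)).
  apply: le_trans (ler_wpM2l P0 (cabs_le _ _)) _.
  by rewrite mulrDr mulrDl lerD.
by apply: ler_wpM2r => //; rewrite ler_wpDr// le_max lexx orbT.
Qed.

End symbols_as_classes.

(** * Construction of the elliptic symbol *)

Section elliptic_symbol.
Context (R : realType).
Implicit Types (l : R * R) (p q : R * R -> R[i]).

Lemma norm2_le l : 0 <= l.1 -> 0 <= l.2 -> norm2 l <= l.1 + l.2.
Proof.
move=> l1 l2; rewrite /norm2 -[leRHS]ger0_norm ?addr_ge0// -sqrtr_sqr ler_wsqrtr//.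
by rewrite sqrrD lerD2r lerDl mulrn_wge0// mulr_ge0.
Qed.

Lemma norm2_ge1 l : `|l.1| <= norm2 l.
Proof. by rewrite /norm2 -sqrtr_sqr ler_wsqrtr// lerDl sqr_ge0. Qed.

Lemma norm2_ge2 l : `|l.2| <= norm2 l.
Proof. by rewrite /norm2 -sqrtr_sqr ler_wsqrtr// lerDr sqr_ge0. Qed.

Lemma jap_Ln l : quadrant l -> jap R (Ln R l) = 1 + l.1 + l.2.
Proof. by move=> [l1 l2]; rewrite /jap /Ln /sepmap/= !lnK. Qed.

Lemma max_Ln (M : R) l : quadrant l -> (M <= Num.max (Ln R l).1 (Ln R l).2) =
  (expR M <= Num.max l.1 l.2).
Proof.
move=> [l1 l2]; rewrite !le_max /= -[M <= ln l.1]ler_expR -[M <= ln l.2]ler_expR.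
by rewrite !lnK ?posrE.
Qed.

Lemma elliptic_off_empty_cones (ev : R -> Prop) (alpha beta d : R) (m : int) p :
  alpha < beta ->
  (forall l l' : R, 0 < l -> 0 < l' -> ev l -> ev l' -> l <> l' -> ~ (alpha < l / l' < beta)) ->
  quasielliptic ev alpha beta d m p ->
  exists (q : R * R -> R[i]) (del : R), [/\ elliptic d m q, 0 < del &
    forall l, quadrant l -> thick R (log_ev R ev) del (ln l.1) ->
      thick R (log_ev R ev) del (ln l.2) -> q l = p l].
Proof.
move=> ab gap [sp [c c0 cone_ge]].
set r : R := m%:~R / (d + 1).
pose U := empty_slopes R ev alpha beta.
have UE (a e : R) l : quadrant l -> Gamma a e l <-> `|expR (ln l.1 - ln l.2) - a| < e.
  case: l => x y [/= x0 y0]; rewrite expRB !lnK ?posrE//; exact: GammaE.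
(* The part of the quadrant outside all empty cones is a cone that meets none of them;
   quasiellipticity on it gives one threshold. *)
have [A A0 hA] : exists2 A : R, 0 < A & forall l, quadrant l ->
    ~ U (ln l.1 - ln l.2) -> A <= norm2 l -> c * norm2 l `^ r <= cabs (p l).
  have [|A A0 hA] := cone_ge [set l | quadrant l /\ ~ U (ln l.1 - ln l.2)].
    split.
      split=> [l []//|s [x y] s0 [[/= x0 y0] nU]].
      split; first by rewrite /quadrant/= !mulr_gt0.
      by rewrite /= !lnM ?posrE// opprD addrACA subrr add0r.
    move=> G' [a [e [ae e0 -> noev]]]; apply/seteqP; split => // l [[ql nU] Gl].
    by apply: nU; exists a, e; split => //; apply/UE.
  by exists A => // l ql nU; apply: hA.
(* Without empty slopes that cone is the whole quadrant and p is already elliptic. *)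
have [/clusters|noU] := pselect (exists s, U s); last first.
  exists p, 1; split => //; split => //; exists c, A; split => // l ql.
  by apply: hA => // Ul; apply: noU; exists (ln l.1 - ln l.2).
move=> /(_ ab gap)[g [D [g0 D0 ld lb]]].
(* The factor 2 compares [jap] with 1 + |l| everywhere, the factor 3 compares it with |l| where |l|
   >= 1. *)
have [k1 k10 hk1] := powR_comparable R r 2%R ltac:(by rewrite ler1n).
have [k2 k20 hk2] := powR_comparable R r 3 ltac:(by rewrite ler1n).
(* p reduced to order 0, as patching requires. *)
pose F l := Complex (Re (p (Exp R l)) * japow R (- r) l) (Im (p (Exp R l)) * japow R (- r) l).
have japE l : jap R l = 1 + (Exp R l).1 + (Exp R l).2 by [].
have sw l : sweight R d m (Exp R l) <= k1 * japow R r l.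
  have [e1 e2] := quadrant_Exp R l.
  have n2 := norm2_le (Exp R l) (ltW e1) (ltW e2).
  have := norm2_ge1 (Exp R l); have := norm2_ge2 (Exp R l).
  rewrite !gtr0_norm// => n3 n4.
  have n5 := norm2_ge0 R (Exp R l).
  apply: (proj1 (hk1 _ _ _ _ _)); rewrite ?japE; lra.
have ws l : japow R r l <= k1 * sweight R d m (Exp R l).
  have [e1 e2] := quadrant_Exp R l.
  have n2 := norm2_le (Exp R l) (ltW e1) (ltW e2).
  have := norm2_ge1 (Exp R l); have := norm2_ge2 (Exp R l).
  rewrite !gtr0_norm// => n3 n4.
  have n5 := norm2_ge0 R (Exp R l).
  apply: (proj2 (hk1 _ _ _ _ _)); rewrite ?japE; lra.
have jj l : japow R r l * japow R (- r) l = 1.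
  by rewrite /japow powRN mulfV// lt0r_neq0// powR_gt0// jap_gt0.
have Fcl N : Cl R setT N (fun=> 1) (@Re R \o F) /\ Cl R setT N (fun=> 1) (@Im R \o F).
  have [cR cI] := symbol_class R d m p N sp.
  have ww l : setT l -> (sweight R d m \o Exp R) l * japow R (- r) l <= k1 * 1.
    by move=> _ /=; rewrite -(jj l) mulrA ler_wpM2r ?(ltW (japow_gt0 R _ _))// sw.
  have w0 l : setT l -> 0 <= (sweight R d m \o Exp R) l * japow R (- r) l.
    by move=> _ /=; rewrite mulr_ge0 ?sweight_ge0// ltW ?japow_gt0.
  have s0 l : setT l -> 0 <= (sweight R d m \o Exp R) l by move=> _; exact: sweight_ge0.
  have j0 l : setT l -> 0 <= japow R (- r) l by move=> _; rewrite ltW ?japow_gt0.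
  by split; apply: (Cl_weight _ _ _ _ _ _ _ (ltW k10) w0 ww);
    apply: (Cl_mul _ _ _ _ _ _ _ openT s0 j0) => //; exact: japow_class.
have cabsZ (x y t : R) : 0 <= t -> cabs (Complex (x * t) (y * t)) = cabs (Complex x y) * t.
  move=> t0; rewrite !cabsE/= !exprMn -mulrDl sqrtrM ?addr_ge0 ?sqr_ge0//.
  by rewrite sqrtr_sqr ger0_norm.
have cabsC (z : R[i]) : cabs (Complex (Re z) (Im z)) = cabs z by case: z.
have cF l : cabs (F l) = cabs (p (Exp R l)) * japow R (- r) l.
  have := cabsZ (Re (p (Exp R l))) (Im (p (Exp R l))) _ (ltW (japow_gt0 R (- r) l)).
  by rewrite cabsC.
(* The cap 1 is there because the last frames of the patching have modulus 1; M >= 0 ensures |l| >=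
   1, where the comparison with factor 3 holds. *)
pose c' := Num.min 1 (c / k2); pose M := Num.max 0 (ln A).
have c'0 : 0 < c' by rewrite /c' lt_min ltr01 divr_gt0.
have c'1 : c' <= 1 by rewrite /c' ge_min lexx.
have Fge x y : ~ U (x - y) -> M <= Num.max x y -> c' <= cabs (F (x, y)).
  move=> nU hM; have ql := quadrant_Exp R (x, y); have [e1 e2] := ql.
  have big : Num.max 1 A <= norm2 (Exp R (x, y)).
    have eM : Num.max 1 A <= expR M.
      rewrite ge_max; apply/andP; split.
        by rewrite -[leLHS]expR0 ler_expR /M le_max lexx.
      by rewrite -[leLHS]lnK ?posrE// ler_expR /M le_max lexx orbT.
    apply: (le_trans eM); move: hM; rewrite le_max => /orP[h|h].
      apply: le_trans (norm2_ge1 _); rewrite gtr0_norm//.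
      by rewrite ler_expR.
    apply: le_trans (norm2_ge2 _); rewrite gtr0_norm//.
    by rewrite ler_expR.
  rewrite ge_max in big; case/andP: big => n1 nA.
  have n2 := norm2_le (Exp R (x, y)) (ltW e1) (ltW e2).
  have := norm2_ge1 (Exp R (x, y)); have := norm2_ge2 (Exp R (x, y)).
  rewrite !gtr0_norm// => n3 n4.
  have [_ hj] : norm2 (Exp R (x, y)) `^ r <= k2 * jap R (x, y) `^ r /\
      jap R (x, y) `^ r <= k2 * norm2 (Exp R (x, y)) `^ r.
    by apply: hk2; rewrite ?japE; lra.
  have hp := hA (Exp R (x, y)) ql; rewrite /= !expRK in hp; have {}hp := hp nU nA.
  rewrite cF -(ler_pM2r (japow_gt0 R r (x, y))) -mulrA.
  rewrite [japow R (- r) _ * _]mulrC jj mulr1; apply: le_trans hp.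
  have h0 : 0 <= norm2 (Exp R (x, y)) `^ r by exact: powR_ge0.
  apply: (@le_trans _ _ (c / k2 * japow R r (x, y))).
    by rewrite ler_wpM2r ?(ltW (japow_gt0 R _ _))// /c' ge_min lexx orbT.
  rewrite -mulrA ler_pM2l// ler_pdivrMl//.
have [H [del [c2 [M' [del0 c20 Hcl Heq Hge]]]]] :=
  patching R (log_ev R ev) g D U g0 ld lb F c' M Fcl c'0 c'1 Fge.
pose Q l := Complex (Re (H l) * japow R r l) (Im (H l) * japow R r l).
have cQ l : cabs (Q l) = cabs (H l) * japow R r l.
  have := cabsZ (Re (H l)) (Im (H l)) _ (ltW (japow_gt0 R r l)).
  by rewrite cabsC.
have Qcl N : Cl R setT N (sweight R d m \o Exp R) (@Re R \o Q) /\
    Cl R setT N (sweight R d m \o Exp R) (@Im R \o Q).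
  have [cR cI] := Hcl N.
  have j0 l : setT l -> 0 <= japow R r l by move=> _; rewrite ltW ?japow_gt0.
  by split; apply: (Cl_weight _ _ _ _ _ _ _ (ltW k10) j0 (fun l _ => ws l));
    apply: (Cl_mul1 _ _ _ _ _ _ openT j0) => //; exact: japow_class.
exists (Q \o Ln R), del; split => //.
  split; first exact: class_symbol.
  (* As |l| <= l1 + l2, beyond 2 exp M' one coordinate is at least exp M'; the summand 1 gives |l|
     >= 1. *)
  exists (c2 / k2), (2 * expR M' + 1); split.
  - by rewrite divr_gt0.
  - by rewrite addr_gt0// mulr_gt0// expR_gt0.
  move=> l ql hl; have [l1 l2] := ql.
  have n2 := norm2_le l (ltW l1) (ltW l2).
  have := norm2_ge1 l; have := norm2_ge2 l.
  rewrite !gtr0_norm// => n3 n4.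
  have eM := expR_gt0 M'.
  have : expR M' <= Num.max l.1 l.2.
    rewrite le_max; have [//|h1] := leP (expR M') l.1.
    by have [//|h2] := leP (expR M') l.2; lra.
  rewrite -max_Ln// => /Hge hH.
  have n5 : 1 <= norm2 l by lra.
  rewrite -[(Q \o Ln R) l]/(Q (Ln R l)) cQ.
  apply: le_trans (ler_wpM2r (ltW (japow_gt0 R r _)) hH).
  rewrite -mulrA ler_pM2l// ler_pdivrMl//.
  by apply: (proj1 (hk2 _ _ _ _ _)); rewrite ?jap_Ln//; lra.
move=> l ql h1 h2; rewrite /= /Q Heq// /F ExpK//=.
have e (x : R) : x * japow R (- r) (Ln R l) * japow R r (Ln R l) = x.
  by rewrite -mulrA [japow R (- r) _ * _]mulrC jj mulr1.
by rewrite !e; case: (p l).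
Qed.

End elliptic_symbol.

(** * Square-integrable functions *)

Lemma Re_addc (R : realType) (x y : R[i]) : Re (x + y) = Re x + Re y.
Proof. by case: x y => ? ? []. Qed.
Lemma Im_addc (R : realType) (x y : R[i]) : Im (x + y) = Im x + Im y.
Proof. by case: x y => ? ? []. Qed.
Lemma Re_mulc (R : realType) (x y : R[i]) : Re (x * y) = Re x * Re y - Im x * Im y.
Proof. by case: x y => ? ? []. Qed.
Lemma Im_mulc (R : realType) (x y : R[i]) : Im (x * y) = Re x * Im y + Im x * Re y.
Proof. by case: x y => ? ? []. Qed.
Lemma Re_conjc (R : realType) (x : R[i]) : Re (x^*%C) = Re x.
Proof. by case: x. Qed.
Lemma Im_conjc (R : realType) (x : R[i]) : Im (x^*%C) = - Im x.
Proof. by case: x. Qed.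
Lemma complex_ext (R : realType) (x y : R[i]) : Re x = Re y -> Im x = Im y -> x = y.
Proof. by case: x y => ? ? [? ?] /= -> ->. Qed.

Lemma cabs_eq0 (R : realType) (z : R[i]) : cabs z ^+ 2 = 0 -> z = 0.
Proof.
by move=> /eqP; rewrite expf_eq0/= => /eqP; exact: ComplexField.Normc.eq0_normc.
Qed.

Section L2_space.
Context (d : measure_display) (T : measurableType d) (R : realType).
Variable mu : {measure set T -> \bar R}.
Implicit Types (f g : T -> R) (u v w : T -> R[i]).

Lemma realL2_lin (a : R) f g : realL2 mu f -> realL2 mu g ->
  realL2 mu (fun x => a * f x + g x).
Proof.
have p1 : (1 <= 2%:E :> \bar R)%E by rewrite lee_fin ler1n.
move=> hf hg; have [_ h] := Lfun_submod_closed mu p1.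
exact: (h a f g hf hg).
Qed.

Lemma realL2_0 : realL2 mu (fun=> 0).
Proof.
have p1 : (1 <= 2%:E :> \bar R)%E by rewrite lee_fin ler1n.
by have [h _] := Lfun_submod_closed mu p1.
Qed.

Lemma realL2_measurable f : realL2 mu f -> measurable_fun setT f.
Proof. by rewrite /realL2 inE => /andP[/[!inE]]. Qed.

Lemma realL2_mul f g : realL2 mu f -> realL2 mu g ->
  mu.-integrable setT (EFin \o (fun x => f x * g x)).
Proof. by move=> hf hg; apply/Lfun1_integrable; exact: Lfun2_mul_Lfun1. Qed.

Lemma L2_lin (a : R[i]) u v : L2 mu u -> L2 mu v -> L2 mu (fun x => a * u x + v x).
Proof.
move=> [ru iu] [rv iv]; split.
  rewrite (_ : _ \o _ = (fun x => Re a * Re (u x) + (- Im a * Im (u x) + Re (v x)))).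
    exact: (realL2_lin _ _ _ ru (realL2_lin _ _ _ iu rv)).
  by apply/funext => x /=; rewrite Re_addc Re_mulc mulNr addrA.
rewrite (_ : _ \o _ = (fun x => Re a * Im (u x) + (Im a * Re (u x) + Im (v x)))).
  exact: (realL2_lin _ _ _ iu (realL2_lin _ _ _ ru iv)).
by apply/funext => x /=; rewrite Im_addc Im_mulc addrA.
Qed.

Lemma L2_0 : L2 mu (fun=> 0).
Proof. by split; exact: realL2_0. Qed.

Lemma L2_scale (a : R[i]) u : L2 mu u -> L2 mu (fun x => a * u x).
Proof.
move=> hu; have := L2_lin a _ _ hu L2_0.
by under eq_fun do rewrite addr0.
Qed.

Lemma L2_add u v : L2 mu u -> L2 mu v -> L2 mu (fun x => u x + v x).
Proof.
move=> hu hv; have := L2_lin 1 _ _ hu hv.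
by under eq_fun do rewrite mul1r.
Qed.

Lemma L2_sub u v : L2 mu u -> L2 mu v -> L2 mu (fun x => u x - v x).
Proof.
move=> hu hv; have := L2_add _ _ hu (L2_scale (-1) _ hv).
by under eq_fun do rewrite mulN1r.
Qed.

Lemma L2_sum k (u : 'I_k -> T -> R[i]) : (forall i, L2 mu (u i)) ->
  L2 mu (fun x => \sum_(i < k) u i x).
Proof.
elim: k u => [|k IH] u hu.
  by under eq_fun do rewrite big_ord0; exact: L2_0.
under eq_fun do rewrite big_ord_recr/=.
by apply: L2_add => //; exact: IH.
Qed.

Definition cintegrable u := mu.-integrable setT (EFin \o (@Re R \o u)) /\
  mu.-integrable setT (EFin \o (@Im R \o u)).

Lemma integrable_lin (a b : R) f g : mu.-integrable setT (EFin \o f) ->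
  mu.-integrable setT (EFin \o g) -> mu.-integrable setT (EFin \o (fun x => a * f x + b * g x)).
Proof.
move=> hf hg.
have h1 := integrableZl measurableT a hf; have h2 := integrableZl measurableT b hg.
by have := integrableD measurableT h1 h2.
Qed.

Lemma Rintegral_lin (a b : R) f g : mu.-integrable setT (EFin \o f) ->
  mu.-integrable setT (EFin \o g) ->
  \int[mu]_x (a * f x + b * g x) = a * \int[mu]_x f x + b * \int[mu]_x g x.
Proof.
move=> hf hg.
have h1 : mu.-integrable setT (EFin \o (fun x => a * f x)) := integrableZl measurableT a hf.
have h2 : mu.-integrable setT (EFin \o (fun x => b * g x)) := integrableZl measurableT b hg.
by rewrite RintegralD// !RintegralZl.
Qed.

Lemma cintegrable_mul u v : L2 mu u -> L2 mu v -> cintegrable (fun x => u x * (v x)^*%C).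
Proof.
move=> [ru iu] [rv iv]; split.
  have := integrable_lin 1 1 _ _ (realL2_mul _ _ ru rv) (realL2_mul _ _ iu iv).
  apply: eq_integrable => // x _ /=.
  by rewrite Re_mulc Re_conjc Im_conjc !mul1r mulrN opprK.
have := integrable_lin (-1) 1 _ _ (realL2_mul _ _ ru iv) (realL2_mul _ _ iu rv).
apply: eq_integrable => // x _ /=.
by rewrite Im_mulc Re_conjc Im_conjc mul1r mulN1r mulrN.
Qed.

Lemma cintegral_lin (a : R[i]) u v : cintegrable u -> cintegrable v ->
  cintegral mu (fun x => a * u x + v x) = a * cintegral mu u + cintegral mu v.
Proof.
move=> [ru iu] [rv iv]; apply: complex_ext; rewrite ?Re_addc ?Im_addc ?Re_mulc ?Im_mulc /=.
  transitivity (\int[mu]_x (1 * (Re a * Re (u x) + (- Im a) * Im (u x)) + 1 * Re (v x))).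
    by apply: eq_Rintegral => x _; rewrite Re_addc Re_mulc !mul1r mulNr.
  by rewrite Rintegral_lin ?Rintegral_lin ?mul1r ?mulNr//; exact: integrable_lin.
transitivity (\int[mu]_x (1 * (Re a * Im (u x) + (Im a) * Re (u x)) + 1 * Im (v x))).
  by apply: eq_Rintegral => x _; rewrite Im_addc Im_mulc !mul1r.
by rewrite Rintegral_lin ?Rintegral_lin ?mul1r//; exact: integrable_lin.
Qed.

Lemma inner_lin (a : R[i]) u v w : L2 mu u -> L2 mu v -> L2 mu w ->
  inner mu (fun x => a * u x + v x) w = a * inner mu u w + inner mu v w.
Proof.
move=> hu hv hw; rewrite /inner -cintegral_lin; [|exact: cintegrable_mul..].
by congr cintegral; apply/funext => x; rewrite mulrDl mulrA.
Qed.

Lemma inner_conj u v : L2 mu u -> L2 mu v -> inner mu v u = (inner mu u v)^*%C.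
Proof.
move=> hu hv; have [r i] := cintegrable_mul _ _ hu hv.
apply: complex_ext; rewrite /= ?Re_conjc ?Im_conjc.
  by apply: eq_Rintegral => x _; rewrite !Re_mulc !Re_conjc !Im_conjc; ring.
transitivity (\int[mu]_x (-1 * Im (u x * (v x)^*%C) + 0 * Re (u x * (v x)^*%C))).
  by apply: eq_Rintegral => x _; rewrite !Im_mulc !Re_mulc !Re_conjc !Im_conjc; ring.
by rewrite Rintegral_lin// mul0r addr0 mulN1r.
Qed.

Lemma normsq_integrable u : L2 mu u ->
  mu.-integrable setT (EFin \o (fun x => cabs (u x) ^+ 2)).
Proof.
move=> [ru iu].
have := integrable_lin 1 1 _ _ (realL2_mul _ _ ru ru) (realL2_mul _ _ iu iu).
apply: eq_integrable => // x _ /=.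
by rewrite cabs_sqr !mul1r !expr2.
Qed.

Lemma normsq_inner u : L2 mu u -> inner mu u u = Complex (normsq mu u) 0.
Proof.
move=> hu; apply: complex_ext => /=.
  by apply: eq_Rintegral => x _; rewrite cabs_sqr Re_mulc Re_conjc Im_conjc; ring.
rewrite -[RHS](mulr0 (fine (mu setT))) -[RHS]mulrC -Rintegral_cst//.
by apply: eq_Rintegral => x _; rewrite Im_mulc Re_conjc Im_conjc; ring.
Qed.

Lemma normsq_ge0 u : 0 <= normsq mu u.
Proof. by apply: Rintegral_ge0 => x _; exact: sqr_ge0. Qed.

Lemma normsq_le2 u v : L2 mu u -> L2 mu v ->
  normsq mu (fun x => u x + v x) <= 2 * normsq mu u + 2 * normsq mu v.
Proof.
move=> hu hv; have nu := normsq_integrable _ hu; have nv := normsq_integrable _ hv.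
rewrite /normsq -Rintegral_lin//; apply: le_Rintegral => //.
- exact: normsq_integrable (L2_add _ _ hu hv).
- exact: integrable_lin.
move=> x _; rewrite !cabs_sqr Re_addc Im_addc.
move: (Re _) (Re _) (Im _) (Im _) => a b c e.
by rewrite -subr_ge0 (_ : _ - _ = (a - b) ^+ 2 + (c - e) ^+ 2) ?addr_ge0 ?sqr_ge0//; ring.
Qed.

Lemma normsq_scale (a : R[i]) u : L2 mu u ->
  normsq mu (fun x => a * u x) = cabs a ^+ 2 * normsq mu u.
Proof.
move=> hu; rewrite /normsq -RintegralZl//; last exact: normsq_integrable.
by apply: eq_Rintegral => x _; rewrite ComplexField.Normc.normcM exprMn.
Qed.

Lemma measurable_Re u : L2 mu u -> measurable_fun setT (@Re R \o u).
Proof. by move=> [/realL2_measurable]. Qed.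

Lemma measurable_Im u : L2 mu u -> measurable_fun setT (@Im R \o u).
Proof. by move=> [_ /realL2_measurable]. Qed.

Lemma ae_Rintegral f g : measurable_fun setT f -> measurable_fun setT g ->
  f = g %[ae mu] -> \int[mu]_x f x = \int[mu]_x g x.
Proof.
move=> /measurable_EFinP mf /measurable_EFinP mg fg; congr fine.
apply: (@ae_eq_integral _ _ _ mu setT (EFin \o g) (EFin \o f) measurableT mf mg).
by apply: filterS fg => x h _ /=; rewrite h.
Qed.

Lemma normsq_ae u v : L2 mu u -> L2 mu v -> u = v %[ae mu] -> normsq mu u = normsq mu v.
Proof.
move=> hu hv uv; apply: ae_Rintegral.
- exact/measurable_EFinP/measurable_int/normsq_integrable.
- exact/measurable_EFinP/measurable_int/normsq_integrable.
- by apply: filterS uv => x h _; rewrite h.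
Qed.

Lemma inner_ael u u' v : L2 mu u -> L2 mu u' -> L2 mu v -> u = u' %[ae mu] ->
  inner mu u v = inner mu u' v.
Proof.
move=> hu hu' hv uu'.
have [r i] := cintegrable_mul _ _ hu hv; have [r' i'] := cintegrable_mul _ _ hu' hv.
apply: complex_ext => /=; apply: ae_Rintegral.
- exact/measurable_EFinP/measurable_int/r.
- exact/measurable_EFinP/measurable_int/r'.
- by apply: filterS uu' => x h _; rewrite h.
- exact/measurable_EFinP/measurable_int/i.
- exact/measurable_EFinP/measurable_int/i'.
- by apply: filterS uu' => x h _; rewrite h.
Qed.

Lemma inner_aer u v v' : L2 mu u -> L2 mu v -> L2 mu v' -> v = v' %[ae mu] ->
  inner mu u v = inner mu u v'.
Proof.
by move=> hu hv hv' vv'; rewrite inner_conj// (inner_conj v')// (inner_ael v v').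
Qed.

Lemma normsq_eq0 u : L2 mu u -> normsq mu u = 0 -> u = (fun=> 0) %[ae mu].
Proof.
move=> hu n0; have iu := normsq_integrable _ hu.
have h : (\int[mu]_x `|(cabs (u x) ^+ 2)%:E| = 0)%E.
  rewrite (eq_integral (EFin \o (fun x => cabs (u x) ^+ 2))); last first.
    by move=> x _ /=; rewrite ger0_norm// sqr_ge0.
  have fin := integrable_fin_num measurableT iu.
  by rewrite -(fineK fin) /= -[fine _]/(normsq mu u) n0.
have mf := measurable_int mu iu.
have /(ae_eq_integral_abs mu measurableT mf) := h.
by apply: filterS => x hx _; have [/cabs_eq0] := hx I.
Qed.

Lemma normsq0 : normsq mu (fun=> 0) = 0.
Proof.
rewrite /normsq -[RHS](mulr0 (fine (mu setT))) -[RHS]mulrC -Rintegral_cst//.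
by apply: eq_Rintegral => x _; rewrite ComplexField.Normc.normc0 expr0n.
Qed.

Lemma normsq_ae0 u : L2 mu u -> u = (fun=> 0) %[ae mu] -> normsq mu u = 0.
Proof. by move=> hu /(normsq_ae _ _ hu L2_0); rewrite normsq0. Qed.

Lemma inner0l v : L2 mu v -> inner mu (fun=> 0) v = 0.
Proof.
move=> hv; have := inner_lin 0 (fun=> 0) (fun=> 0) v L2_0 L2_0 hv.
rewrite mul0r add0r.
have := inner_lin 1 (fun=> 0) (fun=> 0) v L2_0 L2_0 hv.
under eq_fun do rewrite mulr0 addr0.
by move=> /eqP; rewrite mul1r -subr_eq0 opprD addNKr oppr_eq0 => /eqP.
Qed.

Lemma inner_suml k (c : 'I_k -> R[i]) (u : 'I_k -> T -> R[i]) w :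
  (forall i, L2 mu (u i)) -> L2 mu w ->
  inner mu (fun x => \sum_(i < k) c i * u i x) w = \sum_(i < k) c i * inner mu (u i) w.
Proof.
elim: k c u => [|k IH] c u hu hw.
  by rewrite big_ord0; under eq_fun do rewrite big_ord0; exact: inner0l.
rewrite big_ord_recr/= -IH//.
have -> : (fun x => \sum_(i < k.+1) c i * u i x) = (fun x => c ord_max * u ord_max x +
    \sum_(i < k) c (widen_ord (leqnSn k) i) * u (widen_ord (leqnSn k) i) x).
  by apply/funext => x; rewrite big_ord_recr/= addrC.
rewrite inner_lin//; last by apply: L2_sum => i; exact: L2_scale.
by rewrite addrC.
Qed.

Lemma inner_sumr k (c : 'I_k -> R[i]) (u : 'I_k -> T -> R[i]) w :
  (forall i, L2 mu (u i)) -> L2 mu w ->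
  inner mu w (fun x => \sum_(i < k) c i * u i x) =
  \sum_(i < k) (c i)^*%C * inner mu w (u i).
Proof.
move=> hu hw; have hs : L2 mu (fun x => \sum_(i < k) c i * u i x).
  by apply: L2_sum => i; exact: L2_scale.
rewrite inner_conj// inner_suml// rmorph_sum/=; apply: eq_bigr => i _.
by rewrite (inner_conj (u i) w)// -[LHS]/((c i * inner mu (u i) w)^*%C) rmorphM.
Qed.

End L2_space.

(** * Indicators as square-integrable functions *)

Lemma L2_indic_fin (d : measure_display) (S : measurableType d) (R : realType)
  (m : {measure set S -> \bar R})
  (A : set S) : measurable A -> (m A < +oo)%E -> L2 m (fun x => rtoc (\1_A x : R)).
Proof.
move=> mA fA; split; last exact: realL2_0.
rewrite /realL2 inE; apply/andP; split; rewrite inE//=; first exact: measurable_indic.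
rewrite /finite_norm unlock poweR_lty//.
rewrite (eq_integral (fun x => (\1_A x)%:E)) ?integral_indic ?setIT// => x _ /=.
by rewrite indicE; case: (_ \in _); rewrite ?normr1 ?normr0 ?powR1 ?powR0.
Qed.

Section simple_L2.
Context (d : measure_display) (S : measurableType d) (R : realType).
Variable m : {measure set S -> \bar R}.
Hypothesis mfin : (m setT < +oo)%E.

Lemma finite_measure_set (A : set S) : measurable A -> (m A < +oo)%E.
Proof. by move=> mA; apply: le_lt_trans mfin; apply: le_measure; rewrite ?inE. Qed.

Lemma realL2_measurable_bounded (f : S -> R) (c : R) : measurable_fun setT f ->
  (forall x, `|f x| <= c) -> realL2 m f.
Proof.
move=> mf fc; rewrite /realL2 inE; apply/andP; split; rewrite inE//=.
rewrite /finite_norm unlock poweR_lty//.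
apply: (@le_lt_trans _ _ (\int[m]_x (c `^ 2)%:E)%E).
  apply: ge0_le_integral => //.
  - by move=> x _; rewrite lee_fin powR_ge0.
  - apply/measurable_EFinP/(@measurableT_comp _ _ _ _ _ _ (@powR R ^~ 2)) => //.
    exact: measurableT_comp.
  - move=> x _; rewrite lee_fin ge0_ler_powR// nnegrE//.
    exact: le_trans (fc x).
by rewrite integral_cst// lte_mul_pinfty// lee_fin powR_ge0.
Qed.

Lemma L2_indic (A : set S) : measurable A -> L2 m (fun x => rtoc (\1_A x : R)).
Proof. by move=> mA; apply: L2_indic_fin => //; exact: finite_measure_set. Qed.

Lemma inner_indic (A B : set S) : measurable A -> measurable B ->
  inner m (fun x => rtoc (\1_A x : R)) (fun x => rtoc (\1_B x : R)) =
  Complex (fine (m (A `&` B))) 0.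
Proof.
move=> mA mB; apply: complex_ext => /=.
  transitivity (\int[m]_x (\1_(A `&` B) x : R)).
    by apply: eq_Rintegral => x _ /=; rewrite indicI /=; ring.
  by rewrite /Rintegral integral_indic ?setIT//; exact: measurableI.
rewrite -[RHS](mulr0 (fine (m setT))) -[RHS]mulrC -Rintegral_cst//.
by apply: eq_Rintegral => x _ /=; ring.
Qed.

End simple_L2.

(** * Spectral measures *)

Section spectral.
Context (d : measure_display) (T : measurableType d) (R : realType).
Variable mu : {measure set T -> \bar R}.
Context (d' : measure_display) (S : measurableType d').
Variable P : set S -> (T -> R[i]) -> (T -> R[i]).
Hypothesis HP : is_spectral_measure mu P.
Implicit Types (u v w : T -> R[i]) (A B : set S).

Lemma spm_inner A B u : measurable A -> measurable B -> L2 mu u ->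
  inner mu (P A u) (P B u) = Complex (normsq mu (P (A `&` B) u)) 0.
Proof.
move=> mA mB hu; have mAB : measurable (A `&` B) by exact: measurableI.
have hA := spm_L2 HP mA hu; have hB := spm_L2 HP mB hu; have hAB := spm_L2 HP mAB hu.
have hAPB := spm_L2 HP mA hB; have hABAB := spm_L2 HP mAB hAB.
rewrite (spm_sym HP mA hu hB) (inner_aer _ _ _ _ _ _ _ hu hAPB hAB (spm_setI HP mA mB hu)).
rewrite -normsq_inner// (spm_sym HP mAB hu hAB).
apply: inner_aer => //; apply: ae_eq_sym; have := spm_setI HP mAB mAB hu.
by rewrite setIid.
Qed.

Lemma spm_normsq_le A u : measurable A -> L2 mu u -> normsq mu (P A u) <= normsq mu u.
Proof.
move=> mA hu; have [m hm] := spm_sigma_additive HP hu.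
have <- : normsq mu (P setT u) = normsq mu u.
  by apply: normsq_ae => //; [exact: (spm_L2 HP)|exact: spm_setT].
rewrite -lee_fin -!hm//; apply: le_measure; rewrite ?inE//.
Qed.

Lemma spm_null A u v : measurable A -> L2 mu u -> L2 mu v -> u = v %[ae mu] ->
  P A v = (fun=> 0) %[ae mu] -> P A u = (fun=> 0) %[ae mu].
Proof.
by move=> mA hu hv uv; apply: ae_eq_trans; exact: spm_ae.
Qed.

Lemma spm_add A u v : measurable A -> L2 mu u -> L2 mu v ->
  P A (fun x => u x + v x) = (fun x => P A u x + P A v x) %[ae mu].
Proof.
move=> mA hu hv; have := spm_linear HP 1 mA hu hv.
have -> : (fun x => 1 * u x + v x) = (fun x => u x + v x).
  by apply/funext => x; rewrite mul1r.
by apply: filterS => x; rewrite mul1r.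
Qed.

Lemma spm0 A : measurable A -> P A (fun=> 0) = (fun=> 0) %[ae mu].
Proof.
move=> mA; apply: normsq_eq0; first exact: (spm_L2 HP mA (L2_0 _ _ _ mu)).
apply/eqP; rewrite eq_le normsq_ge0 andbT.
by rewrite (le_trans (spm_normsq_le _ _ mA (L2_0 _ _ _ mu)))// normsq0.
Qed.

Lemma spm_sum0 A k (f : 'I_k -> T -> R[i]) : measurable A -> (forall i, L2 mu (f i)) ->
  (forall i, P A (f i) = (fun=> 0) %[ae mu]) ->
  P A (fun x => \sum_(i < k) f i x) = (fun=> 0) %[ae mu].
Proof.
move=> mA; elim: k f => [|k IH] f hf h0.
  rewrite (_ : (fun x => \sum_(i < 0) f i x) = (fun=> 0)); first exact: spm0.
  by apply/funext => x; rewrite big_ord0.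
have hk : L2 mu (fun x => \sum_(i < k) f (widen_ord (leqnSn k) i) x) by exact: L2_sum.
rewrite (_ : (fun x => \sum_(i < k.+1) f i x) =
  (fun x => \sum_(i < k) f (widen_ord (leqnSn k) i) x + f ord_max x)); last first.
  by apply/funext => x; rewrite big_ord_recr.
apply: ae_eq_trans (spm_add _ _ _ mA hk (hf ord_max)) _.
have h1 := IH (fun i => f (widen_ord (leqnSn k) i)) (fun i => hf _) (fun i => h0 _).
by apply: filterS2 h1 (h0 ord_max) => x e1 e2 _; rewrite e1// e2// addr0.
Qed.

Lemma spm_setI0 A B u : measurable A -> measurable B -> A `&` B = set0 -> L2 mu u ->
  P A (P B u) = (fun=> 0) %[ae mu].
Proof.
move=> mA mB AB hu; apply: ae_eq_trans (spm_setI HP mA mB hu) _; rewrite AB.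
apply: normsq_eq0; first exact: (spm_L2 HP).
have [m hm] := spm_sigma_additive HP hu.
by have := hm set0 measurable0; rewrite measure0 => -[] ->.
Qed.

Section calculus.
Variables (u : T -> R[i]) (m : {measure set S -> \bar R}).
Hypothesis hu : L2 mu u.
Hypothesis hm : forall A, measurable A -> m A = (normsq mu (P A u))%:E.

Lemma spm_fin : (m setT < +oo)%E.
Proof. by rewrite hm// ltry. Qed.

(** The isometry between simple functions and vectors. The sets may overlap, so Gram matrices are
    compared; the entries of both are the measures of the pairwise intersections. *)
Lemma normsq_simple k (c : 'I_k -> R[i]) (A : 'I_k -> set S) : (forall i, measurable (A i)) ->
  normsq mu (fun x => \sum_(i < k) c i * P (A i) u x) =
  normsq m (fun s => \sum_(i < k) c i * rtoc (\1_(A i) s)).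
Proof.
move=> mA.
have hA i : L2 mu (P (A i) u) by exact: (spm_L2 HP).
have hS := L2_indic _ S R m spm_fin.
have hI i : L2 m (fun s => rtoc (\1_(A i) s : R)) by exact: hS.
have l1 : L2 mu (fun x => \sum_(i < k) c i * P (A i) u x) by apply: L2_sum => i; exact: L2_scale.
have l2 : L2 m (fun s => \sum_(i < k) c i * rtoc (\1_(A i) s)).
  by apply: L2_sum => i; exact: L2_scale (hI i).
have := normsq_inner _ _ _ _ _ l1; have := normsq_inner _ _ _ _ _ l2.
rewrite !inner_suml//.
have -> : \sum_(i < k) c i * inner m (fun s => rtoc (\1_(A i) s)) (fun s => \sum_(i < k) c i * rtoc (\1_(A i) s)) =
    \sum_(i < k) c i * inner mu (P (A i) u) (fun x => \sum_(i < k) c i * P (A i) u x).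
  apply: eq_bigr => i _; congr (_ * _).
  rewrite !inner_sumr//; apply: eq_bigr => j _; congr (_ * _).
  rewrite inner_indic// spm_inner// hm//; exact: measurableI.
by move=> -> [].
Qed.

(** The functional calculus would give equality with constant 1. The factor 4 comes from using (a +
    b)^2 <= 2 a^2 + 2 b^2 twice; it is harmless where the right side is 0 and where only a lower
    bound up to a constant is wanted. *)
Lemma spectral_bound (g : S -> R[i]) w (c : R[i]) :
  measurable_fun setT (@Re R \o g) -> measurable_fun setT (@Im R \o g) -> L2 mu w ->
  (forall e : R, 0 < e -> exists k (b : 'I_k -> R[i]) (A : 'I_k -> set S),
      [/\ forall i, measurable (A i),
          (\int[m]_s (cabs (g s - \sum_(i < k) b i * rtoc (\1_(A i) s)) ^+ 2)%:E < e%:E)%E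
        & normsq mu (fun x => w x - \sum_(i < k) b i * P (A i) u x) < e]) ->
  (\int[m]_s (cabs (g s - c) ^+ 2)%:E <= (4 * normsq mu (fun x => w x - c * u x))%:E)%E.
Proof.
move=> mgR mgI hw H.
set N := normsq mu (fun x => w x - c * u x).
have msq (f : S -> R[i]) : measurable_fun setT (@Re R \o f) -> measurable_fun setT (@Im R \o f) ->
    measurable_fun setT (fun s => (cabs (f s) ^+ 2)%:E).
  move=> mr mi; apply/measurable_EFinP.
  rewrite (_ : (fun s => _) = (fun s => Re (f s) ^+ 2 + Im (f s) ^+ 2)); last first.
    by apply/funext => s; rewrite cabs_sqr.
  by apply: measurable_funD; apply: measurable_funX.
(* 2 (e / 6) + 2 (2 (e / 6) + 2 N) = e + 4 N. *)
apply/lee_addgt0Pr => e e0; have e6 : 0 < e / 6 by rewrite divr_gt0.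
have [k [b [A [mA he hn]]]] := H _ e6.
pose s (x : S) := \sum_(i < k) b i * rtoc (\1_(A i) x : R).
pose ps (x : T) := \sum_(i < k) b i * P (A i) u x.
have hps : L2 mu ps by apply: L2_sum => i; apply: L2_scale; exact: (spm_L2 HP).
have hs : L2 m s.
  by apply: L2_sum => i; apply: L2_scale; apply: (L2_indic _ _ _ _ spm_fin).
have h1T : L2 m (fun=> 1).
  have := L2_indic _ S R m spm_fin _ (@measurableT _ S).
  by under eq_fun do rewrite indicT.
have hsc : L2 m (fun x => s x - c).
  have := L2_sub _ _ _ _ _ _ hs (L2_scale _ _ _ _ c _ h1T).
  by under [X in L2 _ X -> _]eq_fun do rewrite mulr1.
(* the constant c is the simple function c 1_S, and P S u = u *)
have simple_c : normsq m (fun x => s x - c) = normsq mu (fun x => ps x - c * u x).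
  pose b' (i : 'I_k.+1) : R[i] := if unlift ord_max i is Some j then b j else - c.
  pose A' (i : 'I_k.+1) : set S := if unlift ord_max i is Some j then A j else setT.
  have mA' i : measurable (A' i) by rewrite /A'; case: (unlift _ _).
  have wl (i : 'I_k) : widen_ord (leqnSn k) i = lift ord_max i.
    by apply: val_inj; rewrite /= /bump leqNgt ltn_ord.
  have := normsq_simple _ b' A' mA'.
  have -> : (fun x => \sum_(i < k.+1) b' i * rtoc (\1_(A' i) x : R)) = (fun x => s x - c).
    apply/funext => x; rewrite big_ord_recr/= /b' /A' unlift_none indicT mulr1.
    by congr (_ - _); apply: eq_bigr => i _; rewrite wl liftK.
  move=> <-; apply: normsq_ae.
  - by apply: L2_sum => i; apply: L2_scale; exact: (spm_L2 HP).
  - by apply: L2_sub => //; exact: L2_scale.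
  - apply: filterS (spm_setT HP hu) => x ux _.
    rewrite big_ord_recr/= /b' /A' unlift_none ux// mulNr; congr (_ - _).
    by apply: eq_bigr => i _; rewrite wl liftK.
have b1 : normsq m (fun x => s x - c) <= 2 * (e / 6) + 2 * N.
  rewrite simple_c.
  have -> : (fun x => ps x - c * u x) = (fun x => (-1) * (w x - ps x) + (w x - c * u x)).
    by apply/funext => x; ring.
  apply: le_trans (normsq_le2 _ _ _ _ _ _ _ _) _.
  - by apply: L2_scale; exact: L2_sub.
  - by apply: L2_sub => //; exact: L2_scale.
  rewrite normsq_scale; last exact: L2_sub.
  have -> : cabs (-1 : R[i]) ^+ 2 = 1.
    by rewrite cabs_sqr /= oppr0 expr0n addr0 sqrrN expr1n.
  by rewrite mul1r lerD2r ler_pM2l// ltW.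
have msc : measurable_fun setT (fun x => (cabs (s x - c) ^+ 2)%:E).
  by apply: msq; [exact: measurable_Re hsc|exact: measurable_Im hsc].
have mgs : measurable_fun setT (fun x => (cabs (g x - s x) ^+ 2)%:E).
  apply: msq.
    rewrite (_ : _ \o _ = (fun x => Re (g x) - Re (s x))); last first.
      by apply/funext => x /=; rewrite Re_addc; case: (s x).
    by apply: measurable_funB => //; exact: measurable_Re hs.
  rewrite (_ : _ \o _ = (fun x => Im (g x) - Im (s x))); last first.
    by apply/funext => x /=; rewrite Im_addc; case: (s x).
  by apply: measurable_funB => //; exact: measurable_Im hs.
apply: (@le_trans _ _ (\int[m]_x (2%:E * (cabs (g x - s x) ^+ 2)%:E + 2%:E * (cabs (s x - c) ^+ 2)%:E))%E).
  apply: ge0_le_integral => //.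
  - by move=> x _; rewrite lee_fin sqr_ge0.
  - apply: msq.
      rewrite (_ : _ \o _ = (fun x => Re (g x) - Re c)); last first.
        by apply/funext => x /=; rewrite Re_addc; case: (c).
      by apply: measurable_funB.
    rewrite (_ : _ \o _ = (fun x => Im (g x) - Im c)); last first.
      by apply/funext => x /=; rewrite Im_addc; case: (c).
    by apply: measurable_funB.
  - by apply: emeasurable_funD; apply: measurable_funeM.
  move=> x _; rewrite -!EFinM -EFinD lee_fin.
  have -> : g x - c = (g x - s x) + (s x - c) by rewrite addrA subrK.
  rewrite !cabs_sqr !(Re_addc _ (g x - s x)) !(Im_addc _ (g x - s x)).
  move: (Re _) (Re _) (Im _) (Im _) => a1 a2 a3 a4.
  by rewrite -subr_ge0 (_ : _ - _ = (a1 - a2) ^+ 2 + (a3 - a4) ^+ 2) ?addr_ge0 ?sqr_ge0//; ring.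
rewrite ge0_integralD//; last first.
- exact: measurable_funeM.
- by move=> x _; rewrite mule_ge0// lee_fin sqr_ge0.
- exact: measurable_funeM.
- by move=> x _; rewrite mule_ge0// lee_fin sqr_ge0.
rewrite !ge0_integralZl//; try by move=> x _; rewrite lee_fin sqr_ge0.
have fin := integrable_fin_num measurableT (normsq_integrable _ _ _ _ _ hsc).
have -> : (\int[m]_x (cabs (s x - c) ^+ 2)%:E = (normsq m (fun x => s x - c))%:E)%E.
  by rewrite /normsq /Rintegral fineK.
apply: (@le_trans _ _ (2%:E * (e / 6)%:E + 2%:E * (2 * (e / 6) + 2 * N)%:E)%E).
  by rewrite leeD// lee_pmul2l// ?lee_fin// ltW.
by rewrite -!EFinM -!EFinD lee_fin; lra.
Qed.

End calculus.
End spectral.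

(** * Open sets and continuous functions in the plane *)

Section plane_measurability.
Context (R : realType).

(** Measurability refers to the product sigma-algebra; an open set is the union of the countably
    many rational rectangles it contains. *)
Lemma open_prod_measurable (U : set (R * R)) : open U -> measurable U.
Proof.
move=> oU.
pose rect (i : (rat * rat) * (rat * rat)) : set (R * R) :=
  `]ratr i.1.1, ratr i.1.2[%classic `*` `]ratr i.2.1, ratr i.2.2[%classic.
pose F i := if `[< rect i `<=` U >] then rect i else set0.
have -> : U = \bigcup_i F i.
  apply/seteqP; split => [[x y] Uxy|z [i _]]; last by rewrite /F; case: asboolP => // h /h.
  have /nbhs_ballP[e /= e0 he] : nbhs (x, y) U by exact: open_nbhs_nbhs.
  have itv (t : R) : exists q : rat * rat, [/\ t - e < ratr q.1, ratr q.1 < t, t < ratr q.2 & ratr q.2 < t + e].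
    have h1 : t - e < t by rewrite ltrBlDr ltrDl.
    have h2 : t < t + e by rewrite ltrDl.
    have [q1 /[!inE]/= q1P] := rat_in_itvoo h1; have [q2 /[!inE]/= q2P] := rat_in_itvoo h2.
    move: q1P q2P; rewrite ?in_itv/= => /andP[? ?] /andP[? ?].
    by exists (q1, q2).
  have [p [p1 p2 p3 p4]] := itv x; have [q [q1 q2 q3 q4]] := itv y.
  exists (p, q) => //; rewrite /F; case: asboolP; last first.
    case=> -[x' y'] [/=]; rewrite !in_itv/= => /andP[? ?] /andP[? ?]; apply: he.
    by split; rewrite /ball/= ltr_norml; apply/andP; split; lra.
  by move=> _; split; rewrite /= in_itv/= ?p2 ?p3 ?q2 ?q3.
apply: countable_bigcupT_measurable; first exact: countableP.
by move=> i; rewrite /F; case: asboolP => // _; exact: measurableX.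
Qed.

Lemma continuous_open_measurable (D : set (R * R)) (f : R * R -> R) : open D ->
  (forall l, D l -> {for l, continuous f}) -> measurable_fun D f.
Proof.
move=> oD cf; apply: (measurability _ (RGenOpens.measurableE R)) => _ [_ [a [b ->] <-]].
apply: open_prod_measurable; rewrite openE => l [Dl fl]; apply: filterI.
  exact: open_nbhs_nbhs.
by apply: (cf l Dl); apply: open_nbhs_nbhs; split => //; exact: interval_open.
Qed.

End plane_measurability.

(** * Null sets, eigenvectors and spectral integrals *)

Section spectral_consequences.
Context (d : measure_display) (T : measurableType d) (R : realType).
Variable mu : {measure set T -> \bar R}.
Implicit Types (u v w : T -> R[i]).

Lemma measurable_cabs_sqr (d' : measure_display) (S : measurableType d') (D : set S) (f : S -> R[i]) :
  measurable_fun D (@Re R \o f) -> measurable_fun D (@Im R \o f) ->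
  measurable_fun D (fun s => (cabs (f s) ^+ 2)%:E).
Proof.
move=> mr mi; apply/measurable_EFinP.
rewrite (_ : (fun s => _) = (fun s => Re (f s) ^+ 2 + Im (f s) ^+ 2)); last first.
  by apply/funext => s; rewrite cabs_sqr.
by apply: measurable_funD; apply: measurable_funX.
Qed.

(** [N] is null for the measure of u, so the simple functions that approximate p approximate q
    equally well. *)
Lemma spectral_integral_congr (d' : measure_display) (S : measurableType d')
    (P : set S -> (T -> R[i]) -> (T -> R[i])) (D N : set S) (p q : S -> R[i]) u w :
  measurable D -> measurable N ->
  measurable_fun D (@Re R \o p) -> measurable_fun D (@Im R \o p) ->
  measurable_fun D (@Re R \o q) -> measurable_fun D (@Im R \o q) ->
  (forall s, D s -> ~ N s -> p s = q s) -> (L2 mu u -> normsq mu (P N u) = 0) ->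
  spectral_integral mu P D p u w -> spectral_integral mu P D q u w.
Proof.
move=> mD mN pr pi qr qi pq nN [hu [hw [m [hm H]]]].
split => //; split => //; exists m; split => // e e0.
have [k [c [A [mA he hn]]]] := H e e0; exists k, c, A; split => //.
have mNn : m.-negligible N by exists N; split => //; rewrite hm// nN.
pose s (x : S) := \sum_(i < k) c i * rtoc (\1_(A i) x : R).
have [sr si] : measurable_fun setT (@Re R \o s) /\ measurable_fun setT (@Im R \o s).
  pose cR := @Re R; pose cI := @Im R.
  have hRe (z : 'I_k -> R[i]) : Re (\sum_(i < k) z i) = \sum_(i < k) Re (z i).
    by elim/big_rec2: _ => // i x y _ <-; rewrite Re_addc.
  have hIm (z : 'I_k -> R[i]) : Im (\sum_(i < k) z i) = \sum_(i < k) Im (z i).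
    by elim/big_rec2: _ => // i x y _ <-; rewrite Im_addc.
  split.
    rewrite (_ : _ \o s = (fun x => \sum_(i < k) Re (c i) * (\1_(A i) x))); last first.
      by apply/funext => x; rewrite /= hRe; apply: eq_bigr => i _; rewrite Re_mulc/= mulr0 subr0.
    by apply: measurable_sum => i; apply: measurable_funM => //; exact: measurable_indic.
  rewrite (_ : _ \o s = (fun x => \sum_(i < k) Im (c i) * (\1_(A i) x))); last first.
    by apply/funext => x; rewrite /= hIm; apply: eq_bigr => i _; rewrite Im_mulc/= mulr0 add0r.
  by apply: measurable_sum => i; apply: measurable_funM => //; exact: measurable_indic.
have ms f : measurable_fun D (@Re R \o f) -> measurable_fun D (@Im R \o f) ->
    measurable_fun D (fun x => (cabs (f x - s x) ^+ 2)%:E).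
  move=> fr fi; apply: measurable_cabs_sqr.
    rewrite (_ : _ \o _ = (fun x => Re (f x) - Re (s x))); last first.
      by apply/funext => x /=; rewrite Re_addc; case: (s x).
    by apply: measurable_funB => //; exact: measurable_funTS.
  rewrite (_ : _ \o _ = (fun x => Im (f x) - Im (s x))); last first.
    by apply/funext => x /=; rewrite Im_addc; case: (s x).
  by apply: measurable_funB => //; exact: measurable_funTS.
apply: le_lt_trans he; rewrite le_eqVlt; apply/orP; left; apply/eqP.
apply: (@ae_eq_integral _ _ _ m D (fun x => (cabs (p x - s x) ^+ 2)%:E)) => //; [exact: ms|exact: ms|].
apply: (negligibleS _ mNn) => x /= hx; apply: contrapT => nNx; apply: hx => Dx.
by rewrite pq.
Qed.

Variable P : set R -> (T -> R[i]) -> (T -> R[i]).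
Hypothesis HP : is_spectral_measure mu P.

Lemma id_bound u w (c : R[i]) : spectral_integral mu P setT (fun l : R => rtoc l) u w ->
  exists m : {measure set R -> \bar R}, (forall A, measurable A -> m A = (normsq mu (P A u))%:E) /\
  (\int[m]_s (cabs (rtoc s - c) ^+ 2)%:E <= (4 * normsq mu (fun x => w x - c * u x))%:E)%E.
Proof.
move=> [hu [hw [m [hm H]]]]; exists m; split => //.
apply: (spectral_bound _ _ _ _ _ _ _ HP u m hu hm (fun l : R => rtoc l) w c _ _ hw).
- exact: (@measurable_id _ _ setT).
- exact: (@measurable_cst _ _ _ _ setT (0 : R)).
move=> e e0; have [k [b [A [mA h1 h2]]]] := H e e0; exists k, b, A; split => //.
by under [X in normsq mu X]eq_fun do under eq_bigr do rewrite -[A _]setIT.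
Qed.

(** The integral of |s - l|^2 against the measure of phi is at most 4 times the squared norm of l
    phi - l phi, that is 0; so this measure sits at l. *)
Lemma eigen_null (l : R) phi (Z : set R) : measurable Z -> ~ Z l ->
  spectral_integral mu P setT (fun l : R => rtoc l) phi (fun x => rtoc l * phi x) ->
  P Z phi = (fun=> 0) %[ae mu].
Proof.
move=> mZ nZ sp; have [hphi _] := sp.
have [m [hm hb]] := id_bound _ _ (rtoc l) sp.
have e0 : normsq mu (fun x => rtoc l * phi x - rtoc l * phi x) = 0.
  rewrite (_ : (fun x => _) = (fun=> 0)) ?normsq0//.
  by apply/funext => x; rewrite subrr.
rewrite e0 mulr0 in hb.
have mf : measurable_fun setT (fun s : R => (cabs (rtoc s - rtoc l) ^+ 2)%:E).
  apply: measurable_cabs_sqr; last first.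
    by rewrite (_ : _ \o _ = cst 0)//; apply/funext => x /=; rewrite subrr.
  rewrite (_ : _ \o _ = (fun x => x - l)); last by apply/funext.
  exact: measurable_funB.
have i0 : (\int[m]_s `|(cabs (rtoc s - rtoc l) ^+ 2)%:E| = 0)%E.
  apply/eqP; rewrite eq_le integral_ge0 ?andbT//.
  by under eq_integral do rewrite gee0_abs ?lee_fin ?sqr_ge0//.
have /(ae_eq_integral_abs m measurableT mf) [N [mN N0 hN]] := i0.
apply: normsq_eq0; first exact: (spm_L2 HP).
apply/EFin_inj; rewrite -hm//; apply/eqP; rewrite eq_le measure_ge0 andbT.
apply: (@le_trans _ _ (m N)); last by rewrite N0.
apply: le_measure; rewrite ?inE// => x Zx; apply: hN => /= h; apply: nZ.
have [e2] := h I; have /eqP := cabs_eq0 _ (rtoc x - rtoc l) e2.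
rewrite subr_eq0 => /eqP[] <-.
exact: Zx.
Qed.

(** [P Z] kills every eigenvector: by [eigen_null] if the eigenvalue is off [Z], and because the
    vector vanishes otherwise. As [P Z] does not increase norms, its value at u is as small as the
    distance from u to sums of eigenvectors. *)
Lemma pure_point_null (Z : set R) u : measurable Z -> L2 mu u ->
  (forall l phi, Z l -> L2 mu phi ->
     spectral_integral mu P setT (fun l : R => rtoc l) phi (fun x => rtoc l * phi x) ->
     phi = (fun=> 0) %[ae mu]) ->
  (forall e : R, 0 < e -> exists k (l : 'I_k -> R) (phi : 'I_k -> T -> R[i]),
    (forall i, L2 mu (phi i) /\
     spectral_integral mu P setT (fun l : R => rtoc l) (phi i) (fun x => rtoc (l i) * phi i x)) /\
    normsq mu (fun x => u x - \sum_(i < k) phi i x) < e) ->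
  P Z u = (fun=> 0) %[ae mu].
Proof.
move=> mZ hu noZ H; apply: normsq_eq0; first exact: (spm_L2 HP).
apply/eqP; rewrite eq_le normsq_ge0 andbT; apply/ler_addgt0Pl => e e0; rewrite addr0.
have [k [l [phi [hphi he]]]] := H e e0; apply: le_trans (ltW he).
have hf i : L2 mu (phi i) by have [] := hphi i.
have hs : L2 mu (fun x => \sum_(i < k) phi i x) by exact: L2_sum.
have hd : L2 mu (fun x => u x - \sum_(i < k) phi i x) by exact: L2_sub.
have h0 : P Z (fun x => \sum_(i < k) phi i x) = (fun=> 0) %[ae mu].
  apply: (spm_sum0 _ _ _ _ _ _ _ HP) => // i; have [hi si] := hphi i.
  have [Zl|nZl] := pselect (Z (l i)); last exact: eigen_null si.
  apply: (spm_null _ _ _ _ _ _ _ HP _ _ (fun=> 0)) => //; [exact: L2_0|exact: noZ Zl hi si|].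
  exact: (spm0 _ _ _ _ _ _ _ HP).
have e1 : P Z u = P Z (fun x => u x - \sum_(i < k) phi i x) %[ae mu].
  have := spm_add _ _ _ _ _ _ _ HP Z _ _ mZ hd hs.
  rewrite (_ : (fun x => u x - _ + _) = u); last by apply/funext => x; rewrite subrK.
  move=> e1; apply: filterS2 e1 h0 => x e1 e2 _.
  by rewrite e1// e2// addr0.
rewrite (normsq_ae _ _ _ _ _ _ _ _ e1); [|exact: (spm_L2 HP)..].
exact: (spm_normsq_le _ _ _ _ _ _ _ HP).
Qed.

(** The measure of [P [set l] u] sits at l, where l times the indicator of the point equals the
    identity function; so one simple function is an exact approximation. *)
Lemma atom_eigen (l : R) u : L2 mu u ->
  spectral_integral mu P setT (fun l : R => rtoc l) (P [set l] u) (fun x => rtoc l * P [set l] u x).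
Proof.
move=> hu; have mL : measurable [set l : R] by exact: measurable_set1.
have hv : L2 mu (P [set l] u) by exact: (spm_L2 HP).
split => //; split; first exact: L2_scale.
have [m hm] := spm_sigma_additive HP hv; exists m; split => // e e0.
exists 1%N, (fun=> rtoc l), (fun=> [set l]); split => //.
  have mC : measurable (~` [set l : R]) by exact: measurableC.
  have m0 : m (~` [set l]) = 0%E.
    rewrite hm// (normsq_ae0 _ _ _ _ _ (spm_L2 HP mC hv))//.
    by apply: (spm_setI0 _ _ _ _ _ _ _ HP) => //; rewrite setICl.
  rewrite (_ : (\int[m]_s _ = 0)%E) ?lte_fin//.
  transitivity (\int[m]_s (cst 0%E s : \bar R))%E; last by rewrite integral0.
  apply: ae_eq_integral => //.
    apply: measurable_cabs_sqr; last first.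
      rewrite (_ : _ \o _ = cst 0)//; apply/funext => x /=.
      by rewrite big_ord1/= !mulr0 mul0r addr0 subr0.
    rewrite (_ : _ \o _ = (fun x => x - l * \1_[set l] x)); last first.
      by apply/funext => x; rewrite /= big_ord1/= mulr0 subr0.
    by apply: measurable_funB => //; apply: measurable_funM => //; exact: measurable_indic.
  exists (~` [set l]); split => // x /= h xl; apply: h => _.
  rewrite big_ord1 xl indicE mem_set//.
  have -> : rtoc l - rtoc l * rtoc (true%:R : R) = 0.
    by apply: complex_ext; rewrite /= ?mulr1 ?mulr0 ?subr0 ?mul0r ?addr0 ?subrr// oppr0.
  by rewrite ComplexField.Normc.normc0 expr0n.
rewrite (_ : (fun x => _) = (fun x => rtoc l * P [set l] u x + (- rtoc l) * P [set l] (P [set l] u) x)); last first.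
  by apply/funext => x; rewrite big_ord1 setIT mulNr.
rewrite normsq_ae0//.
  by apply: L2_add; apply: L2_scale => //; exact: (spm_L2 HP).
have := spm_setI HP mL mL hu; rewrite setIid; apply: filterS => x h _.
by rewrite h// mulNr subrr.
Qed.

End spectral_consequences.

(** * Operators with a bounded kernel *)

Section atomless.
Context (R : realType) (m : {measure set R -> \bar R}).
Hypothesis atomless : forall x, m [set x] = 0%E.

Lemma measure_null_bigcup (F : (set R)^nat) (A : set R) : measurable A ->
  (forall k, measurable (F k)) -> (forall k, m (F k) = 0%E) -> A `<=` \bigcup_k F k -> m A = 0%E.
Proof.
move=> mA mF F0 sub; apply/eqP; rewrite eq_le measure_ge0 andbT.
have mU : measurable (\bigcup_k F k) by exact: bigcupT_measurable.
apply: (le_trans (le_measure m _ _ sub)); rewrite ?inE//.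
apply: (le_trans (generalized_Boole_inequality m mF mU)).
by rewrite eseries0.
Qed.

(** Otherwise each x has no mass of A on its left or none on its right. With s the supremum of the x
    without mass on the left, which exists as A is bounded, all mass of A would sit at s. *)
Lemma atomless_split (A : set R) (a b : R) : measurable A -> A `<=` `[a, b] -> (0 < m A)%E ->
  exists x : R, (0 < m (A `&` `]-oo, x]))%E /\ (0 < m (A `&` `]x, +oo[))%E.
Proof.
move=> mA Aab Apos; apply: contrapT => nex.
have mL (x : R) : measurable (A `&` `]-oo, x]) by exact: measurableI.
have mU (x : R) : measurable (A `&` `]x, +oo[) by exact: measurableI.
have zero x : m (A `&` `]-oo, x]) = 0%E \/ m (A `&` `]x, +oo[) = 0%E.
  have [|h] := eqVneq (m (A `&` `]-oo, x])) 0%E; first by left.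
  have [|h'] := eqVneq (m (A `&` `]x, +oo[)) 0%E; first by right.
  by exfalso; apply: nex; exists x; rewrite !lt0e h h' !measure_ge0.
have ntop : m A <> 0%E by move=> h; rewrite h ltxx in Apos.
pose S := [set x | m (A `&` `]-oo, x]) = 0%E].
have Sa : S (a - 1).
  rewrite /S/= (_ : _ `&` _ = set0) ?measure0//; apply/seteqP; split => // x [/Aab/=].
  by rewrite !in_itv/=; lra.
have ubS : ubound S b.
  move=> y Sy; rewrite leNgt; apply/negP => yb; apply: ntop; rewrite -Sy; congr (m _).
  apply/seteqP; split => [x Ax|x []//]; split => //.
  by have := Aab _ Ax; rewrite /= !in_itv/=; lra.
have hsS : has_sup S by split; [exists (a - 1)|exists b].
pose s := sup S; apply: ntop.
have k0 k : 0 < k.+1%:R^-1 :> R by rewrite invr_gt0.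
apply: (measure_null_bigcup (fun k => (A `&` `]-oo, s - k.+1%:R^-1]) `|` [set s] `|`
   (A `&` `]s + k.+1%:R^-1, +oo[))) => // [k|k|x Ax].
- by apply: measurableU => //; apply: measurableU.
- have l0 : m (A `&` `]-oo, s - k.+1%:R^-1]) = 0%E.
    have [y Sy sy] := sup_adherent (k0 k) hsS.
    apply/eqP; rewrite eq_le measure_ge0 andbT -[leRHS]Sy; apply: le_measure; rewrite ?inE//.
    by move=> z [Az]; rewrite /= in_itv/= => hz; split => //; rewrite /= in_itv/=; exact: (le_trans hz (ltW sy)).
  have u0 : m (A `&` `]s + k.+1%:R^-1, +oo[) = 0%E.
    case: (zero (s + k.+1%:R^-1)) => // Sk.
    have : s + k.+1%:R^-1 <= s by apply: sup_upper_bound.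
    by rewrite gerDl leNgt k0.
  by rewrite !null_set_setU//; apply: measurableU.
- have [xs|sx|->] := ltgtP x s; last by exists 0%N => //; left; right.
    have [k hk] := ltr_add_invr xs; exists k => //; left; left; split => //.
    by rewrite /= in_itv/= lerBrDr (ltW hk).
  have [k hk] := ltr_add_invr sx; exists k => //; right; split => //.
  by rewrite /= in_itv/= andbT.
Qed.

Lemma atomless_family n (A : set R) (a b : R) : measurable A -> A `<=` `[a, b] -> (0 < m A)%E ->
  exists F : nat -> set R, (forall i, (i < n)%N ->
     [/\ measurable (F i), F i `<=` A & (0 < m (F i))%E]) /\
   forall i j, (i < n)%N -> (j < n)%N -> i != j -> F i `&` F j = set0.
Proof.
elim: n A => [|n IH] A mA Aab Apos; first by exists (fun=> set0).
have [x [x1 x2]] := atomless_split A a b mA Aab Apos.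
have [F [F1 F2]] := IH (A `&` `]x, +oo[) (measurableI _ _ mA (measurable_itv _))
  (subset_trans (@subIsetl _ A _) Aab) x2.
have subA i : (i < n)%N -> F i `<=` A by move=> /F1[_ h _] y /h[].
have dis i : (i < n)%N -> (A `&` `]-oo, x]) `&` F i = set0.
  move=> /F1[_ h _]; apply/seteqP; split => // y [[_ /=]].
  by rewrite in_itv/= => yx /h[_]; rewrite /= in_itv/= andbT ltNge yx.
exists (fun i => if i is j.+1 then F j else A `&` `]-oo, x]); split => [[|i]|].
- by split => //; exact: measurableI.
- by rewrite ltnS => hi; have [? ? ?] := F1 i hi; split => //; exact: subA.
move=> [|i] [|j]//; rewrite ?ltnS => hi hj ij; first exact: dis.
  by rewrite setIC; exact: dis.
exact: F2.
Qed.

End atomless.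

(** * Bessel's inequality for orthogonal vectors *)

Section bessel.
Context (d : measure_display) (T : measurableType d) (R : realType).
Variable mu : {measure set T -> \bar R}.

Lemma bessel n (v : 'I_n -> T -> R[i]) (k : T -> R[i]) (a : 'I_n -> R) :
  L2 mu k -> (forall i, L2 mu (v i)) -> (forall i, 0 < a i) ->
  (forall i j, inner mu (v i) (v j) = if i == j then Complex (a i) 0 else 0) ->
  \sum_(i < n) (a i)^-1 * cabs (inner mu (v i) k) ^+ 2 <= normsq mu k.
Proof.
move=> hk hv a0 orth.
pose b i := inner mu k (v i).
pose c i := b i * rtoc (a i)^-1.
pose f x := \sum_(i < n) c i * v i x.
have hf : L2 mu f by apply: L2_sum => i; exact: L2_scale.
set B := \sum_(i < n) _.
have bE i : inner mu (v i) k = (b i)^*%C by rewrite /b (inner_conj _ _ _ _ _ _ hk (hv i)).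
have sq (z : R[i]) (t : R) : z^*%C * (z * rtoc t) = rtoc (t * cabs z ^+ 2).
  by rewrite cabs_sqr; case: z => x y; apply: complex_ext => /=; ring.
have cj (z : R[i]) (r : R) : r != 0 -> (z * rtoc r^-1)^*%C * rtoc r = z^*%C.
  by case: z => x y r0; apply: complex_ext => /=; field.
have kf : inner mu f k = rtoc B.
  rewrite inner_suml// /B; rewrite (eq_bigr (fun i => rtoc ((a i)^-1 * cabs (inner mu (v i) k) ^+ 2))).
    by elim/big_rec2: _ => // i x y _ ->; apply: complex_ext; rewrite /= ?addr0.
  move=> i _; rewrite /c bE mulrC sq; congr (rtoc (_ * _)).
  by rewrite !cabs_sqr Re_conjc Im_conjc sqrrN.
have ff : inner mu f f = rtoc B.
  rewrite inner_suml// -kf inner_suml//; apply: eq_bigr => i _; congr (_ * _).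
  rewrite inner_sumr// (bigD1 i)//= orth eqxx big1 ?addr0 => [|j ji]; last first.
    by rewrite orth eq_sym (negbTE ji) mulr0.
  by rewrite bE -(cj (b i) (a i) (lt0r_neq0 (a0 i))).
have kB : inner mu k f = rtoc B.
  by rewrite (inner_conj _ _ _ _ _ _ hf hk) kf; apply: complex_ext; rewrite /= ?oppr0.
pose g x := (-1) * f x + k x.
have hg : L2 mu g by apply: L2_lin.
have gf : inner mu g f = 0.
  by rewrite inner_lin// ff kB; apply: complex_ext => /=; ring.
have gk : inner mu g k = rtoc (normsq mu k - B).
  by rewrite inner_lin// kf normsq_inner//; apply: complex_ext => /=; ring.
have : rtoc (normsq mu g) = rtoc (normsq mu k - B).
  rewrite -normsq_inner// inner_lin// (inner_conj _ _ _ _ _ _ hg hf) (inner_conj _ _ _ _ _ _ hg hk).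
  by rewrite gf gk; apply: complex_ext => /=; ring.
by move=> [e]; have := normsq_ge0 _ _ _ mu g; rewrite e subr_ge0.
Qed.

End bessel.

(** * Bounded kernels on a space of finite measure *)

Section hilbert_schmidt.
Context (d : measure_display) (T : measurableType d) (R : realType).
Variable mu : {measure set T -> \bar R}.
Hypothesis mufin : (mu setT < +oo)%E.
Variable P : set R -> (T -> R[i]) -> (T -> R[i]).
Hypothesis HP : is_spectral_measure mu P.
Variables (k : T -> T -> R) (C t : R).
Hypothesis mk : measurable_fun setT (fun x : T * T => k x.1 x.2).
Hypothesis kC : forall x y, `|k x y| <= C.
Hypothesis t0 : 0 < t.
Let K u x := cintegral mu (fun y => rtoc (k x y) * u y).
Hypothesis sK : forall u, L2 mu u ->
  spectral_integral mu P setT (fun l : R => rtoc (expR (- (t * l)))) u (K u).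

Lemma kernel_L2 x : L2 mu (fun y => rtoc (k x y)).
Proof.
split; last exact: realL2_0.
apply: (realL2_measurable_bounded _ _ _ _ mufin _ C) => //.
  exact: (measurableT_comp mk (pair1_measurable x)).
by move=> y; exact: kC.
Qed.

Lemma kernel_inner u x : K u x = inner mu u (fun y => rtoc (k x y)).
Proof.
congr cintegral; apply/funext => y; rewrite mulrC; congr (_ * _).
by apply: complex_ext; rewrite /= ?oppr0.
Qed.

(** On [B] the function exp (- t l) is at least exp (- t Lam); the 4 is that of [spectral_bound],
    taken at c = 0. *)
Lemma kernel_lower (B : set R) (Lam : R) u : measurable B -> B `<=` `]-oo, Lam] -> L2 mu u ->
  normsq mu (P (~` B) u) = 0 -> expR (- (t * Lam)) ^+ 2 * normsq mu (P B u) <= 4 * normsq mu (K u).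
Proof.
move=> mB BL hu nB; have [_ [hK [m [hm H]]]] := sK u hu.
have mexp : measurable_fun setT (fun l : R => expR (- (t * l))).
  apply: (measurableT_comp (@measurable_expR R)); apply: measurable_funN.
  by apply: measurable_funM; [exact: measurable_cst|exact: measurable_id].
have := spectral_bound _ _ _ _ _ _ _ HP u m hu hm (fun l : R => rtoc (expR (- (t * l)))) (K u) 0.
have mz : measurable_fun setT (@Im R \o (fun l : R => rtoc (expR (- (t * l))))).
  exact: (@measurable_cst _ _ _ _ setT (0 : R)).
move=> /(_ mexp mz hK) h.
have {h} : (\int[m]_s (cabs (rtoc (expR (- (t * s))) - 0) ^+ 2)%:E <=
   (4 * normsq mu (fun x => K u x - 0 * u x))%:E)%E.
  apply: h => e e0; have [j [b [A [mA h1 h2]]]] := H e e0; exists j, b, A; split => //.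
  by under [X in normsq mu X]eq_fun do under eq_bigr do rewrite -[A _]setIT.
rewrite (_ : (fun x => K u x - 0 * u x) = K u); last by apply/funext => x; rewrite mul0r subr0.
move=> h; rewrite -lee_fin; apply: le_trans h.
have cE s : cabs (rtoc (expR (- (t * s))) - 0) ^+ 2 = expR (- (t * s)) ^+ 2.
  by rewrite subr0 cabs_sqr/= expr0n addr0.
rewrite EFinM -hm//.
have mf : measurable_fun setT (fun s : R => (cabs (rtoc (expR (- (t * s))) - 0) ^+ 2)%:E).
  under eq_fun do rewrite cE.
  by apply/measurable_EFinP; exact: measurable_funX.
apply: (@le_trans _ _ (\int[m]_(s in B) (cabs (rtoc (expR (- (t * s))) - 0) ^+ 2)%:E)%E); last first.
  by apply: ge0_subset_integral => // s _; rewrite lee_fin sqr_ge0.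
rewrite -(integral_cst m mB); apply: ge0_le_integral => //.
- by move=> s _; rewrite lee_fin sqr_ge0.
- exact: measurable_funTS.
move=> s Bs; rewrite lee_fin cE ler_sqr ?nnegrE ?expR_ge0// ler_expR lerN2 ler_pM2l//.
by have := BL _ Bs; rewrite /= in_itv.
Qed.

(* Without atoms B splits into as many pieces of positive mass as wanted, which
   yields too many orthogonal vectors that the Hilbert-Schmidt operator K shrinks
   by at most exp (- t b). *)
Lemma no_atoms_null (B : set R) (a b : R) u : measurable B -> B `<=` `[a, b] -> L2 mu u ->
  (forall l v, B l -> L2 mu v -> P [set l] v = (fun=> 0) %[ae mu]) ->
  P B u = (fun=> 0) %[ae mu].
Proof.
move=> mB Bab hu noat; pose v := P B u.
have hv : L2 mu v by exact: (spm_L2 HP).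
have [m hm] := spm_sigma_additive HP hv.
have [m0|mpos] := eqVneq (m B) 0%E.
  move: m0; rewrite hm// => -[/normsq_eq0 h].
  have {}h : P B v = (fun=> 0) %[ae mu] by apply: h; exact: (spm_L2 HP).
  apply: ae_eq_trans h; apply: ae_eq_sym; have := spm_setI HP mB mB hu.
  by rewrite setIid.
exfalso.
have atl x : m [set x] = 0%E.
  have mx : measurable [set x : R] by exact: measurable_set1.
  rewrite hm// normsq_ae0//; first exact: (spm_L2 HP).
  have [Bx|nBx] := pselect (B x); first exact: noat.
  apply: (spm_setI0 _ _ _ _ _ _ _ HP) => //.
  by apply/seteqP; split => // y [/= ->].
have Bpos : (0 < m B)%E by rewrite lt0e mpos measure_ge0.
pose V := fine (mu setT).
have V0 : 0 <= V by rewrite fine_ge0.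
pose E := expR (- (t * b)) ^+ 2.
have E0 : 0 < E by rewrite exprn_gt0// expR_gt0.
(* Chosen so that n E / 4, the lower bound of the sum below, exceeds its upper bound C^2 V^2. *)
pose n := (Num.truncn (4 * (C ^+ 2 * V * V) / E)).+1.
have [F [F1 F2]] := atomless_family R m atl n B a b mB Bab Bpos.
pose w (i : 'I_n) := P (F i) v.
pose c (i : 'I_n) := normsq mu (w i).
have mF (i : 'I_n) : measurable (F i) by have [] := F1 i (ltn_ord i).
have hw i : L2 mu (w i) by exact: (spm_L2 HP).
have c0 i : 0 < c i by have [_ _] := F1 i (ltn_ord i); rewrite hm// lte_fin.
have orth i j : inner mu (w i) (w j) = if i == j then Complex (c i) 0 else 0.
  rewrite (spm_inner _ _ _ _ _ _ _ HP)//; case: eqVneq => [->|ij]; first by rewrite setIid.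
  have -> : F i `&` F j = set0 by apply: F2.
  have := hm set0 measurable0; rewrite measure0 => -[<-].
  by [].
have hK i : L2 mu (K (w i)) by have [_ [? _]] := sK _ (hw i).
(* K (w i) x is the inner product of w i with the row of the kernel at x, so Bessel bounds the sum
   by the squared norm of the row, whatever n is. Integration over x then gives [total]. *)
have pt x : \sum_(i < n) (c i)^-1 * cabs (K (w i) x) ^+ 2 <= C ^+ 2 * V.
  under eq_bigr do rewrite kernel_inner.
  apply: le_trans (bessel _ _ _ _ _ _ _ _ (kernel_L2 x) hw c0 orth) _.
  rewrite /normsq -Rintegral_cst//; apply: le_Rintegral => //.
  - exact: normsq_integrable (kernel_L2 x).
  - apply/integrableP; split => //; first by apply/measurable_EFinP; exact: measurable_cst.
    by rewrite (eq_integral (cst (`|C ^+ 2|%:E)))// integral_cst// lte_mul_pinfty// ?lee_fin.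
  move=> y _; rewrite cabs_sqr/= expr0n addr0 -real_normK ?num_real//.
  by rewrite ler_sqr ?nnegrE// (le_trans _ (kC x y)).
have total : \sum_(i < n) (c i)^-1 * normsq mu (K (w i)) <= C ^+ 2 * V * V.
  have nK i : (normsq mu (K (w i)))%:E = (\int[mu]_x (cabs (K (w i) x) ^+ 2)%:E)%E.
    have fin := integrable_fin_num measurableT (normsq_integrable _ _ _ _ _ (hK i)).
    by rewrite /normsq /Rintegral fineK.
  have mKi i : measurable_fun setT (fun x => (cabs (K (w i) x) ^+ 2)%:E).
    by apply: measurable_cabs_sqr; [exact: measurable_Re (hK i)|exact: measurable_Im (hK i)].
  have ci0 i : 0 <= (c i)^-1 by rewrite invr_ge0 ltW.
  rewrite -lee_fin -sumEFin.
  rewrite (eq_bigr (fun i => \int[mu]_x ((c i)^-1%:E * (cabs (K (w i) x) ^+ 2)%:E))%E); last first.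
    move=> i _; rewrite ge0_integralZl_EFin//; first by rewrite -nK.
    by move=> x _; rewrite lee_fin sqr_ge0.
  rewrite -ge0_integral_sum//; last first.
  - by move=> i x _; rewrite mule_ge0// lee_fin// sqr_ge0.
  - by move=> i; apply: measurable_funeM.
  apply: (@le_trans _ _ (\int[mu]_x (C ^+ 2 * V)%:E)%E).
    apply: ge0_le_integral => //.
    + by move=> x _; apply: sume_ge0 => i _; rewrite mule_ge0// lee_fin// sqr_ge0.
    + by apply: emeasurable_sum => i; apply: measurable_funeM.
    + by move=> x _; under eq_bigr do rewrite -EFinM; rewrite sumEFin lee_fin.
  rewrite integral_cst//; have -> : mu setT = V%:E by rewrite fineK// ge0_fin_numE.
  by rewrite -EFinM.
have lower : n%:R * (E / 4) <= \sum_(i < n) (c i)^-1 * normsq mu (K (w i)).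
  rewrite (_ : n%:R * (E / 4) = \sum_(i < n) (E / 4)); last first.
    by rewrite sumr_const card_ord mulr_natl.
  apply: ler_sum => i _; rewrite ler_pdivlMl//.
  have [_ FB _] := F1 i (ltn_ord i).
  have mC : measurable (~` B) by exact: measurableC.
  have z : normsq mu (P (~` B) (w i)) = 0.
    apply: normsq_ae0; first exact: (spm_L2 HP).
    apply: (spm_setI0 _ _ _ _ _ _ _ HP) => //.
    by apply/seteqP; split => // y [nB /FB].
  have BL : B `<=` `]-oo, b].
    by move=> y /Bab; rewrite /= !in_itv/= => /andP[].
  have := kernel_lower B b (w i) mB BL (hw i) z.
  have -> : normsq mu (P B (w i)) = c i.
    apply: normsq_ae => //; first exact: (spm_L2 HP).
    by have := spm_setI HP mB (mF i) hv; rewrite (setIidr FB).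
  by rewrite -/E => h; lra.
have : 4 * (C ^+ 2 * V * V) / E < n%:R by exact: truncnS_gt.
rewrite ltr_pdivrMr// => h.
by have := le_trans lower total; lra.
Qed.

End hilbert_schmidt.

(** * Products of spectral measures *)

Section rectangles.
Context (d : measure_display) (T : measurableType d) (R : realType).
Variable mu : {sigma_finite_measure set T -> \bar R}.
Local Notation nu := (mu \x mu)%E.

(** Rectangles are stable under intersection and generate the product sigma-algebra, so Dynkin's
    theorem applies; integrability on [D1] x [D2] is what lets complements be handled by
    subtraction. *)
Lemma rect_integral_eq0 (f : T * T -> \bar R) (D1 D2 : set T) : measurable D1 -> measurable D2 ->
  nu.-integrable (D1 `*` D2) f ->
  (forall B1 B2, measurable B1 -> measurable B2 -> B1 `<=` D1 -> B2 `<=` D2 ->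
     (\int[nu]_(x in B1 `*` B2) f x = 0)%E) ->
  forall A, measurable A -> (\int[nu]_(x in A `&` (D1 `*` D2)) f x = 0)%E.
Proof.
move=> mD1 mD2 fi rect A; rewrite measurable_prod_measurableType.
have mD : measurable (D1 `*` D2) by exact: measurableX.
have fD B : measurable B -> B `<=` D1 `*` D2 -> nu.-integrable B f.
  by move=> mB BD; exact: (integrableS mD).
apply: (dynkin_induction (P := fun A => (\int[nu]_(x in A `&` (D1 `*` D2)) f x = 0)%E)).
- exact: measurable_prod_measurableType.
- move=> _ _ [A1 mA1 [A2 mA2 <-]] [B1 mB1 [B2 mB2 <-]].
  exists (A1 `&` B1); first exact: measurableI.
  by exists (A2 `&` B2); [exact: measurableI|rewrite setXI].
- by rewrite setTI; exact: rect.
- move=> _ [A1 mA1 [A2 mA2 <-]]; rewrite -setXI.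
  by apply: rect => //; exact: measurableI.
- move=> B mB B0; have mC : measurable (~` B) by exact: measurableC.
  have mBD : measurable (B `&` (D1 `*` D2)) by exact: measurableI.
  have mCD : measurable (~` B `&` (D1 `*` D2)) by exact: measurableI.
  have := rect D1 D2 mD1 mD2 (@subset_refl _ _) (@subset_refl _ _).
  have {1}-> : D1 `*` D2 = (B `&` (D1 `*` D2)) `|` (~` B `&` (D1 `*` D2)).
    by rewrite -setIUl setUv setTI.
  rewrite integral_setU//; last 2 first.
  - by rewrite -setIUl setUv setTI; exact: measurable_int fi.
  - by apply/disj_set2P/seteqP; split => // x [[Bx _] [nBx _]].
  by rewrite B0 add0e.
- move=> F mF tF F0; rewrite setI_bigcupl integral_bigcup.
  + by rewrite eseries0.
  + by apply/trivIsetP => i j _ _ ij; rewrite setIACA (trivIsetP.1 tF)// set0I.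
  + by move=> k; exact: measurableI.
  + apply: fD; first by apply: bigcupT_measurable => k; exact: measurableI.
    by apply: bigcup_sub => k _; exact: subIsetr.
Qed.

(** A square-integrable f is integrable on rectangles of finite measure, and countably many of these
    cover the product. *)
Lemma realL2_rect_null (f : T * T -> R) : realL2 nu f ->
  (forall B1 B2, measurable B1 -> measurable B2 -> (mu B1 < +oo)%E -> (mu B2 < +oo)%E ->
     \int[nu]_x (f x * \1_(B1 `*` B2) x) = 0) ->
  f = (fun=> 0) %[ae nu].
Proof.
move=> hf rect.
have mf := realL2_measurable _ _ _ _ _ hf.
have /sigma_finiteP[F [FT _ Ffin]] := sigma_finiteT mu.
have rfin B1 B2 : measurable B1 -> measurable B2 -> (mu B1 < +oo)%E -> (mu B2 < +oo)%E ->
    (nu (B1 `*` B2) < +oo)%E.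
  by move=> *; rewrite product_measure1E//= lte_mul_pinfty// ge0_fin_numE.
have fi B1 B2 : measurable B1 -> measurable B2 -> (mu B1 < +oo)%E -> (mu B2 < +oo)%E ->
    nu.-integrable (B1 `*` B2) (EFin \o f).
  move=> m1 m2 f1 f2; have mB : measurable (B1 `*` B2) by exact: measurableX.
  have [h _] := L2_indic_fin _ _ _ nu _ mB (rfin _ _ m1 m2 f1 f2).
  rewrite -[X in nu.-integrable X]setTI; apply/integrable_restrict => //.
  rewrite epatch_indic; exact: realL2_mul hf h.
have rect0 B1 B2 : measurable B1 -> measurable B2 -> (mu B1 < +oo)%E -> (mu B2 < +oo)%E ->
    (\int[nu]_(x in B1 `*` B2) (f x)%:E = 0)%E.
  move=> m1 m2 f1 f2; have mB : measurable (B1 `*` B2) by exact: measurableX.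
  have h := integrable_fin_num mB (fi _ _ m1 m2 f1 f2).
  rewrite -[LHS]fineK//; congr EFin; rewrite -[RHS](rect B1 B2)//.
  by rewrite -/(Rintegral nu (B1 `*` B2) f) Rintegral_mkcond patch_indic.
have key i j : {ae nu, forall x, (F i `*` F j) x -> f x = 0}.
  have [mi fi'] := Ffin i; have [mj fj] := Ffin j.
  have mD : measurable (F i `*` F j) by exact: measurableX.
  have : ae_eq nu (F i `*` F j) (EFin \o f) (cst 0%E).
    apply: integral_ae_eq => //; first exact: fi.
    move=> E ED mE; rewrite integral_cst// mul0e -(setIidl ED).
    apply: (rect_integral_eq0 _ _ _ mi mj (fi _ _ mi mj fi' fj)) => // B1 B2 m1 m2 s1 s2.
    apply: rect0 => //.
      by apply: le_lt_trans fi'; apply: le_measure; rewrite ?inE.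
    by apply: le_lt_trans fj; apply: le_measure; rewrite ?inE.
  by apply: filterS => x h Dx; have := h Dx => -[].
have : {ae nu, forall x, forall i j, (F i `*` F j) x -> f x = 0}.
  by apply: ae_foralln => i; apply: ae_foralln => j; exact: key.
apply: filterS => -[x y] h _.
have : [set: T] x by []. have : [set: T] y by [].
rewrite FT => -[j _ Fy] [i _ Fx].
exact: (h i j).
Qed.

Lemma L2_rect_null (w : T * T -> R[i]) : L2 nu w ->
  (forall B1 B2, measurable B1 -> measurable B2 -> (mu B1 < +oo)%E -> (mu B2 < +oo)%E ->
     inner nu w (fun x => rtoc (\1_B1 x.1 : R) * rtoc (\1_B2 x.2 : R)) = 0) ->
  w = (fun=> 0) %[ae nu].
Proof.
move=> [hr hi] rect.
have e (B1 B2 : set T) (x : T * T) : \1_(B1 `*` B2) x = \1_B1 x.1 * \1_B2 x.2 :> R.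
  by rewrite !indicE in_setX; case: (_ \in _); case: (_ \in _); rewrite ?mul0r ?mul1r.
have r0 : (@Re R \o w) = (fun=> 0) %[ae nu].
  apply: realL2_rect_null => // B1 B2 m1 m2 f1 f2.
  have [<- _] := rect B1 B2 m1 m2 f1 f2.
  apply: eq_Rintegral => x _.
  by rewrite e /=; case: (w x) => a b /=; ring.
have i0 : (@Im R \o w) = (fun=> 0) %[ae nu].
  apply: realL2_rect_null => // B1 B2 m1 m2 f1 f2.
  have [_ <-] := rect B1 B2 m1 m2 f1 f2.
  apply: eq_Rintegral => x _.
  by rewrite e /=; case: (w x) => a b /=; ring.
by apply: filterS2 r0 i0 => x /= h1 h2 _; apply: complex_ext; [exact: h1|exact: h2].
Qed.

End rectangles.

(** * Null sets of the joint spectral measure *)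

Section tensor.
Context (d : measure_display) (T : measurableType d) (R : realType).
Variable mu : {sigma_finite_measure set T -> \bar R}.
Local Notation nu := (mu \x mu)%E.
Variable P1 : set R -> (T -> R[i]) -> (T -> R[i]).
Variable P : set (R * R) -> (T * T -> R[i]) -> (T * T -> R[i]).
Hypothesis HP : is_spectral_measure nu P.
Hypothesis HP1 : forall A1 A2 u1 u2, measurable A1 -> measurable A2 -> L2 mu u1 -> L2 mu u2 ->
  P (A1 `*` A2) (fun x => u1 x.1 * u2 x.2) = (fun x => P1 A1 u1 x.1 * P1 A2 u2 x.2) %[ae nu].

(** The product formula speaks of pure tensors only. Indicators of rectangles are pure tensors, and
    the symmetry of [P] moves it from u onto them, so no density argument is needed. *)
Lemma tensor_null (A1 A2 : set R) u : measurable A1 -> measurable A2 -> L2 nu u ->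
  (forall u1 u2, L2 mu u1 -> L2 mu u2 ->
     (fun x => P1 A1 u1 x.1 * P1 A2 u2 x.2) = (fun=> 0) %[ae nu]) ->
  P (A1 `*` A2) u = (fun=> 0) %[ae nu].
Proof.
move=> m1 m2 hu h; have mA : measurable (A1 `*` A2) by exact: measurableX.
apply: L2_rect_null; first exact: (spm_L2 HP).
move=> B1 B2 mB1 mB2 f1 f2.
set v := fun x : T * T => _.
have h1 := L2_indic_fin _ _ _ mu _ mB1 f1; have h2 := L2_indic_fin _ _ _ mu _ mB2 f2.
have f12 : (nu (B1 `*` B2) < +oo)%E.
  by rewrite product_measure1E//= lte_mul_pinfty// ge0_fin_numE.
have hv : L2 nu v.
  rewrite (_ : v = fun x => rtoc (\1_(B1 `*` B2) x : R)); last first.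
    apply/funext => x; rewrite /v !indicE in_setX.
    by case: (_ \in _); case: (_ \in _); apply: complex_ext => /=; ring.
  apply: L2_indic_fin; [exact: measurableX|exact: f12].
rewrite (spm_sym HP)//.
have hPv : L2 nu (P (A1 `*` A2) v) by exact: (spm_L2 HP).
rewrite (inner_aer _ _ _ _ _ _ _ hu hPv (L2_0 _ _ _ nu)); last first.
  exact: ae_eq_trans (HP1 _ _ _ _ m1 m2 h1 h2) (h _ _ h1 h2).
by rewrite (inner_conj _ _ _ _ _ _ (L2_0 _ _ _ nu) hu) inner0l//; apply: complex_ext; rewrite /= ?oppr0.
Qed.

Lemma ae_fst (Q : T -> Prop) : {ae mu, forall x, Q x} -> {ae nu, forall x : T * T, Q x.1}.
Proof.
move=> [N [mN N0 sub]]; exists (N `*` setT); split.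
- exact: measurableX.
- by rewrite product_measure1E// [LHS]/= N0 mul0e.
- by move=> x /= nQ; split => //; exact: sub.
Qed.

Lemma ae_snd (Q : T -> Prop) : {ae mu, forall x, Q x} -> {ae nu, forall x : T * T, Q x.2}.
Proof.
move=> [N [mN N0 sub]]; exists (setT `*` N); split.
- exact: measurableX.
- by rewrite product_measure1E// [LHS]/= N0 mule0.
- by move=> x /= nQ; split => //; exact: sub.
Qed.

Lemma tensor_null_cross (Z : set R) u : measurable Z -> L2 nu u ->
  (forall v, L2 mu v -> P1 Z v = (fun=> 0) %[ae mu]) ->
  P (Z `*` setT `|` setT `*` Z) u = (fun=> 0) %[ae nu].
Proof.
move=> mZ hu h.
have mZT : measurable (Z `*` [set: R]) by exact: measurableX.
have mTZ : measurable ([set: R] `*` Z) by exact: measurableX.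
have l0 : P (Z `*` setT) u = (fun=> 0) %[ae nu].
  apply: tensor_null => // u1 u2 h1 h2.
  have := ae_fst _ (h _ h1); apply: filterS => x /(_ I) e _.
  by rewrite e mul0r.
have r0 : P (setT `*` Z) u = (fun=> 0) %[ae nu].
  apply: tensor_null => // u1 u2 h1 h2.
  have := ae_snd _ (h _ h2); apply: filterS => x /(_ I) e _.
  by rewrite e mulr0.
have [m hm] := spm_sigma_additive HP hu.
apply: normsq_eq0; first by apply: (spm_L2 HP) => //; exact: measurableU.
apply: EFin_inj; rewrite -hm; last exact: measurableU.
by rewrite null_set_setU// hm// normsq_ae0//; exact: (spm_L2 HP).
Qed.

End tensor.

(** * Fractafolds *)

Lemma contraction_fixed_unique (R : realType) (n : nat) (f : 'rV[R]_n -> 'rV[R]_n) x y :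
  euclid_contraction f -> f x = x -> f y = y -> x = y.
Proof.
move=> [c c1 hf] fx fy; have := hf x y; rewrite fx fy.
set N := euclid_norm _ => h.
have N0 : 0 <= N by exact: sqrtr_ge0.
have {h N0}Nz : N = 0.
  apply/eqP; rewrite eq_le N0 andbT -(pmulr_rle0 _ (_ : 0 < 1 - c)) ?subr_gt0//.
  by rewrite mulrBl mul1r subr_le0.
have /eqP := Nz; rewrite /N /euclid_norm sqrtr_eq0 => h0.
apply/rowP => i; apply/eqP; rewrite -subr_eq0 -sqrf_eq0 eq_le sqr_ge0 andbT.
apply: le_trans h0; rewrite (bigD1 i)//= !mxE lerDl.
by apply: sumr_ge0 => j _; exact: sqr_ge0.
Qed.

Section geometry.
Context (R : realType) (n : nat) (S : pcf_fractal R n) (X : fractafold S).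
Local Notation E := 'rV[R]_n.
Local Notation K := (fset_of S).

(** Boundary points are fixed points of the maps, and a contraction has at most one. *)
Lemma bdry_finite : finite_set (bdry S).
Proof.
have [fixd _] := fractal_pcf S.
apply: (@sub_finite_set _ _ (\bigcup_(i in [set: 'I_(nmaps S)]) [set x | @ifs _ _ S i x = x])).
  by move=> x /fixd[i h]; exists i.
apply: bigcup_finite => // i _.
have [[x fx]|nx] := pselect (exists x, @ifs _ _ S i x = x); last first.
  by rewrite (_ : [set x | _] = set0)//; apply/seteqP; split => // x fx; apply: nx; exists x.
apply: (sub_finite_set _ (finite_set1 x)) => y /= fy.
exact: (contraction_fixed_unique _ _ _ _ _ (@ifs_contraction _ _ S i) fy fx).
Qed.

Lemma finite_closed (A : set E) : finite_set A -> closed A.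
Proof.
by move=> fA; apply: compact_closed; [exact: norm_hausdorff|exact: finite_compact].
Qed.

Definition cells_at (x : X) : set (cell X) := [set c | exists2 y, K y & chart c y = x].

Hypothesis nobdry : without_boundary X.

(** A boundary point is identified with exactly one other, so a point lies in at most two cells. *)
Lemma cells_at_finite x : finite_set (cells_at x).
Proof.
have [c [y Ky cyx]] := chart_cover x.
have [by_|nby] := pselect (bdry S y).
  have [p [_ uniqp]] := nobdry c y by_.
  apply: (sub_finite_set _ (finite_set2 c p.1)) => c' [y' Ky' e] /=.
  have [[-> _]|[by' _]] := chart_glue Ky' Ky (etrans e (esym cyx)); first by left.
  have [[-> _]|ne] := pselect ((c', y') = (c, y)); first by left.
  by right; rewrite (uniqp (c', y')); split => //=; rewrite e.
apply: (sub_finite_set _ (finite_set1 c)) => c' [y' Ky' e] /=.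
by have [[-> _]|[]] := chart_glue Ky' Ky (etrans e (esym cyx)).
Qed.

Definition star (x : X) : set X := [set z | cells_at z `<=` cells_at x].

(** In a cell at x, a point off the star lies in a second cell too, hence is a boundary point; there
    are finitely many, so they form a closed set. The other cells do not meet the star. *)
Lemma star_open x : open (star x).
Proof.
apply/chart_open => c.
have [cx|ncx] := pselect (cells_at x c); last first.
  exists set0; first exact: open0.
  by move=> y Ky; split => // sy; apply: ncx; apply: sy; exists y.
exists (~` [set y | K y /\ ~ star x (chart c y)]).
  rewrite openC; apply: finite_closed; apply: sub_finite_set bdry_finite.
  move=> y [Ky ns]; apply: contrapT => nb; apply: ns => c' [y' Ky' e].
  by have [[-> _]|[]] := chart_glue Ky' Ky e.
by move=> y Ky; split => [h [_]//|h]; apply: contrapT => ns; apply: h.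
Qed.

(** Finitely many stars cover the space, and each meets only the finitely many cells at its
    center. *)
Lemma compact_finite_cells : compact [set: X] -> finite_set [set: cell X].
Proof.
rewrite compact_cover => cX.
have [|D _ cov] := cX X setT star (fun x _ => star_open x).
  by move=> x _; exists x.
apply: (@sub_finite_set _ _ (\bigcup_(x in [set` D]) cells_at x)).
  have [_ [y Ky] _] := fractal_self_similar S.
  move=> c _; have [x Dx sx] := cov (chart c y) I.
  by exists x => //; apply: sx; exists y.
by apply: bigcup_finite => // x _; exact: cells_at_finite.
Qed.

Lemma compact_volume : compact [set: X] -> (volume X setT < +oo)%E.
Proof.
move=> /compact_finite_cells fX.
have [muK _] := fractal_measure S.
rewrite volumeE// (@eq_esum _ _ _ _ (fun=> 1%E)); last first.
  by move=> c _; rewrite -muK; congr (fmeasure S _); apply/seteqP; split => // y [].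
rewrite esum_fset// fsbig_finite//=.
by elim/big_ind: _ => [||x y]; rewrite ?ltry//; exact: lte_add_pinfty.
Qed.

End geometry.

(** * Spectrum and spectral measure of one factor *)

Section fractafold_spectrum.
Context (R : realType) (n : nat) (S : pcf_fractal R n) (X : fractafold S).
Local Notation E := 'rV[R]_n.
Local Notation K := (fset_of S).
Local Notation B := (borel X).
Local Notation mu := (volume X).

Lemma fenergyN (v : X -> R) : fenergy (fun x => - v x) = fenergy v.
Proof.
apply: eq_esum => c _.
rewrite (_ : _ \o _ = (fun y => -1 * (v \o chart c) y)); last first.
  by apply/funext => y /=; rewrite mulN1r.
by rewrite (energyZ (fractal_energy S)) sqrrN expr1n mul1e.
Qed.

Lemma fenergy0 : fenergy (fun _ : X => 0 : R) = 0%E.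
Proof. by apply: esum1 => c _; apply/(energy_eq0 (fractal_energy S)). Qed.

Lemma laplacian0 : laplacian (fun _ : B => 0 : R) (fun=> 0).
Proof.
split; first exact: realL2_0.
exists (fun=> 0); split; [|exact: ae_eq_refl|].
  by split; [exact: realL2_0|rewrite fenergy0 ltry].
move=> v _; rewrite /fenergy2.
rewrite (_ : (fun x => 0 + v x) = v); last by apply/funext => x; rewrite add0r.
rewrite (_ : (fun x => 0 - v x) = (fun x => - v x)); last by apply/funext => x; rewrite sub0r.
rewrite fenergyN subrr mul0r.
rewrite (@eq_Rintegral _ _ _ _ _ (cst 0)) => [|x _]; last by rewrite mul0r.
by rewrite /Rintegral integral0 oppr0.
Qed.

Lemma claplacian0 : claplacian (fun _ : B => 0 : R[i]) (fun=> 0).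
Proof. by split; exact: laplacian0. Qed.

(** An eigenfunction is a second solution of the homogeneous resolvent equation. This transfers the
    gap, stated for the spectrum, to eigenvalues. *)
Lemma eigenvalue_spectrum l : @lap_eigenvalue R n S X l -> spectrum X l.
Proof.
move=> [phi [hphi ephi] nphi] [C H].
have [u [_ _ uniq_u]] := H (fun=> 0) (L2_0 _ _ _ mu).
have zero : resolvent_eq l (fun _ : B => 0 : R[i]) (fun=> 0).
  split; first exact: L2_0.
  rewrite (_ : (fun x : B => - (rtoc l * 0) - 0) = (fun=> 0)); first exact: claplacian0.
  by apply/funext => x; rewrite mulr0 subr0 oppr0.
have phi0 : resolvent_eq l phi (fun=> 0).
  split => //; rewrite (_ : (fun x => _ - 0) = (fun x => - (rtoc l * phi x)))//.
  by apply/funext => x; rewrite subr0.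
apply: nphi; have := uniq_u _ zero; have := uniq_u _ phi0.
move=> h1 h2; apply: filterS2 h1 h2 => x h1 h2 _.
by rewrite h1// -h2.
Qed.

Variable P1 : set R -> (B -> R[i]) -> (B -> R[i]).
Hypothesis res : spectral_resolution P1.

Lemma eigenfunctionP l (phi : B -> R[i]) : L2 mu phi ->
  eigenfunction l phi <->
  spectral_integral mu P1 setT (fun l : R => rtoc l) phi (fun x => rtoc l * phi x).
Proof.
move=> hphi; have [_ H] := res.
have hl : L2 mu (fun x => - (rtoc l * phi x)).
  by under eq_fun do rewrite -mulNr; exact: L2_scale.
have := H phi _ hphi hl.
rewrite (_ : (fun x => - - _) = (fun x => rtoc l * phi x)); last first.
  by apply/funext => x; rewrite opprK.
by move=> <-; split => [[]|].
Qed.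

Lemma heat_kernel_bounded h (c1 c2 gamma d t : R) : 0 < c1 -> 0 < c2 -> 0 < t -> heat_kernel P1 h ->
  (forall x y : X, ((h t x y)%:E <= (c1 * t `^ (- (d / (d + 1))))%R%:E *
          expeR (- (c2%:E * (poweR (poweR (resistance x y) (d + 1)%R
                                      * (t^-1)%R%:E) gamma))))%E) ->
  forall x y, `|h t x y| <= c1 * t `^ (- (d / (d + 1))).
Proof.
move=> c10 c20 t0 hk est x y; have [_ h0 _] := hk t t0.
rewrite ger0_norm// -lee_fin; apply: (le_trans (est x y)).
rewrite -[leRHS]mule1; apply: lee_wpmul2l.
  by rewrite lee_fin mulr_ge0 ?powR_ge0 ?(ltW c10).
rewrite -expeR0 lee_expeR oppe_le0; apply: mule_ge0; last exact: poweR_ge0.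
by rewrite lee_fin ltW.
Qed.

Lemma eigenvalue_free_null (d : R) (Z : set R) u : without_boundary X ->
  (~ compact [set: X] -> pure_point_spectrum X) -> heat_kernel_estimate P1 d ->
  measurable Z -> (forall l, Z l -> 0 < l) -> (forall l, Z l -> ~ @lap_eigenvalue R n S X l) ->
  L2 mu u -> P1 Z u = (fun=> 0) %[ae mu].
Proof.
move=> nobdry pp [h [c1 [c2 [gamma [hk c10 c20 g0 est]]]]] mZ Zpos Zev hu.
have HP := res.1.
have noev l phi : Z l -> L2 mu phi ->
     spectral_integral mu P1 setT (fun l : R => rtoc l) phi (fun x => rtoc l * phi x) ->
     phi = (fun=> 0) %[ae mu].
  move=> Zl hphi sp; apply: contrapT => nz; apply: (Zev l Zl); exists phi => //.
  exact/eigenfunctionP.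
have [cX|ncX] := pselect (compact [set: X]); last first.
  apply: (pure_point_null _ _ _ _ _ HP) => // e e0.
  have [k [l [phi [ephi he]]]] := pp ncX u hu e e0.
  exists k, l, phi; split => // i; have [hi _] := ephi i; split => //.
  exact/eigenfunctionP.
(* In the compact case the kernel at time 1/2, inside the range of the estimate, is bounded. The
   intervals [0, k] exhaust [Z], which consists of positive reals. *)
have Zb (k : nat) : P1 (Z `&` `[0, k%:R]) u = (fun=> 0) %[ae mu].
  have t0 : (0 < 2^-1 :> R) by rewrite invr_gt0.
  have t1 : (2^-1 < 1 :> R) by rewrite invf_lt1// ltr1n.
  have [mh _ sh] := hk _ t0.
  have bound := heat_kernel_bounded h c1 c2 gamma d _ c10 c20 t0 hk (fun x y => est _ x y (introT andP (conj t0 t1))).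
  apply: (no_atoms_null _ _ _ _ (compact_volume _ _ _ _ nobdry cX) _ HP _ _ _ mh bound t0 sh _ 0 k%:R) => //.
    exact: measurableI.
  move=> l v [Zl _] hv; apply: (noev l) => //.
    by apply: (spm_L2 HP) => //; exact: measurable_set1.
  exact: (atom_eigen _ _ _ _ _ HP).
have [m hm] := spm_sigma_additive HP hu.
apply: normsq_eq0; first exact: (spm_L2 HP).
apply: EFin_inj; rewrite -hm//.
apply: (measure_null_bigcup _ _ (fun k : nat => Z `&` `[0, k%:R])) => // [k|k|l Zl].
- exact: measurableI.
- have mk : measurable (Z `&` `[0, k%:R] : set R) by exact: measurableI.
  by rewrite hm// normsq_ae0//; exact: (spm_L2 HP).
have [k lk] : exists k : nat, l < k%:R by exists (Num.truncn l).+1; exact: truncnS_gt.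
by exists k => //; split => //; rewrite /= in_itv/= (ltW lk) (ltW (Zpos _ Zl)).
Qed.

End fractafold_spectrum.

(** * Measurability of the symbols and the final comparison *)

Lemma thick_open (R : realType) (A : set R) (r : R) : open (thick R A r).
Proof. by rewrite openE => x hx; exact: thick_near. Qed.

Lemma symbol_measurable (R : realType) (d : R) (m : int) (p : R * R -> R[i]) : symbol d m p ->
  measurable_fun (@quadrant R) (@complex.Re R \o p) /\
  measurable_fun (@quadrant R) (@complex.Im R \o p).
Proof.
move=> [sm _]; split; apply: continuous_open_measurable; [exact: quadrant_open| |exact: quadrant_open|];
  by move=> l Ql; have [] := sm 0%N 0%N l Ql.
Qed.

Theorem proposition6p8 (R : realType) (n : nat) (S : pcf_fractal R n)
    (X : fractafold S)
    (P1 : set R -> (borel X -> R[i]) -> (borel X -> R[i]))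
    (P : set (R * R) -> (borel X * borel X -> R[i]) ->
         (borel X * borel X -> R[i]))
    (d alpha beta : R) (m : int) (p : R * R -> R[i]) :
  without_boundary X ->
  spectral_resolution P1 ->
  product_resolution P1 P ->
  (~ compact [set: X] -> pure_point_spectrum X) ->
  0 < d ->
  heat_kernel_estimate P1 d ->
  spectral_gap X alpha beta ->
  quasielliptic (@lap_eigenvalue R n S X) alpha beta d m p ->
  exists q : R * R -> R[i],
    elliptic d m q /\
    forall u w : borel X * borel X -> R[i], pdo P p u w <-> pdo P q u w.
Proof.
move=> nobdry res [HP prodP] pp d0 hke [ab gap] qe.
have gapE (l l' : R) : 0 < l -> 0 < l' -> lap_eigenvalue X l -> lap_eigenvalue X l' -> l <> l' ->
    ~ (alpha < l / l' < beta).
  move=> l0 l'0 el el' ll'; apply: gap => //; try exact: eigenvalue_spectrum.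
  by apply/eqP; rewrite gt_eqF.
have [q [del [ellq del0 qp]]] := elliptic_off_empty_cones R _ alpha beta d m p ab gapE qe.
exists q; split => //.
(* Where both logarithms lie in this neighbourhood, q = p. It is open, so [Z] is Borel whatever the
   set of eigenvalues looks like, and it contains the logarithms of all positive eigenvalues, so [Z]
   is free of eigenvalues. *)
pose Occ := thick R (log_ev R (lap_eigenvalue X)) del.
pose Z : set R := `]0, +oo[ `&` (setT `&` @ln R @^-1` (~` Occ)).
have mZ : measurable Z.
  apply: measurableI => //; apply: measurable_ln => //; apply: measurableC.
  by apply: open_measurable; exact: thick_open.
have Z0 l : Z l -> 0 < l by move=> [+ _]; rewrite /= in_itv/= andbT.
have Zev l : Z l -> ~ lap_eigenvalue X l.
  move=> Zl el; have [_ [_ nOcc]] := Zl; apply: nOcc; exists (ln l).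
    by rewrite /log_ev/= lnK// posrE; exact: Z0.
  by rewrite subrr normr0.
pose N := Z `*` setT `|` setT `*` Z.
have mN : measurable N by apply: measurableU; exact: measurableX.
have mQ : measurable (@quadrant R) by apply: open_prod_measurable; exact: quadrant_open.
have [mpR mpI] := symbol_measurable _ _ _ _ qe.1.
have [mqR mqI] := symbol_measurable _ _ _ _ ellq.1.
have pqE l : quadrant l -> ~ N l -> q l = p l.
  move=> Ql nN; have [l1 l2] := Ql.
  apply: qp => //; apply: contrapT => nO; apply: nN; [left|right]; split => //; split => //;
    by rewrite /= in_itv/= andbT.
have null u : L2 (volume X \x volume X)%E u -> normsq (volume X \x volume X)%E (P N u) = 0.
  move=> hu; apply: normsq_ae0; first exact: (spm_L2 HP).
  apply: (tensor_null_cross _ _ _ _ P1 P HP prodP) => // v hv.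
  exact: (eigenvalue_free_null _ _ _ _ _ res d).
move=> u w; split; apply: (spectral_integral_congr _ _ _ _ _ _ P _ N) => //;
  first by move=> l Ql nN; rewrite pqE.
- exact: null.
- exact: null.
Qed.
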